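(* Let $k$ be a field of characteristic $p>0$ and let $(\mathcal{B},\pi)$ be a coordinate $k$-algebra scheme. Assume that $B:=\mathcal{B}(k^{\mathrm{alg}})$ is local and that the nilradical of $B$ coincides with the kernel of the Frobenius homomorphism on $B$. Then the theory $\mathcal{B}\text{-}\mathrm{DCF}$ eliminates quantifiers in the language $L^\partial_{\lambda_0}$.
   Context: A coordinate $k$-algebra scheme $(\mathcal{B},\pi)$ consists of a functor $\mathcal{B}$ from $k$-algebras to $k$-algebras whose underlying functor to additive groups is $R\mapsto (R^{e},+)$, $e=d+1$ (i.e. $\mathcal{B}$ is a $k$-algebra scheme with additive group $\mathbb{G}_{\mathrm a}^{e}$, whose multiplication and $k$-algebra structure are given by polynomials over $k$), together with a natural transformation $\pi\colon\mathcal{B}\to\mathrm{id}$ of functors to $k$-algebras, given by projection onto the first coordinate. A $\mathcal{B}$-operator on a $k$-algebra $R$ is a $k$-algebra homomorphism $\partial\colon R\to\mathcal{B}(R)$ such that $\pi_R\circ\partial=\mathrm{id}_R$. In coordinates, $\partial(r)=(r,\partial_1(r),\dots,\partial_d(r))$, so a $\mathcal{B}$-operator is the same as a suitable tuple of maps $\partial_1,\dots,\partial_d\colon R\to R$. For example, derivations correspond to $\mathcal{B}(R)=R[\varepsilon]/(\varepsilon^2)$, and derivations of the $n$-th power of Frobenius correspond to $\mathcal{B}(R)=R\times R$ with multiplication $(x,y)(x',y')=(xx',x^{p^n}y'+x'^{p^n}y)$. A $\mathcal{B}$-field is a field extension of $k$ together with a $\mathcal{B}$-operator. $k^{\mathrm{alg}}$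 is an algebraic closure of $k$. The Frobenius homomorphism on $B$ is $b\mapsto b^p$. $\mathcal{B}\text{-}\mathrm{DCF}$ denotes the model companion of the theory of $\mathcal{B}$-fields in the language $L^\partial$ of fields (with constants for the elements of $k$) together with unary function symbols $\partial_1,\dots,\partial_d$; for $B$ as in the claim, its existence is a result of Gogolok–Kowalski, building on Beyarslan–Hoffmann–Kamensky–Kowalski. $L^\partial_{\lambda_0}$ is $L^\partial$ together with a unary function symbol $\lambda_0$, interpreted in a field $K$ of characteristic $p$ as the inverse of the Frobenius map on $K^p$ (i.e. $\lambda_0(x^p)=x$) and as zero on $K\setminus K^p$; $\mathcal{B}\text{-}\mathrm{DCF}$ is considered in this language by adding this definition of $\lambda_0$. *)

(* Defs.v *)
From HB Require Import structures.
From mathcomp Require Import all_boot all_algebra.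

Set Implicit Arguments.
Unset Strict Implicit.
Unset Printing Implicit Defensive.

Import GRing.Theory.
Local Open Scope ring_scope.

(* All languages below have only function symbols (constants are the symbols
   of arity 0); the sole relation is equality. *)
Record language := Language { fsym : Type; arity : fsym -> nat }.

Inductive term (L : language) : Type :=
| Var of nat
| App (f : fsym L) of ('I_(arity f) -> term L).

Arguments Var {L}.
Arguments App {L}.

Inductive formula (L : language) : Type :=
| Eq of term L & term L
| Bot
| Imp of formula L & formula L
| All of nat & formula L.

Arguments Bot {L}.

Record structure (L : language) := Structure {
  carrier :> Type;
  interp : forall f : fsym L, ('I_(arity f) -> carrier) -> carrier }.

Section Semantics.
Context (L : language).

Definition update (M : Type) (e : nat -> M) (n : nat) (x : M) : nat -> M :=
  fun m => if m == n then x else e m.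

Fixpoint eval (M : structure L) (e : nat -> M) (t : term L) : M :=
  match t with
  | Var n => e n
  | App f a => interp (fun i => eval e (a i))
  end.

Fixpoint sat (M : structure L) (e : nat -> M) (phi : formula L) : Prop :=
  match phi with
  | Eq t u => eval e t = eval e u
  | Bot => False
  | Imp phi psi => sat e phi -> sat e psi
  | All n phi => forall x : M, sat (update e n x) phi
  end.

Fixpoint in_term (n : nat) (t : term L) : Prop :=
  match t with
  | Var m => n = m
  | App f a => exists i, in_term n (a i)
  end.

Fixpoint free_in (n : nat) (phi : formula L) : Prop :=
  match phi with
  | Eq t u => in_term n t \/ in_term n u
  | Bot => False
  | Imp phi psi => free_in n phi \/ free_in n psi
  | All m phi => n <> m /\ free_in n phi
  end.

Fixpoint quantifier_free (phi : formula L) : Prop :=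
  match phi with
  | Eq _ _ | Bot => True
  | Imp phi psi => quantifier_free phi /\ quantifier_free psi
  | All _ _ => False
  end.

Definition sentence (phi : formula L) : Prop := forall n, ~ free_in n phi.

Definition theory := formula L -> Prop.

Definition model (T : theory) (M : structure L) : Prop :=
  forall phi, T phi -> forall e : nat -> M, sat e phi.

Definition embedding (M N : structure L) (h : M -> N) : Prop :=
  injective h /\
  forall (f : fsym L) (a : 'I_(arity f) -> M),
    h (interp a) = interp (fun i => h (a i)).

Definition elementary (M N : structure L) (h : M -> N) : Prop :=
  forall (phi : formula L) (e : nat -> M), sat e phi <-> sat (h \o e) phi.

Definition model_complete (T : theory) : Prop :=
  forall (M N : structure L) (h : M -> N),
    model T M -> model T N -> embedding h -> elementary h.

Definition model_companion (T' T : theory) : Prop :=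
  [/\ forall phi, T' phi -> sentence phi,
      model_complete T',
      forall M : structure L, model T M ->
        exists (N : structure L) (h : M -> N), model T' N /\ embedding h
    & forall M : structure L, model T' M ->
        exists (N : structure L) (h : M -> N), model T N /\ embedding h].

Definition eliminates_quantifiers (T : theory) : Prop :=
  forall phi : formula L, exists psi : formula L,
    [/\ quantifier_free psi,
        forall n, free_in n psi -> free_in n phi
      & forall M : structure L, model T M ->
          forall e : nat -> M, sat e phi <-> sat e psi].

End Semantics.

(* The new symbol is [None]. *)
Definition expand (L : language) (n : nat) : language :=
  @Language (option (fsym L)) (fun f => if f is Some g then arity g else n).

Fixpoint lift_term (L : language) (n : nat) (t : term L) : term (expand L n) :=
  match t with
  | Var m => Var m
  | App f a => @App (expand L n) (Some f) (fun i => lift_term n (a i))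
  end.

Fixpoint lift_formula (L : language) (n : nat) (phi : formula L) :
    formula (expand L n) :=
  match phi with
  | Eq t u => Eq (lift_term n t) (lift_term n u)
  | Bot => Bot
  | Imp phi psi => Imp (lift_formula n phi) (lift_formula n psi)
  | All m phi => All m (lift_formula n phi)
  end.

HB.structure Definition FieldAlg (k : fieldType) :=
  {K of GRing.Field K & GRing.ComAlgebra k K}.
Notation fieldAlgType := FieldAlg.type.

HB.structure Definition ClosedFieldAlg (k : fieldType) :=
  {K of GRing.ClosedField K & GRing.ComAlgebra k K}.
Notation closedFieldAlgType := ClosedFieldAlg.type.

Definition algebraic_closure (k : fieldType) (K : closedFieldAlgType k) : Prop :=
  forall x : K, algebraicOver (in_alg K) x.

(* [idealr_closed] already requires the ideal to be proper. *)
Definition maximal_ideal (A : comNzRingType) (m : {pred A}) : Prop :=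
  idealr_closed m /\
  forall J : {pred A}, idealr_closed J -> {subset m <= J} -> J =i m.

Definition local_ring (A : comNzRingType) : Prop :=
  exists m : {pred A}, maximal_ideal m /\
    forall m' : {pred A}, maximal_ideal m' -> m' =i m.

(* The values on objects have underlying group R^e (e = d + 1) and the action
   on a morphism f is [map_mx f], so a functor to k-algebras amounts to natural
   algebra operations on R^e; by Yoneda they are given by polynomials over k.
   The scalar action [cs_scale] is part of the data: it need not be
   coordinatewise. *)
Record coordScheme (k : fieldType) (d : nat) := CoordScheme {
  cs_one : forall R : comAlgType k, 'rV[R]_d.+1;
  cs_mul : forall R : comAlgType k, 'rV[R]_d.+1 -> 'rV[R]_d.+1 -> 'rV[R]_d.+1;
  cs_scale : forall R : comAlgType k, k -> 'rV[R]_d.+1 -> 'rV[R]_d.+1;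
  cs_mulA : forall R, associative (@cs_mul R);
  cs_mulC : forall R, commutative (@cs_mul R);
  cs_mul1 : forall R, left_id (cs_one R) (@cs_mul R);
  cs_mulDl : forall R, left_distributive (@cs_mul R) +%R;
  cs_scaleA : forall (R : comAlgType k) a b (x : 'rV[R]_d.+1),
    cs_scale a (cs_scale b x) = cs_scale (a * b) x;
  cs_scale1 : forall R, left_id 1 (@cs_scale R);
  cs_scaleDr : forall R, right_distributive (@cs_scale R) +%R;
  cs_scaleDl : forall (R : comAlgType k) (x : 'rV[R]_d.+1), {morph (@cs_scale R)^~ x : a b / a + b};
  cs_scaleAl : forall (R : comAlgType k) a (x y : 'rV[R]_d.+1),
    cs_scale a (cs_mul x y) = cs_mul (cs_scale a x) y;
  cs_one_nat : forall (R S : comAlgType k) (f : {lrmorphism R -> S}),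
    map_mx f (cs_one R) = cs_one S;
  cs_mul_nat : forall (R S : comAlgType k) (f : {lrmorphism R -> S}) x y,
    map_mx f (cs_mul x y) = cs_mul (map_mx f x) (map_mx f y);
  cs_scale_nat : forall (R S : comAlgType k) (f : {lrmorphism R -> S}) a x,
    map_mx f (cs_scale a x) = cs_scale a (map_mx f x);
  (* the first coordinate is a morphism of k-algebras *)
  cs_pi_one : forall R : comAlgType k, cs_one R 0 0 = 1;
  cs_pi_mul : forall (R : comAlgType k) (x y : 'rV[R]_d.+1), cs_mul x y 0 0 = x 0 0 * y 0 0;
  cs_pi_scale : forall (R : comAlgType k) a (x : 'rV[R]_d.+1), cs_scale a x 0 0 = a *: x 0 0 }.

Definition cs_obj (k : fieldType) (d : nat) (B : coordScheme k d)
  (R : comAlgType k) : Type := 'rV[R]_d.+1.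

Section CoordSchemeObject.
Context (k : fieldType) (d : nat) (B : coordScheme k d) (R : comAlgType k).

HB.instance Definition _ := GRing.Zmodule.copy (cs_obj B R) 'rV[R]_d.+1.

Fact cs_one_neq0 : (cs_one B R : cs_obj B R) != 0.
Proof.
apply/eqP => /(congr1 (fun x : 'rV[R]_d.+1 => x 0 0)) /eqP.
by rewrite cs_pi_one mxE oner_eq0.
Qed.

HB.instance Definition _ := GRing.Zmodule_isComNzRing.Build (cs_obj B R)
  (@cs_mulA k d B R) (@cs_mulC k d B R) (@cs_mul1 k d B R) (@cs_mulDl k d B R)
  cs_one_neq0.

HB.instance Definition _ := GRing.Zmodule_isLmodule.Build k (cs_obj B R)
  (@cs_scaleA k d B R) (@cs_scale1 k d B R) (@cs_scaleDr k d B R)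
  (@cs_scaleDl k d B R).

HB.instance Definition _ := GRing.Lmodule_isLalgebra.Build k (cs_obj B R)
  (@cs_scaleAl k d B R).

HB.instance Definition _ := GRing.Lalgebra_isComAlgebra.Build k (cs_obj B R).

Definition cs_coord (i : 'I_d.+1) (x : cs_obj B R) : R :=
  (x : 'rV[R]_d.+1) 0 i.

Definition cs_pi : cs_obj B R -> R := cs_coord ord0.

Definition B_operator (D : {lrmorphism R -> cs_obj B R}) : Prop :=
  forall r : R, cs_pi (D r) = r.

End CoordSchemeObject.

Record B_field (k : fieldType) (d : nat) (B : coordScheme k d) := BField {
  bf_field :> fieldAlgType k;
  bf_op : {lrmorphism bf_field -> cs_obj B bf_field};
  bf_opP : B_operator bf_op }.

Inductive Ld_sym (k : Type) (d : nat) : Type :=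
| SZero | SOne | SAdd | SOpp | SMul
| SConst of k
| SOp of 'I_d.

Arguments SZero {k d}.
Arguments SOne {k d}.
Arguments SAdd {k d}.
Arguments SOpp {k d}.
Arguments SMul {k d}.

Definition Ld (k : Type) (d : nat) : language :=
  @Language (Ld_sym k d) (fun f =>
    match f with
    | SZero | SOne | SConst _ => 0
    | SOpp | SOp _ => 1
    | SAdd | SMul => 2
    end%N).

Definition B_interp (k : fieldType) (d : nat) (B : coordScheme k d)
    (K : B_field B) (f : Ld_sym k d) :
    ('I_(@arity (Ld k d) f) -> K) -> K :=
  match f return ('I_(@arity (Ld k d) f) -> K) -> K with
  | SZero => fun _ => 0
  | SOne => fun _ => 1
  | SAdd => fun v => v ord0 + v ord_max
  | SOpp => fun v => - v ord0
  | SMul => fun v => v ord0 * v ord_max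
  | SConst c => fun _ => c%:A
  | SOp i => fun v => cs_coord (lift ord0 i) (bf_op K (v ord0))
  end.

Definition B_structure (k : fieldType) (d : nat) (B : coordScheme k d)
  (K : B_field B) : structure (Ld k d) :=
  @Structure (Ld k d) K (@B_interp k d B K).

(* B-fields form an elementary class, whose theory is taken here as the set of
   all sentences that hold in every B-field. *)
Definition theory_of_B_fields (k : fieldType) (d : nat) (B : coordScheme k d) :
    theory (Ld k d) :=
  fun phi => sentence phi /\
    forall (K : B_field B) (e : nat -> B_structure K), sat e phi.

Definition Ld_lambda0 (k : Type) (d : nat) : language := expand (Ld k d) 1.

Section Lambda0.
Context (k : Type) (d : nat).
Notation L := (Ld_lambda0 k d).

Definition tzero : term L :=
  @App L (Some SZero) (fun i => match notF (ltn_ord i) with end).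
Definition tone : term L :=
  @App L (Some SOne) (fun i => match notF (ltn_ord i) with end).
Definition tmul (t u : term L) : term L :=
  @App L (Some SMul) (fun i : 'I_2 => if i == ord0 then t else u).
Definition tpow (t : term L) (n : nat) : term L := iter n (tmul t) tone.
Definition tlambda0 (t : term L) : term L := @App L None (fun=> t).

(* forall x y, y ^ p = x -> lambda0 x = y *)
Definition lambda0_on_powers (p : nat) : formula L :=
  All 0 (All 1 (Imp (Eq (tpow (Var 1) p) (Var 0))
                    (Eq (tlambda0 (Var 0)) (Var 1)))).

(* forall x, (forall y, y ^ p <> x) -> lambda0 x = 0 *)
Definition lambda0_off_powers (p : nat) : formula L :=
  All 0 (Imp (All 1 (Imp (Eq (tpow (Var 1) p) (Var 0)) Bot))
             (Eq (tlambda0 (Var 0)) tzero)).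

Definition add_lambda0 (p : nat) (T : theory (Ld k d)) : theory L :=
  fun phi => [\/ exists2 psi, T psi & phi = lift_formula 1 psi,
                 phi = lambda0_on_powers p
               | phi = lambda0_off_powers p].

End Lambda0.

(* Main.v *)
Require Import Defs.
From HB Require Import structures.
From mathcomp Require Import all_boot all_algebra.
From mathcomp Require Import generic_quotient.
From mathcomp Require Import boolp classical_sets filter.

Set Implicit Arguments.
Unset Strict Implicit.
Unset Printing Implicit Defensive.

Import GRing.Theory.
Local Open Scope classical_set_scope.
Local Open Scope quotient_scope.
Local Open Scope ring_scope.

(** By compactness, quantifiers can be eliminated as soon as two models of the
    companion, with assignments of the same quantifier-free type, agree on every
    formula (qe_criterion). Let A be the substructure of values of terms, common
    to both models M and N. If the fields with operators M and N amalgamate over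
    A, then the amalgam embeds into a model, which by model completeness is an
    elementary extension of M and of N; this is companion_transfer. Formulas with
    the inverse Frobenius are first translated away, its graph being definable.

    Let m be the kernel of the projection of the scheme. Over the algebraic
    closure m is nil (ker_pi_nil): otherwise some b in m has a nonzero eigenvalue
    on the tangent space at the origin, whence a nonconstant polynomial ring
    morphism chi to the field with chi b nonzero; it is onto, so chi (1 - b c) = 0
    for some c, although 1 - b c is a unit of the local ring. By hypothesis x^p = 0
    on m, first over the algebraic closure and then over every algebra
    (frobenius_kernel). So in the scheme x^p only depends on the first coordinate
    r of x; it is sigma r, for a natural ring morphism sigma lifting Frobenius.
    Consequences: an element is invertible when its first coordinate is, hence
    operators extend to fractions and to quotients by stable primes; and a p-th
    root of a can be adjoined to a field with operator when the operator sends a to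
    sigma (a^(1/p)). In a model of the companion such constants a are therefore
    p-th powers (companion_constants).

    Let K be the field of fractions of A inside M. Closure of A under the inverse
    Frobenius says that elements of K which are p-th powers in M are p-th powers in
    K. The key step (independent_pow) is that M is then separable over K: p-th
    powers of K-independent elements are K-independent. A minimal relation between
    the c_i^p, transformed by the operator and compared with its image under sigma,
    yields relations between higher powers of the c_i with fewer terms, which are
    trivial by induction; so its coefficients are constants, hence p-th powers in
    K, and the relation is the p-th power of one between the c_i.

    Separability makes the tensor product of M and N over K reduced
    (tensor_reduced): write an element with independent left factors and raise it to
    the p-th power. The operators of M and N induce one on the tensor product, and
    a minimal prime of a reduced ring is stable under any operator
    (operator_reduced), so its residue field is the amalgam. *)


(** * Ultraproducts and compactness *)

Section Ultraproduct.
Context (L : language) (I : Type) (U : set_system I) (UU : UltraFilter U).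
Context (M : I -> structure L).

Notation T := {classic (forall i, M i)}.

Definition ultra_eq : rel T := fun f g => `[< U [set i | f i = g i] >].

Lemma ultra_eq_equiv : equiv_class_of ultra_eq.
Proof.
split=> [f|f g|f g h].
- by apply/asboolP; apply: filterS filterT => i _.
- by apply/asboolP/asboolP; apply: filterS => i /= ->.
- move=> /asboolP gf /asboolP fh; apply/asboolP.
  by apply: filterS2 gf fh => i /= -> ->.
Qed.

Canonical ultra_equiv := EquivRelPack ultra_eq_equiv.

Definition ultraproduct : structure L :=
  @Structure L {eq_quot ultra_equiv}
    (fun f a => \pi_({eq_quot ultra_equiv}) (fun i => interp (fun j => (repr (a j) : T) i))).

Definition ultra_class (f : forall i, M i) : ultraproduct := \pi_({eq_quot ultra_equiv}) (f : T).

Lemma ultra_classP (f g : forall i, M i) :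
  ultra_class f = ultra_class g <-> U [set i | f i = g i].
Proof.
split=> [/eqmodP/asboolP //|h]; exact/eqmodP/asboolP.
Qed.

Lemma ultra_class_repr (x : ultraproduct) : ultra_class (repr x) = x.
Proof. exact: reprK. Qed.

Lemma ultra_eval (e : nat -> forall i, M i) (t : term L) :
  eval (fun n => ultra_class (e n)) t = ultra_class (fun i => eval (e^~ i) t).
Proof.
elim: t => [n|f a IH] //=; apply/ultra_classP => /=.
have fin_and (m : nat) (P : 'I_m -> set I) :
    (forall j, U (P j)) -> U [set i | forall j, P j i].
  elim: m P => [|m IHm] P UP; first by apply: filterS filterT => i _ [].
  have Ulift : U [set i | forall j, P (lift ord0 j) i] by exact: IHm.
  apply: filterS2 (UP ord0) Ulift => i /= P0 PS j.
  by case: (unliftP ord0 j) => [j'|] ->.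
have Uargs : U [set i | forall j, (repr (eval (fun n => ultra_class (e n)) (a j)) : T) i
                            = eval (e^~ i) (a j)].
  by apply: fin_and => j; apply/ultra_classP; rewrite ultra_class_repr IH.
apply: filterS Uargs => i /= eqa.
by congr interp; apply/funext => j; exact: eqa.
Qed.

Lemma ultra_not (A : set I) : ~ U A -> U (~` A).
Proof.
by move=> nUA; have [//|] := in_ultra_setVsetC A UU.
Qed.

(** Ultrafilters commute with implication because they decide every set, and
    with universal quantification by choosing one witness per coordinate. *)
Lemma los (phi : formula L) (e : nat -> forall i, M i) :
  sat (fun n => ultra_class (e n)) phi <-> U [set i | sat (e^~ i) phi].
Proof.
elim: phi e => [t u||phi IH1 psi IH2|n phi IH] e /=.
- by rewrite !ultra_eval ultra_classP.
- split=> // U0; have : U set0 by apply: filterS U0.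
  by have := @filter_not_empty _ _ (@ultra_proper _ _ UU).
- split=> [h|h /IH1 h1]; last by apply/IH2; apply: filterS2 h h1 => i /= h; exact: h.
  have [/IH1/h/IH2 h2|/ultra_not nh] := pselect (U [set i | sat (e^~ i) phi]).
    by apply: filterS h2 => i /= ? _.
  by apply: filterS nh => i /= nh /nh.
- have upd (x : forall i, M i) : update (fun n => ultra_class (e n)) n (ultra_class x)
      = (fun m => ultra_class (update e n x m)).
    by apply/funext => m; rewrite /update; case: eqP.
  have upd' (x : forall i, M i) i :
      update (e^~ i) n (x i) = (update e n x)^~ i.
    by apply/funext => m; rewrite /update; case: eqP.
  split=> [h|h x]; last first.
    rewrite -[x]ultra_class_repr upd IH.
    by apply: filterS h => i /= h; rewrite -upd'; exact: h.
  apply: contrapT => /ultra_not nh.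
  have ex i : exists x : M i,
      ~ sat (update (e^~ i) n x) phi \/ forall x, sat (update (e^~ i) n x) phi.
    have [[x nx]|nx] := pselect (exists x : M i, ~ sat (update (e^~ i) n x) phi).
      by exists x; left.
    exists (e 0%N i); right => x; apply: contrapT => nsx; apply: nx; by exists x.
  pose x i := sval (cid (ex i)).
  have := h (ultra_class x); rewrite upd IH => hx.
  have : U set0; last exact: (@filter_not_empty _ _ (@ultra_proper _ _ UU)).
  apply: filterS2 nh hx => i /= nh hx; apply: nh => y.
  have [|] := svalP (cid (ex i)); last exact.
  by case; have := upd' x i; rewrite /x => ->.
Qed.

End Ultraproduct.

(** Index the ultraproduct by the finite lists of formulas, with an ultrafilter
    containing every cone of lists that extend a given one. *)
Lemma compactness (L : language) (T : theory L) (S : set (formula L)) :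
  (forall s : seq {classic (formula L)}, (forall phi : {classic (formula L)}, phi \in s -> S phi) ->
     exists (M : structure L) (e : nat -> M),
       model T M /\ forall phi : {classic (formula L)}, phi \in s -> sat e phi) ->
  exists (M : structure L) (e : nat -> M),
    model T M /\ forall phi, S phi -> sat e phi.
Proof.
move=> fin; pose I := seq {classic (formula L)}.
have /choice[M0 M0P] : forall s : I, exists Me : {M : structure L & nat -> M},
    model T (projT1 Me) /\ forall phi : {classic (formula L)}, phi \in s -> S phi -> sat (projT2 Me) phi.
  move=> s; have [phi|M [e [TM sM]]] := fin [seq phi <- s | `[< S phi >]].
    by rewrite mem_filter => /andP[/asboolP].
  exists (existT _ M e); split=> // phi phis Sphi; apply: sM.
  by rewrite mem_filter phis andbT; apply/asboolP.
pose F : set_system I := [set A | exists s : I, forall s' : I, {subset s <= s'} -> A s'].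
have FF : ProperFilter F.
  apply: Build_ProperFilter_ex; first by move=> A [s As]; exists s; exact: As.
  split=> [|A C [s As] [s' Cs']|A C AC [s As]]; first by exists [::].
    by exists (s ++ s') => r sr; split; [apply: As|apply: Cs'] => x xs; apply: sr;
      rewrite mem_cat xs ?orbT.
  by exists s => s' ss'; apply: AC; exact: As.
have [U [UU FU]] := ultraFilterLemma FF.
pose M s := projT1 (M0 s).
exists (ultraproduct UU M), (fun n => ultra_class UU (fun s => projT2 (M0 s) n)).
split=> [phi Tphi e|phi Sphi].
  have -> : e = (fun n => ultra_class UU (fun s => (repr (e n) : {classic forall i, M i}) s)).
    by apply/funext => n; rewrite ultra_class_repr.
  apply/los; apply: filterS filterT => s _; exact: (proj1 (M0P s)).
apply/los; apply: FU; exists [:: phi : {classic _}] => s sub /=.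
by apply: (proj2 (M0P s)) => //; apply: sub; rewrite inE eqxx.
Qed.

(** * A semantic criterion for quantifier elimination *)

Section Criterion.
Context (L : language).
Implicit Types (M N : structure L) (phi psi : formula L) (T : theory L).

Lemma eval_free M (e e' : nat -> M) t :
  (forall n, in_term n t -> e n = e' n) -> eval e t = eval e' t.
Proof.
elim: t => [n|f a IH] /= ee'; first exact: ee'.
by congr interp; apply/funext => i; apply: IH => n ni; apply: ee'; exists i.
Qed.

Lemma sat_free M phi (e e' : nat -> M) :
  (forall n, free_in n phi -> e n = e' n) -> sat e phi <-> sat e' phi.
Proof.
elim: phi e e' => [t u||phi IH1 psi IH2|n phi IH] e e' /= ee'.
- by rewrite (@eval_free _ e e' t) ?(@eval_free _ e e' u) // => n nu; apply: ee'; auto.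
- by [].
- have [h1 h1'] : sat e phi <-> sat e' phi by apply: IH1 => n nu; apply: ee'; auto.
  have [h2 h2'] : sat e psi <-> sat e' psi by apply: IH2 => n nu; apply: ee'; auto.
  by split; auto.
- have upd x : sat (update e n x) phi <-> sat (update e' n x) phi.
    apply: IH => m mphi; rewrite /update; case: eqP => // /nesym nm.
    by apply: ee'; split=> // /esym.
  by split=> h x; apply/upd.
Qed.

Definition Neg phi := Imp phi Bot.
Definition Conj phi psi := Neg (Imp phi (Neg psi)).

Lemma sat_conj M (e : nat -> M) phi psi :
  sat e (Conj phi psi) <-> sat e phi /\ sat e psi.
Proof.
rewrite /=; split=> [h|[h1 h2] h]; last exact: h.
by split; apply: contrapT => n; apply: h => h1 ?.
Qed.

Definition conjs (s : seq (formula L)) := foldr Conj (Neg Bot) s.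

Lemma sat_conjs M (e : nat -> M) (s : seq {classic (formula L)}) :
  sat e (conjs s) <-> forall phi : {classic (formula L)}, phi \in s -> sat e phi.
Proof.
elim: s => [|phi s IH]; first by split=> // _ ?.
rewrite -[conjs _]/(Conj phi (conjs s)) sat_conj IH; split=> [[h1 h2] psi|h].
  by rewrite in_cons => /orP[/eqP->|/h2].
by split=> [|psi psis]; apply: h; rewrite in_cons ?eqxx ?psis ?orbT.
Qed.

Definition qf_over phi psi :=
  quantifier_free psi /\ forall n, free_in n psi -> free_in n phi.

Lemma qf_over_conjs phi (s : seq {classic (formula L)}) :
  (forall psi : {classic (formula L)}, psi \in s -> qf_over phi psi) -> qf_over phi (conjs s).
Proof.
elim: s => [|psi s IH] qs; first by split=> // n [].
have [q1 f1] : qf_over phi psi by apply: qs; rewrite in_cons eqxx.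
have [q2 f2] : qf_over phi (conjs s) by apply: IH => x xs; apply: qs; rewrite in_cons xs orbT.
split=> [|n] /=; first by [].
by move=> [[/f1|[/f2|[]]]|[]].
Qed.

(** Two applications of compactness: otherwise the quantifier-free
    consequences of [phi] would have a model where [phi] fails, and the
    quantifier-free type realised there would be consistent with [phi]. *)
Lemma qe_criterion T :
  (forall phi M N (e : nat -> M) (e' : nat -> N), model T M -> model T N ->
     (forall psi, qf_over phi psi -> sat e psi <-> sat e' psi) ->
     sat e phi -> sat e' phi) ->
  eliminates_quantifiers T.
Proof.
move=> crit phi.
pose G : set (formula L) := [set psi | qf_over phi psi /\
  forall M, model T M -> forall e : nat -> M, sat e phi -> sat e psi].
have [[s [sG sP]]|nex] := pselect (exists s : seq {classic (formula L)},
    (forall psi : {classic (formula L)}, psi \in s -> G psi) /\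
    forall M (e : nat -> M), model T M -> sat e (conjs s) -> sat e phi).
  have [q f] : qf_over phi (conjs s) by apply: qf_over_conjs => psi /sG[].
  exists (conjs s); split=> // M TM e; split=> [ephi|]; last exact: sP.
  by apply/sat_conjs => psi /sG[_]; apply.
exfalso.
have [s sS|N [e' [TN Ne']]] := @compactness L T (G `|` [set Neg phi]).
  apply: contrapT => nM; apply: nex.
  exists [seq psi <- s | psi != (Neg phi : {classic _})]; split=> [psi|M e TM].
    rewrite mem_filter => /andP[/eqP npsi /sS[]//].
  move/sat_conjs => sM; apply: contrapT => nphi; apply: nM; exists M, e.
  split=> // psi psis; have [->//|npsi] := eqVneq psi (Neg phi : {classic _}).
  by apply: sM; rewrite mem_filter npsi.
have [s sS|M [e [TM Me]]] := @compactness L T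
    ([set psi | qf_over phi psi /\ sat e' psi] `|` [set phi]).
  pose s' := [seq psi <- s | psi != (phi : {classic _})].
  have s'P (psi : {classic _}) : psi \in s' -> qf_over phi psi /\ sat e' psi.
    by rewrite mem_filter => /andP[/eqP npsi /sS[]//].
  have [q f] : qf_over phi (conjs s') by apply: qf_over_conjs => psi /s'P[].
  apply: contrapT => nM.
  suff : G (Neg (conjs s')).
    move=> Gn; apply: (Ne' (Neg (conjs s'))); first by left.
    by apply/sat_conjs => psi /s'P[].
  split; first by split=> [//|n /= [/f|]].
  move=> M TM e ephi /sat_conjs sM; apply: nM; exists M, e; split=> // psi psis.
  have [->//|npsi] := eqVneq psi (phi : {classic _}).
  by apply: sM; rewrite mem_filter npsi.
apply: (Ne' (Neg phi)); first by right.
apply: (crit phi M N e e') => // [psi qpsi|]; last by apply: Me; right.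
split=> [epsi|e'psi]; last by apply: Me; left.
apply: contrapT => ne'; have : sat e (Neg psi); last by move=> /(_ epsi).
by apply: Me; left; case: qpsi => q f; split=> //; split=> // n [/f|[]].
Qed.

End Criterion.

(** * Eliminating the defined function *)

Lemma term_bound (L : language) (t : term L) :
  exists b, forall n, in_term n t -> (n < b)%N.
Proof.
elim: t => [n|f a /choice[b bP]] /=; first by exists n.+1 => m ->.
exists (\max_i b i)%N => n [i /bP nb].
exact: leq_trans nb (leq_bigmax i).
Qed.

Lemma formula_bound (L : language) (phi : formula L) :
  exists b, forall n, free_in n phi -> (n < b)%N.
Proof.
elim: phi => [t u||phi [b bP] psi [c cP]|m phi [b bP]] /=.
- have [b bP] := term_bound t; have [c cP] := term_bound u.
  by exists (maxn b c) => n [/bP|/cP] h; rewrite leq_max h ?orbT.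
- by exists 0%N.
- by exists (maxn b c) => n [/bP|/cP] h; rewrite leq_max h ?orbT.
- by exists b => n [_ /bP].
Qed.

Section Translation.
Context (L : language).

Definition Ex n (phi : formula L) := Neg (All n (Neg phi)).

Lemma sat_ex (M : structure L) (e : nat -> M) n phi :
  sat e (Ex n phi) <-> exists x, sat (update e n x) phi.
Proof.
split=> [h|[x px] h]; last exact: (h x).
by apply: contrapT => nx; apply: h => x px; apply: nx; exists x.
Qed.

Fixpoint Exs b m (phi : formula L) :=
  if m is m'.+1 then Ex (b + m') (Exs b m' phi) else phi.

Definition updates (M : Type) (e : nat -> M) b m (v : nat -> M) : nat -> M :=
  fun x => if (b <= x < b + m)%N then v (x - b)%N else e x.

Lemma sat_exs (M : structure L) (e : nat -> M) b m phi :
  sat e (Exs b m phi) <-> exists v, sat (updates e b m v) phi.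
Proof.
elim: m e => [|m IH] e.
  have -> : (exists v, sat (updates e b 0 v) phi) = sat e phi; last by [].
  have upd v : updates e b 0 v = e.
    by apply/funext => x; rewrite /updates addn0; case: leqP => //= bx; rewrite ltnNge bx.
  by apply/propext; split=> [[v]|]; [rewrite upd|exists e; rewrite upd].
rewrite [Exs _ _ _]/= sat_ex.
have upd x v v' : x = v' m -> (forall i, (i < m)%N -> v i = v' i) ->
    updates (update e (b + m) x) b m v = updates e b m.+1 v'.
  move=> xv vv'; apply/funext => y; rewrite /updates /update addnS ltnS.
  have [by_|by_] /= := leqP b y; last by case: eqP by_ => // ->; rewrite ltnNge leq_addr.
  rewrite -(subnKC by_) ltn_add2l leq_add2l eqn_add2l addKn.
  by case: ltngtP => // [ym|->//]; exact: vv'.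
split=> [[x /IH[v]]|[v]].
  rewrite (@upd _ _ (fun i => if i == m then x else v i)) ?eqxx //; first by exists (fun i => if i == m then x else v i).
  by move=> i; case: ltngtP.
by rewrite -(@upd (v m) v v) // => h; exists (v m); apply/IH; exists v.
Qed.

Lemma updates_out (M : Type) (e : nat -> M) b m v x : (x < b)%N -> updates e b m v x = e x.
Proof. by rewrite /updates ltnNge => /negbTE->. Qed.

Lemma updates_in (M : Type) (e : nat -> M) b m v (i : 'I_m) : updates e b m v (b + i)%N = v i.
Proof. by rewrite /updates leq_addr ltn_add2l ltn_ord addKn. Qed.

Definition reduct n (M : structure (expand L n)) : structure L :=
  @Structure L M (fun f a => @interp (expand L n) M (Some f) a).

Lemma eval_lift n (M : structure (expand L n)) (e : nat -> M) t :
  eval e (lift_term n t) = @eval L (reduct M) e t.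
Proof.
by elim: t => //= f a IH; congr (@interp (expand L n) M (Some f)); apply/funext => i.
Qed.

Lemma sat_lift n (M : structure (expand L n)) (e : nat -> M) phi :
  sat e (lift_formula n phi) <-> @sat L (reduct M) e phi.
Proof.
elim: phi e => [t u||phi IH1 psi IH2|m phi IH] e /=.
- by rewrite !eval_lift.
- by [].
- by rewrite IH1 IH2.
- by split=> h x; apply/IH.
Qed.

Context (C : structure (expand L 1) -> Prop).

(** If the graph of the new symbol is definable on the class [C], terms are
    unnested one symbol at a time, the values of the arguments being quantified
    away in a block of fresh variables. *)
Lemma translate_term
  (graph : forall m n, exists D : formula L, forall M, C M -> forall e : nat -> M,
     @sat L (reduct M) e D <-> e n = @interp _ M None (fun=> e m))
  (t : term (expand L 1)) n :
  exists D : formula L, forall M, C M -> forall e : nat -> M,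
     @sat L (reduct M) e D <-> e n = eval e t.
Proof.
elim: t n => [m|f a IH] n; first by exists (Eq (Var n) (Var m)).
have [b0 b0P] := term_bound (App f a); pose b := maxn b0 n.+1.
have /choice[D DP] := fun i => IH i (b + i)%N.
have [R RP] : exists R : formula L, forall M, C M -> forall e : nat -> M,
    @sat L (reduct M) e R <-> e n = @interp _ M f (fun i => e (b + i)%N).
  case: f a IH b0P D DP => [f|] a _ _ _ _.
    by exists (Eq (Var n) (@App L f (fun i => Var (b + i)%N))).
  have [R RP] := graph (b + 0)%N n; exists R => M CM e; rewrite RP //.
  suff -> : (fun=> e (b + 0)%N) = (fun i : 'I_1 => e (b + i)%N) by [].
  by apply/funext => i; rewrite ord1.
exists (Exs b (@arity (expand L 1) f) (Conj (conjs [seq D i | i <- enum 'I_(@arity (expand L 1) f)]) R)) => M CM e.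
rewrite (@sat_exs (reduct M)).
have evala v i : eval (updates e b (@arity (expand L 1) f) v) (a i) = eval e (a i).
  apply: eval_free => m ma; apply: updates_out; rewrite leq_max b0P //; by exists i.
have nout v : updates e b (@arity (expand L 1) f) v n = e n.
  by apply: updates_out; rewrite leq_max leqnn orbT.
split=> [[v /(@sat_conj L (reduct M))[/(@sat_conjs L (reduct M)) h /(RP M CM)]]|].
  rewrite nout => -> /=; congr interp; apply/funext => i.
  rewrite updates_in -(evala v); apply/esym; rewrite -(@updates_in _ e b _ v).
  by apply/esym/(DP i M CM)/h/map_f; rewrite mem_enum.
move=> en; exists (fun j => if insub j is Some i then eval e (a i) else e 0%N).
set v := fun j => _.
have vP (i : 'I_(@arity (expand L 1) f)) : v i = eval e (a i) by rewrite /v valK.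
apply/(@sat_conj L (reduct M)); split.
  apply/(@sat_conjs L (reduct M)) => _ /mapP[i _ ->].
  by apply/(DP i M CM); rewrite updates_in evala vP.
apply/(RP M CM); rewrite nout en /=; congr interp; apply/funext => i.
by rewrite updates_in vP.
Qed.

Lemma translate
  (graph : forall m n, exists D : formula L, forall M, C M -> forall e : nat -> M,
     @sat L (reduct M) e D <-> e n = @interp _ M None (fun=> e m))
  (phi : formula (expand L 1)) :
  exists D : formula L, forall M, C M -> forall e : nat -> M,
     sat e phi <-> @sat L (reduct M) e D.
Proof.
elim: phi => [t u||phi [D1 D1P] psi [D2 D2P]|n phi [D DP]].
- have [b bP] := term_bound t; have [c cP] := term_bound u.
  pose n := maxn b c.
  have [D DP] := translate_term graph t n; have [E EP] := translate_term graph u n.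
  exists (Ex n (Conj D E)) => M CM e; rewrite (@sat_ex (reduct M)).
  have evalt x : eval (update e n x) t = eval e t.
    apply: eval_free => m mt; rewrite /update; case: eqP => // mn.
    by have := bP _ mt; rewrite mn ltnNge leq_maxl.
  have evalu x : eval (update e n x) u = eval e u.
    apply: eval_free => m mt; rewrite /update; case: eqP => // mn.
    by have := cP _ mt; rewrite mn ltnNge leq_maxr.
  have updn x : update e n x n = x by rewrite /update eqxx.
  split=> [/= tu|[x /(@sat_conj L (reduct M))[/(DP M CM) + /(EP M CM)]]].
    exists (eval e t : reduct M); apply/(@sat_conj L (reduct M)).
    by split; [apply/(DP M CM)|apply/(EP M CM)]; rewrite updn ?evalt ?evalu.
  by rewrite updn evalt evalu /= => <-.
- by exists Bot.
- by exists (Imp D1 D2) => M CM e /=; rewrite (D1P M CM) (D2P M CM).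
- by exists (All n D) => M CM e /=; split=> h x; apply/(DP M CM).
Qed.

End Translation.

(** * The languages of fields with operators *)

Section Terms.
Context (k : Type) (d : nat).
Notation L := (Ld k d).

Definition lzero : term L := @App L SZero (fun i => match notF (ltn_ord i) with end).
Definition lone : term L := @App L SOne (fun i => match notF (ltn_ord i) with end).
Definition lcst c : term L := @App L (SConst d c) (fun i => match notF (ltn_ord i) with end).
Definition lopp (t : term L) : term L := @App L SOpp (fun=> t).
Definition lop (j : 'I_d) (t : term L) : term L := @App L (SOp k j) (fun=> t).
Definition ladd (t u : term L) : term L :=
  @App L SAdd (fun i : 'I_2 => if i == ord0 then t else u).
Definition lmul (t u : term L) : term L :=
  @App L SMul (fun i : 'I_2 => if i == ord0 then t else u).
Definition lpow (t : term L) (n : nat) : term L := iter n (lmul t) lone.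

Lemma lift_lpow t n : lift_term 1 (lpow t n) = tpow (lift_term 1 t) n.
Proof.
elim: n => [|n IH] /=; first by congr App; apply/funext => -[].
congr App; apply/funext => i; case: eqP => // _; exact: IH.
Qed.

Lemma eval_lpow_var (M : structure L) (e : nat -> M) x n :
  eval e (lpow (Var x) n) = eval (fun=> e x) (lpow (Var 0) n).
Proof.
by elim: n => [|n IH] /=; congr interp; apply/funext => i; case: i => -[|[]] //= _; rewrite ?IH.
Qed.

Lemma lambda0_pow (p : nat) (T : theory L) (M : structure (Ld_lambda0 k d)) (x y : M) : model (add_lambda0 p T) M ->
  @eval L (reduct M) (fun=> y) (lpow (Var 0) p) = x -> @interp _ M None (fun=> x) = y.
Proof.
move=> /(_ (lambda0_on_powers k d p) (Or32 _ _ (erefl _)) (fun=> x) x y) /= on yx.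
by apply: on; rewrite -(lift_lpow (Var 1)) eval_lift eval_lpow_var.
Qed.

(** The two axioms pin the new function down: it is the p-th root where there is
    one and zero elsewhere. *)
Lemma lambda0_graph (p : nat) (T : theory L) m n :
  exists D : formula L, forall M, model (add_lambda0 p T) M -> forall e : nat -> M,
    @sat L (reduct M) e D <-> e n = @interp _ M None (fun=> e m).
Proof.
(* A variable different from both m and n. *)
pose z := (m + n).+1.
pose pow x := Eq (lpow (Var x) p) (Var m).
exists (Imp (Neg (pow n)) (Conj (All z (Neg (pow z))) (Eq (Var n) lzero))) => M TM e.
pose P (x y : M) := @eval L (reduct M) (fun=> y) (lpow (Var 0) p) = x.
have powP (e' : nat -> M) x : @sat L (reduct M) e' (pow x) <-> P (e' m) (e' x).
  by rewrite /P -eval_lpow_var.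
have onP x y : P x y -> @interp _ M None (fun=> x) = y by exact: lambda0_pow TM.
have offP x : (forall y, ~ P x y) -> @interp _ M None (fun=> x) = @eval L (reduct M) e lzero.
  have := TM (lambda0_off_powers k d p).
  move=> /(_ (Or33 _ _ (erefl _)) (fun=> x) x) /= off nP.
  have -> := off _; first by congr interp; apply/funext => -[].
  move=> y; rewrite /= -(lift_lpow (Var 1)) eval_lift eval_lpow_var; exact: nP.
have [[y Py]|nP] := pselect (exists y, P (e m) y).
  rewrite (onP _ _ Py); split=> [h|en h]; last by case: h; apply/powP; rewrite en.
  apply: contrapT => ne.
  have npow : ~ @sat L (reduct M) e (pow n).
    by move=> /powP/onP; rewrite (onP _ _ Py) => /esym.
  have [/(_ y) nz _] := proj1 (@sat_conj L (reduct M) e (All z (Neg (pow z))) (Eq (Var n) lzero)) (h npow).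
  apply: nz; apply/powP.
  by rewrite /update eqxx ltn_eqF // ltnS leq_addr.
rewrite offP => [|y Py]; last by apply: nP; exists y.
split=> [h|en npow].
  have npow : ~ @sat L (reduct M) e (pow n) by move=> /powP Pn; apply: nP; exists (e n).
  by have [_ en] := proj1 (@sat_conj L (reduct M) e (All z (Neg (pow z))) (Eq (Var n) lzero)) (h npow).
apply: (proj2 (@sat_conj L (reduct M) e (All z (Neg (pow z))) (Eq (Var n) lzero))).
split; last exact: en.
move=> y /powP.
by rewrite /update ltn_eqF ?eqxx ?ltnS ?leq_addr // => Py; apply: nP; exists y.
Qed.

End Terms.

(** * Coordinate algebra schemes: functoriality and generic elements *)

Section MakeMorphism.
Context (k : fieldType) (A C : comAlgType k) (g : A -> C).
Hypotheses (gD : {morph g : x y / x + y}) (gM : {morph g : x y / x * y})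
  (g1 : g 1 = 1) (gZ : forall c x, g (c *: x) = c *: g x).

Definition lr_fun : A -> C := g.
Fact lr_fun_zmod : zmod_morphism lr_fun.
Proof.
move=> x y; rewrite /lr_fun gD; congr (_ + _).
by rewrite -[- y]scaleN1r gZ scaleN1r.
Qed.
Fact lr_fun_monoid : monoid_morphism lr_fun. Proof. by []. Qed.
Fact lr_fun_scal : scalable lr_fun. Proof. exact: gZ. Qed.
HB.instance Definition _ := GRing.isZmodMorphism.Build A C lr_fun lr_fun_zmod.
HB.instance Definition _ := GRing.isMonoidMorphism.Build A C lr_fun lr_fun_monoid.
HB.instance Definition _ := GRing.isScalable.Build k A C *:%R lr_fun lr_fun_scal.
Lemma mk_lr_ex : {h : {lrmorphism A -> C} | forall x, h x = g x}.
Proof. by exists lr_fun. Qed.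
Definition mk_lr : {lrmorphism A -> C} := sval mk_lr_ex.
Lemma mk_lrE x : mk_lr x = g x. Proof. exact: (svalP mk_lr_ex). Qed.
End MakeMorphism.
Arguments mk_lr : simpl never.

Section AlgVia.
Context (k : fieldType).

(** The ring [S] as a k-algebra through a structure map [f]; a copy of [S] so
    that several algebra structures on one ring can coexist. *)
Definition alg_via (S : comNzRingType) (f : {rmorphism k -> S}) : Type := S.

Section Ring.
Context (S : comNzRingType) (f : {rmorphism k -> S}).
HB.instance Definition _ := GRing.ComNzRing.copy (alg_via f) S.

Definition via_scale (a : k) (x : alg_via f) : alg_via f := f a * x.
Fact via_scaleA a b x : via_scale a (via_scale b x) = via_scale (a * b) x.
Proof. by rewrite /via_scale rmorphM mulrA. Qed.
Fact via_scale1 : left_id 1 via_scale.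
Proof. by move=> x; rewrite /via_scale rmorph1 mul1r. Qed.
Fact via_scaleDr : right_distributive via_scale +%R.
Proof. by move=> a x y; rewrite /via_scale mulrDr. Qed.
Fact via_scaleDl x : {morph via_scale^~ x : a b / a + b}.
Proof. by move=> a b; rewrite /via_scale rmorphD mulrDl. Qed.
HB.instance Definition _ := GRing.Zmodule_isLmodule.Build k (alg_via f)
  via_scaleA via_scale1 via_scaleDr via_scaleDl.
Fact via_scaleAl a (x y : alg_via f) : a *: (x * y) = (a *: x) * y.
Proof. exact: mulrA. Qed.
HB.instance Definition _ := GRing.Lmodule_isLalgebra.Build k (alg_via f) via_scaleAl.
HB.instance Definition _ := GRing.Lalgebra_isComAlgebra.Build k (alg_via f).
Lemma alg_viaE (a : k) (x : alg_via f) : a *: x = (f a : alg_via f) * x.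
Proof. by []. Qed.
End Ring.

End AlgVia.

Section Polynomials.
Context (k : fieldType) (A : comAlgType k).

Definition poly_scalar : k -> {poly A} := fun a => (a%:A)%:P.
Fact poly_scalar_zmod : zmod_morphism poly_scalar.
Proof. by move=> a b; rewrite /poly_scalar scalerBl polyCB. Qed.
Fact poly_scalar_monoid : monoid_morphism poly_scalar.
Proof.
split=> [|a b]; rewrite /poly_scalar ?scale1r //.
by rewrite -polyCM -scalerAl mul1r scalerA.
Qed.
HB.instance Definition _ := GRing.isZmodMorphism.Build k {poly A} poly_scalar poly_scalar_zmod.
HB.instance Definition _ := GRing.isMonoidMorphism.Build k {poly A} poly_scalar poly_scalar_monoid.

Definition kpoly : comAlgType k := alg_via poly_scalar.

Lemma kpoly_scale (a : k) (p : {poly A}) : (a *: (p : kpoly) : kpoly) = (a%:A)%:P * p.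
Proof. by []. Qed.

Definition kpolyC : {lrmorphism A -> kpoly}.
apply: (@mk_lr k A kpoly (fun x => x%:P)).
- by move=> x y; rewrite polyCD.
- by move=> x y; rewrite polyCM.
- by [].
- by move=> c x; rewrite kpoly_scale -polyCM -scalerAl mul1r.
Defined.

Arguments kpolyC : simpl never.

Lemma kpolyCE x : kpolyC x = x%:P. Proof. exact: mk_lrE. Qed.

Section Eval.
Context (C : comAlgType k) (g : {lrmorphism A -> C}).

Definition kpoly_eval (c : C) : {lrmorphism kpoly -> C}.
apply: (@mk_lr k kpoly C (fun p => (map_poly g p).[c])).
- by move=> p q; rewrite rmorphD hornerD.
- by move=> p q; rewrite rmorphM hornerM.
- by rewrite rmorph1 hornerC.
- move=> a p; rewrite kpoly_scale rmorphM hornerM /= map_polyC hornerC.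
  by rewrite /= linearZ rmorph1 -scalerAl mul1r.
Defined.

Arguments kpoly_eval : simpl never.

Lemma kpoly_evalE c p : kpoly_eval c p = (map_poly g p).[c]. Proof. exact: mk_lrE. Qed.

Lemma kpoly_evalX c : kpoly_eval c 'X = c.
Proof. by rewrite kpoly_evalE map_polyX hornerX. Qed.

Lemma kpoly_evalC c x : kpoly_eval c (kpolyC x) = g x.
Proof. by rewrite kpoly_evalE kpolyCE map_polyC hornerC. Qed.
End Eval.

End Polynomials.

Section KpolyMap.
Context (k : fieldType) (A C : comAlgType k) (g : {lrmorphism A -> C}).

Definition kpoly_map : {lrmorphism kpoly A -> kpoly C}.
apply: (@mk_lr k (kpoly A) (kpoly C) (map_poly g)).
- by move=> p q; rewrite rmorphD.
- by move=> p q; rewrite rmorphM.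
- by rewrite rmorph1.
- by move=> a p; rewrite !kpoly_scale rmorphM /= map_polyC /= linearZ rmorph1.
Defined.

Arguments kpoly_map : simpl never.

Lemma kpoly_mapE p : kpoly_map p = map_poly g p. Proof. exact: mk_lrE. Qed.
End KpolyMap.

Section Functor.
Context (k : fieldType) (d : nat) (B : coordScheme k d).
Implicit Types R S T : comAlgType k.

Definition Bmap_fun R S (f : {lrmorphism R -> S}) (x : cs_obj B R) : cs_obj B S :=
  map_mx f x.

Definition Bmap R S (f : {lrmorphism R -> S}) : {lrmorphism cs_obj B R -> cs_obj B S}.
apply: (@mk_lr k (cs_obj B R) (cs_obj B S) (Bmap_fun f)).
- by move=> x y; exact: raddfD.
- by move=> x y; exact: cs_mul_nat.
- exact: cs_one_nat.
- by move=> c x; exact: cs_scale_nat.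
Defined.

Arguments Bmap : simpl never.

Lemma BmapE R S (f : {lrmorphism R -> S}) x j : cs_coord j (Bmap f x) = f (cs_coord j x).
Proof. by rewrite /Bmap mk_lrE /cs_coord mxE. Qed.

Lemma cs_eqP R (x y : cs_obj B R) : (forall j, cs_coord j x = cs_coord j y) -> x = y.
Proof. by move=> xy; apply/rowP => j; exact: xy. Qed.

Lemma Bmap_inj R S (f : {lrmorphism R -> S}) : injective f -> injective (Bmap f).
Proof. by move=> fI x y xy; apply: cs_eqP => j; apply: fI; rewrite -!BmapE xy. Qed.

Lemma Bmap_comp R S T (f : {lrmorphism R -> S}) (g : {lrmorphism S -> T})
    (h : {lrmorphism R -> T}) x : (forall r, g (f r) = h r) -> Bmap g (Bmap f x) = Bmap h x.
Proof. by move=> gf; apply: cs_eqP => j; rewrite !BmapE. Qed.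

Lemma cs_coordD R j : {morph @cs_coord k d B R j : x y / x + y}.
Proof. by move=> x y; rewrite /cs_coord mxE. Qed.
Lemma cs_coord0 R j : @cs_coord k d B R j 0 = 0.
Proof. by rewrite /cs_coord mxE. Qed.
Lemma cs_coordN R j : {morph @cs_coord k d B R j : x / - x}.
Proof. by move=> x; rewrite /cs_coord mxE. Qed.
Lemma cs_coord_sum R j (I : Type) (r : seq I) (P : pred I) (F : I -> cs_obj B R) :
  cs_coord j (\sum_(i <- r | P i) F i) = \sum_(i <- r | P i) cs_coord j (F i).
Proof. exact: (big_morph _ (@cs_coordD R j) (cs_coord0 R j)). Qed.

Lemma piM R (x y : cs_obj B R) : cs_pi (x * y) = cs_pi x * cs_pi y.
Proof. exact: cs_pi_mul. Qed.
Lemma pi1 R : cs_pi (1 : cs_obj B R) = 1.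
Proof. exact: cs_pi_one. Qed.
Lemma pi_Bmap R S (f : {lrmorphism R -> S}) x : cs_pi (Bmap f x) = f (cs_pi x).
Proof. exact: BmapE. Qed.
Lemma piX R (x : cs_obj B R) n : cs_pi (x ^+ n) = cs_pi x ^+ n.
Proof. by elim: n => [|n IH]; rewrite ?pi1 // !exprS piM IH. Qed.

Definition axis R (i : 'I_d.+1) (r : R) : cs_obj B R := \row_j (if j == i then r else 0).

Lemma axisE R i j r : cs_coord j (axis i r : cs_obj B R) = if j == i then r else 0.
Proof. by rewrite /cs_coord mxE. Qed.

Lemma axisD R i : {morph @axis R i : r s / r + s}.
Proof. by move=> r s; apply: cs_eqP => j; rewrite cs_coordD !axisE; case: eqP; rewrite ?addr0. Qed.

Lemma axis0 R i : @axis R i 0 = 0.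
Proof. by apply: cs_eqP => j; rewrite cs_coord0 axisE; case: eqP. Qed.

Lemma Bmap_axis R S (f : {lrmorphism R -> S}) i r : Bmap f (axis i r) = axis i (f r).
Proof. by apply: cs_eqP => j; rewrite BmapE !axisE; case: eqP; rewrite ?rmorph0. Qed.

Lemma cs_sum_axis R (x : cs_obj B R) : x = \sum_i axis i (cs_coord i x).
Proof.
apply: cs_eqP => j; rewrite cs_coord_sum (bigD1 j) //= axisE eqxx big1 ?addr0 // => i ij.
by rewrite axisE eq_sym (negbTE ij).
Qed.

End Functor.

(** * The kernel of the projection is nil *)

Section Linear.
Context (F : closedFieldType) (n : nat).
Implicit Types A W : 'M[F]_n.+1.

(** Apply the linear factors of the characteristic polynomial one after the other
    to a vector of the subspace, until the result vanishes. *)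
Lemma stable_eigenvector A W : W != 0 -> (W *m A <= W)%MS ->
  exists z (v : 'rV_n.+1), [/\ v != 0, (v <= W)%MS & v *m A = z *: v].
Proof.
move=> W0 WA.
have [r rP] := closed_field_poly_normal (char_poly A).
have cut (s : seq F) (w : 'rV_n.+1) : w != 0 -> (w <= W)%MS ->
    w *m (\prod_(z <- s) (A - z%:M)) = 0 ->
    exists z (v : 'rV_n.+1), [/\ v != 0, (v <= W)%MS & v *m A = z *: v].
  elim: s w => [|z s IH] w w0 wW; first by rewrite big_nil mulmx1 => /eqP; rewrite (negbTE w0).
  rewrite big_cons mulmxA; have [wz _|wz] := eqVneq (w *m (A - z%:M)) 0; last first.
    apply: IH => //; rewrite mulmxBr mul_mx_scalar addmx_sub ?eqmx_opp ?scalemx_sub //.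
    by apply: submx_trans WA; apply: submxMr.
  by exists z, w; split=> //; apply/eqP; rewrite -mul_mx_scalar -subr_eq0 -mulmxBr wz.
have [i iW] : exists i, row i W != 0.
  apply: contrapT => nW; move/eqP: W0; apply; apply/row_matrixP => i.
  by rewrite row0; apply/eqP; apply: contrapT => /negP ni; apply: nW; exists i.
apply: (cut r (row i W) iW (row_sub _ _)).
have := Cayley_Hamilton A; rewrite {1}rP -mul_polyC rmorphM rmorph_prod /=.
have /monicP-> := char_poly_monic A.
rewrite horner_mx_C -[(1%:M)]/1 mul1r => h.
rewrite (eq_bigr (fun z => horner_mx A ('X - z%:P))) ?h ?mulmx0 // => z _.
by rewrite rmorphB /= horner_mx_X horner_mx_C.
Qed.

(** A stable subspace of minimal dimension inside the eigenspace is a joint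
    eigenspace, since it cannot be cut down further. *)
Lemma commuting_eigenvector (P : 'M[F]_n.+1 -> Prop) b lam :
  (forall A A', P A -> P A' -> A *m A' = A' *m A) -> P b -> eigenvalue b lam ->
  exists v : 'rV_n.+1, [/\ v != 0, v *m b = lam *: v &
    forall A, P A -> exists a, v *m A = a *: v].
Proof.
move=> comm Pb /eigenvalueP[v0 v0b v0n].
pose stable W := [/\ W != 0, (W <= eigenspace b lam)%MS & forall A, P A -> (W *m A <= W)%MS].
have eq_stable A a W : P A -> stable W -> (W :&: eigenspace A a != 0)%MS ->
    stable (W :&: eigenspace A a)%MS.
  move=> PA [W0 Wb WA] WA0; split=> // [|A' PA'].
    by apply: submx_trans Wb; exact: capmxSl.
  rewrite sub_capmx (submx_trans _ (WA A' PA')) ?submxMr ?capmxSl //=.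
  apply/eigenspaceP; rewrite -mulmxA -(comm A A') // mulmxA.
  have /eigenspaceP-> : (W :&: eigenspace A a <= eigenspace A a)%MS by exact: capmxSr.
  by rewrite -scalemxAl.
have ex : exists r, `[< exists2 W, stable W & \rank W = r >].
  exists (\rank (eigenspace b lam)); apply/asboolP; exists (eigenspace b lam) => //.
  split=> // [|A PA].
    have : (v0 <= eigenspace b lam)%MS by exact/eigenspaceP.
    by apply: contraTneq => ->; rewrite submx0.
  apply/eigenspaceP; rewrite -mulmxA (comm A b) // mulmxA.
  have /eigenspaceP-> : (eigenspace b lam <= eigenspace b lam)%MS by exact: submx_refl.
  by rewrite -scalemxAl.
case: (ex_minnP ex) => m /asboolP[W stW <-] minW.
have [W0 Wb WA] := stW.
have scal A : P A -> exists a, (W <= eigenspace A a)%MS.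
  move=> PA; have [a [v [v0' vW vA]]] := stable_eigenvector W0 (WA A PA).
  exists a; have vE : (v <= W :&: eigenspace A a)%MS.
    by rewrite sub_capmx vW; apply/eigenspaceP.
  have st : stable (W :&: eigenspace A a)%MS.
    by apply: eq_stable => //; apply/eqP => e0; move: v0'; rewrite -submx0 -e0 vE.
  have := minW (\rank (W :&: eigenspace A a)%MS); rewrite asboolT; last by exists (W :&: eigenspace A a)%MS.
  move=> /(_ isT) rk; have /eqmxP/eqmx_sym/eqmxP/andP[+ _] : (W :&: eigenspace A a == W)%MS.
    rewrite -(geq_leqif (mxrank_leqif_eq (capmxSl W (eigenspace A a)))); exact: rk.
  by move=> h; apply: submx_trans h _; exact: capmxSr.
have [i iW] : exists i, row i W != 0.
  apply: contrapT => nW; move/eqP: W0; apply; apply/row_matrixP => i.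
  by rewrite row0; apply/eqP; apply: contrapT => /negP ni; apply: nW; exists i.
exists (row i W); split=> // [|A PA].
  by apply/eigenspaceP; apply: submx_trans Wb; exact: row_sub.
have [a Wa] := scal A PA; exists a.
by apply/eigenspaceP; apply: submx_trans Wa; exact: row_sub.
Qed.

Lemma nilpotent_mx A : (forall lam, eigenvalue A lam -> lam = 0) -> A ^+ n.+1 = 0.
Proof.
move=> eig0; have [r rP] := closed_field_poly_normal (char_poly A).
have /monicP mon := char_poly_monic A; rewrite mon scale1r in rP.
have rE : \prod_(z <- r) ('X - z%:P) = 'X^(size r) :> {poly F}.
  rewrite -iter_mulr_1 -(count_predT r) -big_const_seq.
  apply: eq_big_seq => z zr; rewrite (eig0 z) ?subr0 //.
  by rewrite eigenvalue_root_char rP root_prod_XsubC.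
have := size_char_poly A; rewrite rP rE size_polyXn => -[sr].
have := Cayley_Hamilton A; rewrite rP rE sr => <-.
by rewrite rmorphXn /= horner_mx_X.
Qed.

End Linear.

(** All maximal ideals coincide, so an element outside one of them lies in none,
    whereas by Zorn's lemma a non-unit lies in one. *)
Lemma local_unit (A : comNzRingType) (I : pred A) :
  local_ring A -> maximal_ideal I -> forall x, x \notin I -> exists y, x * y = 1.
Proof.
move=> [m [_ mmax]] maxI x xI; apply: contrapT => nx.
(* The union of the empty chain is empty: membership of x is only required of
   nonempty sets. *)
pose ideals : set (set A) := [set J | ~ J 1 /\ (forall a u v, J u -> J v -> J (a * u + v))
                                      /\ J `<=` setT /\ (J !=set0 -> J x)].
have [F FP totF|J [[J1 [Jid [_ Jx]]] Jmax]] := @Zorn_bigcup A ideals.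
  split=> [[J /FP[]//]|]; split=> [a u v [J FJ Ju] [K FK Kv]|].
    have [JK|KJ] := totF _ _ FJ FK.
      by exists K => //; have [_ [Kid _]] := FP _ FK; apply: Kid => //; exact: JK.
    by exists J => //; have [_ [Jid _]] := FP _ FJ; apply: Jid => //; exact: KJ.
  split=> // -[u [J FJ Ju]]; exists J => //; have [_ [_ [_]]] := FP _ FJ.
  by apply; exists u.
pose K := [set y | exists a, y = x * a].
have idK : ideals K.
  split=> [[a /esym xa]|]; first by apply: nx; exists a.
  split=> [a u v [b ->] [c ->]|]; first by exists (a * b + c); rewrite mulrDr mulrCA.
  by split=> // _; exists 1; rewrite mulr1.
have {}Jx : J x.
  apply: contrapT => nJx; apply: (Jmax K) => //; split=> [y Jy|]; last first.
    by move=> KJ; apply: nJx; apply: KJ; exists 1; rewrite mulr1.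
  by exfalso; apply: nJx; apply: Jx; exists y.
pose Jp : pred A := fun y => `[< J y >].
have J0 : J 0 by have := Jid (-1) x x Jx Jx; rewrite mulN1r addNr.
have maxJ : maximal_ideal Jp.
  split; first split.
  - exact/asboolP.
  - exact/asboolPn.
  - by move=> a u v /asboolP Ju /asboolP Jv; apply/asboolP; exact: Jid.
  move=> H [H0 H1 Hid] JH y; apply/idP/idP => [Hy|]; last exact: JH.
  apply/asboolP; apply: contrapT => nJy.
  apply: (Jmax [set z | z \in H]); last first.
    split=> [|]; first exact/negP.
    split=> [a u v /= Hu Hv|]; first exact: Hid.
    by split=> // _ /=; apply: JH; exact/asboolP.
  by split=> [z Jz /=|HJ]; [apply: JH; exact/asboolP|apply: nJy; exact: HJ].
by move/negP: xI; apply; rewrite (mmax _ maxI) -(mmax _ maxJ); exact/asboolP.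
Qed.

Section Nil.
Context (k : fieldType) (d : nat) (B : coordScheme k d) (F : closedFieldAlgType k).
Hypothesis hlocal : local_ring (cs_obj B F).

Lemma maximal_ker_pi : maximal_ideal [pred x : cs_obj B F | cs_pi x == 0].
Proof.
split; first split.
- by rewrite inE /cs_pi cs_coord0 eqxx.
- by rewrite !inE pi1 oner_eq0.
- move=> a u v; rewrite !inE => /eqP u0 /eqP v0.
  by rewrite /cs_pi cs_coordD -/(cs_pi _) piM u0 mulr0 -/(cs_pi _) v0 addr0.
move=> J [J0 J1 Jid] sub y; apply/idP/idP => [Jy|]; last exact: sub.
rewrite inE; apply: contraNT J1 => y0.
pose z : cs_obj B F := axis B ord0 (cs_pi y)^-1.
have /sub Jyz : 1 - z * y \in [pred x : cs_obj B F | cs_pi x == 0].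
  rewrite inE /cs_pi cs_coordD cs_coordN -!/(cs_pi _) piM pi1 [X in X * _]axisE eqxx mulVf //.
  by rewrite subrr.
by rewrite -(subrK (z * y) 1) addrC; exact: Jid.
Qed.

Lemma unit_pi (x : cs_obj B F) : cs_pi x != 0 -> exists y, x * y = 1.
Proof. by move=> x0; apply: (local_unit hlocal maximal_ker_pi); rewrite !inE. Qed.

Notation Ft := (kpoly F).
Definition up (x : cs_obj B F) : cs_obj B Ft := Bmap B (kpolyC F) x.
Definition mon (l : 'I_d.+1) : cs_obj B Ft := @axis k d B Ft l 'X.

(** The coordinates of multiplication by [x] restricted to the l-th axis, as
    polynomials in the coordinate on that axis. *)
Definition slot (x : cs_obj B F) (l j : 'I_d.+1) : {poly F} := cs_coord j (up x * mon l).

Lemma slot_comp x l j (g : {poly F}) :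
  cs_coord j (up x * axis B l (g : Ft)) = slot x l j \Po g :> {poly F}.
Proof.
have upx : Bmap B (kpoly_eval (kpolyC F) (g : Ft)) (up x) = up x.
  apply: Bmap_comp => r; exact: kpoly_evalC.
have -> : slot x l j \Po g = kpoly_eval (kpolyC F) (g : Ft) (slot x l j : Ft).
  rewrite kpoly_evalE; congr (_.[_]); apply: eq_map_poly => r; by rewrite kpolyCE.
rewrite /slot /mon -BmapE rmorphM /= Bmap_axis kpoly_evalX.
by rewrite upx.
Qed.

Lemma mul_slots x (y : cs_obj B Ft) j :
  cs_coord j (up x * y) = \sum_l (slot x l j \Po (cs_coord l y : {poly F})) :> {poly F}.
Proof.
rewrite {1}[y]cs_sum_axis mulr_sumr cs_coord_sum.
by apply: eq_bigr => l _; rewrite slot_comp.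
Qed.

Lemma slot0 x l j : (slot x l j)`_0 = 0.
Proof.
have := slot_comp x l j 0; rewrite axis0 mulr0 cs_coord0 comp_poly0r => /esym/eqP.
by rewrite polyC_eq0 => /eqP.
Qed.

Lemma slotD x y l j : slot (x + y) l j = slot x l j + slot y l j.
Proof. by rewrite /slot /up rmorphD mulrDl cs_coordD. Qed.

(** The action of [x] on the tangent space at the origin. *)
Definition tangent (x : cs_obj B F) : 'M[F]_d.+1 := \matrix_(l, j) (slot x l j)`_1.

Definition vanishing (m : nat) (y : cs_obj B Ft) :=
  forall j, exists q : {poly F}, cs_coord j y = q * 'X^m :> {poly F}.

Lemma mul_coef1 x (y : cs_obj B Ft) : vanishing 1 y ->
  (\row_j ((cs_coord j (up x * y) : {poly F})`_1)) =
  (\row_j ((cs_coord j y : {poly F})`_1)) *m tangent x.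
Proof.
move=> y0; apply/rowP => j; rewrite !mxE mul_slots coef_sum; apply: eq_bigr => l _.
rewrite !mxE; have [q ->] := y0 l; rewrite expr1 coefMX /=.
have [p ->] : exists p, slot x l j = p * 'X.
  by have /eqP := slot0 x l j; rewrite -horner_coef0 => /factor_theorem[p]; rewrite subr0; exists p.
rewrite comp_polyM comp_polyX mulrA !coefMX /= mulrC coefM big_ord1 /=; congr (_ * _).
by rewrite -!horner_coef0 horner_comp hornerMX mulr0.
Qed.

Lemma vanishing_mon l : vanishing 1 (mon l).
Proof.
by move=> j; rewrite axisE; case: eqP => _; [exists 1; rewrite mul1r|exists 0; rewrite mul0r].
Qed.

Lemma vanishing_mul m x y : (0 < m)%N -> vanishing m y -> vanishing m (up x * y).
Proof.
move=> m0 ym j; rewrite mul_slots.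
apply: (big_ind (fun p : {poly F} => exists q, p = q * 'X^m)).
- by exists 0; rewrite mul0r.
- by move=> _ _ [q ->] [r ->]; exists (q + r); rewrite mulrDl.
move=> l _; have [q ->] := ym l.
have [p ->] : exists p, slot x l j = p * 'X.
  by have /eqP := slot0 x l j; rewrite -horner_coef0 => /factor_theorem[p]; rewrite subr0; exists p.
by rewrite comp_polyM comp_polyX mulrA; eexists.
Qed.

Lemma row_tangent x l : row l (tangent x) = \row_j ((cs_coord j (up x * mon l) : {poly F})`_1).
Proof. by apply/rowP => j; rewrite !mxE. Qed.

Lemma tangent1 : tangent 1 = 1%:M.
Proof.
apply/matrixP => l j; rewrite !mxE /slot /up rmorph1 mul1r axisE eq_sym.
by case: eqP => _; rewrite ?coefX ?coef0.
Qed.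

Lemma tangentM x y : tangent (x * y) = tangent y *m tangent x.
Proof.
apply/row_matrixP => l; rewrite row_mul !row_tangent -mul_coef1; last exact/vanishing_mul/vanishing_mon.
by rewrite mulrA /up rmorphM.
Qed.

Lemma tangentD x y : tangent (x + y) = tangent x + tangent y.
Proof. by apply/matrixP => l j; rewrite !mxE slotD coefD. Qed.

Lemma tangentX x n : tangent (x ^+ n) = tangent x ^+ n.
Proof. by elim: n => [|n IH]; rewrite ?tangent1 // exprSr tangentM IH exprS. Qed.

(** The slots of [b] have order at least two, and substituting a polynomial of
    order m into one of order two gives one of order 2m. *)
Lemma vanishing_double b m y : tangent b = 0 -> vanishing m y -> vanishing m.*2 (up b * y).
Proof.
move=> b0 ym j; rewrite mul_slots.
apply: (big_ind (fun p : {poly F} => exists q, p = q * 'X^(m.*2))).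
- by exists 0; rewrite mul0r.
- by move=> _ _ [q ->] [r ->]; exists (q + r); rewrite mulrDl.
move=> l _; have [q ->] := ym l.
have [p ->] : exists p, slot b l j = p * 'X^2.
  have /eqP := slot0 b l j; rewrite -horner_coef0 => /factor_theorem[p]; rewrite subr0 => pE.
  have /matrixP/(_ l j) := b0; rewrite !mxE pE coefMX /= => /eqP.
  by rewrite -horner_coef0 => /factor_theorem[r]; rewrite subr0 => ->; exists r; rewrite -mulrA.
rewrite comp_polyM rmorphXn /= comp_polyX exprMn mulrA -exprM muln2.
by eexists.
Qed.

Lemma vanishing_pow b n l : tangent b = 0 -> vanishing (2 ^ n) (up (b ^+ n) * mon l).
Proof.
move=> b0; elim: n => [|n IH]; first by rewrite /up rmorph1 mul1r; exact: vanishing_mon.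
rewrite exprS /up rmorphM -mulrA expnS mul2n; exact: vanishing_double.
Qed.

Notation k0 := (k^o : comAlgType k).

Definition scalar_lr (R : comAlgType k) : {lrmorphism k0 -> R}.
apply: (@mk_lr k k0 R (fun c => c%:A)).
- by move=> a b; rewrite scalerDl.
- by move=> a b; rewrite -scalerAl mul1r scalerA.
- by rewrite scale1r.
- by move=> a b; rewrite scalerA.
Defined.

Arguments scalar_lr : simpl never.

Lemma scalar_lrE (R : comAlgType k) c : scalar_lr R c = c%:A.
Proof. exact: mk_lrE. Qed.

(** A product of two axis vectors, computed once and for all in k[s][t]. *)
Definition generic_slot (i l j : 'I_d.+1) : {poly {poly k}} :=
  cs_coord j ((axis B i (('X : {poly k})%:P : kpoly (kpoly k0))) * (axis B l ('X : kpoly (kpoly k0)))).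

Lemma slot_axis i l j s :
  slot (axis B i s) l j = map_poly (kpoly_eval (scalar_lr F) s) (generic_slot i l j).
Proof.
pose f : {lrmorphism kpoly (kpoly k0) -> kpoly F} := kpoly_map (kpoly_eval (scalar_lr F) s).
have fs : f (('X : {poly k})%:P : kpoly (kpoly k0)) = kpolyC F s.
  by rewrite kpoly_mapE map_polyC /= kpolyCE (@kpoly_evalX k k0 F (scalar_lr F) s).
have ft : f ('X : kpoly (kpoly k0)) = 'X by rewrite kpoly_mapE map_polyX.
rewrite -kpoly_mapE -/f /generic_slot -BmapE rmorphM /= !Bmap_axis fs ft.
by rewrite /slot /up Bmap_axis.
Qed.

(** By naturality each slot is a sum of specialisations of the finitely many
    generic ones, and specialising s does not raise the degree in t. *)
Lemma slot_size : exists D, forall x l j, (size (slot x l j) <= D)%N.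
Proof.
exists (\max_i \max_l \max_j size (generic_slot i l j))%N => x l j.
rewrite [x]cs_sum_axis /slot /up rmorph_sum mulr_suml cs_coord_sum.
apply: leq_trans (size_sum _ _ _) _; apply/bigmax_leqP => i _.
rewrite -[cs_coord j _]/(slot (axis B i (cs_coord i x)) l j) slot_axis.
apply: leq_trans (size_poly _ _) _.
apply: leq_trans (leq_bigmax i); apply: leq_trans (leq_bigmax l); exact: leq_bigmax.
Qed.

(** The slots of the powers of [b] vanish to exponentially growing order while
    their degrees stay bounded. *)
Lemma tangent0_nilpotent b : tangent b = 0 -> exists n, b ^+ n = 0.
Proof.
move=> b0; have [D Dle] := slot_size; exists D.
have s0 l j : slot (b ^+ D) l j = 0.
  have [q qE] := vanishing_pow D l b0 j.
  have := Dle (b ^+ D) l j; rewrite /slot qE.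
  have [->|q0] := eqVneq q 0; first by rewrite mul0r.
  rewrite size_mulXn // => le; have := leq_ltn_trans (leq_addr _ _) (leq_ltn_trans le (ltn_expl D (leqnn 2))).
  by rewrite ltnn.
have h : up (b ^+ D) * up 1 = 0.
  by apply: cs_eqP => j; rewrite mul_slots cs_coord0 big1 // => l _; rewrite s0 comp_poly0.
have : up (b ^+ D) = up 0 by rewrite -[LHS]mulr1 /up rmorph0 -h /up rmorph1.
by apply: (Bmap_inj (f := kpolyC F)) => x y; rewrite !kpolyCE => /polyC_inj.
Qed.

(** A nonzero eigenvalue of the tangent action of [b] comes with an eigenvector
    common to all tangent actions, whose eigenvalues define a polynomial ring
    morphism chi to the field. It is nonconstant on some axis, hence onto, and
    takes the value 0 at some unit 1 - b c. *)
Lemma ker_pi_nil (b : cs_obj B F) : cs_pi b = 0 -> exists n, b ^+ n = 0.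
Proof.
move=> b0; suff eig0 : forall lam, eigenvalue (tangent b) lam -> lam = 0.
  have /tangent0_nilpotent[n] : tangent (b ^+ d.+1) = 0 by rewrite tangentX nilpotent_mx.
  by rewrite -exprM; exists (d.+1 * n)%N.
move=> lam lamP; apply: contrapT => /eqP lam0.
have [||v [v0 vb vP]] := @commuting_eigenvector F d [set A | exists x, A = tangent x] (tangent b) lam _ _ lamP.
- by move=> _ _ [x ->] [y ->]; rewrite -!tangentM mulrC.
- by exists b.
have /choice[chi chiP] : forall x, exists a, v *m tangent x = a *: v by move=> x; apply: vP; exists x.
have /rV0Pn[o vo] := v0.
have chiE x : chi x = (v *m tangent x) 0 o / v 0 o by rewrite chiP mxE mulfK.
have chi_uniq x a : v *m tangent x = a *: v -> chi x = a by rewrite chiE => ->; rewrite mxE mulfK.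
have chi1 : chi 1 = 1 by apply: chi_uniq; rewrite tangent1 mulmx1 scale1r.
have chiM x y : chi (x * y) = chi x * chi y.
  by apply: chi_uniq; rewrite tangentM mulmxA chiP -scalemxAl chiP scalerA mulrC.
have chiD x y : chi (x + y) = chi x + chi y.
  by apply: chi_uniq; rewrite tangentD mulmxDr !chiP scalerDl.
have chi0 : chi 0 = 0 by apply: (addrI (chi 0)); rewrite -chiD !addr0.
have chib : chi b = lam by exact: chi_uniq.
pose p i : {poly F} := \sum_l v 0 l *: map_poly (scalar_lr F) ((generic_slot i l o)`_1).
have pP i s : chi (axis B i s) = (p i).[s] / v 0 o.
  rewrite chiE; congr (_ / _); rewrite mxE horner_sum; apply: eq_bigr => l _.
  by rewrite hornerZ mxE slot_axis coef_map /= kpoly_evalE.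
have [i pi0] : exists i, chi (axis B i (cs_coord i (1 : cs_obj B F))) != 0.
  apply: contrapT => n0; have := oner_neq0 F; rewrite -chi1 [1]cs_sum_axis.
  rewrite (big_morph chi chiD chi0) big1 ?eqxx // => i _.
  by apply/eqP; apply: contrapT => /negP ni; apply: n0; exists i.
have [s sP] : exists s, root (p i - (lam^-1 * v 0 o)%:P) s.
  apply/closed_rootP; apply: contraNneq pi0 => s1.
  have /eqP/size_poly1P[c c0 cE] := s1.
  have pc : p i = (c + lam^-1 * v 0 o)%:P by rewrite polyCD -cE subrK.
  by have := pP i 0; rewrite axis0 chi0 pP !pc !hornerC => <-.
have chis : chi (axis B i s) = lam^-1.
  move: sP; rewrite pP rootE hornerD hornerN hornerC subr_eq0 => /eqP->.
  by rewrite mulfK.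
have [y yP] : exists y, (1 - b * axis B i s) * y = 1.
  apply: unit_pi; rewrite /cs_pi cs_coordD cs_coordN -!/(cs_pi _) piM b0 mul0r subr0 pi1.
  exact: oner_neq0.
have : chi (1 - b * axis B i s) = 0.
  apply: (addIr (chi (b * axis B i s))); rewrite -chiD subrK add0r chi1 chiM chib chis.
  by rewrite divff.
by move=> c0; have := chiM (1 - b * axis B i s) y; rewrite yP chi1 c0 mul0r => /eqP; rewrite oner_eq0.
Qed.

End Nil.

(** * Frobenius on the algebras of the scheme *)

Section FrobeniusKernel.
Context (k : fieldType) (p : nat) (hp : p \in [pchar k]) (d : nat) (B : coordScheme k d).

Lemma pchar_alg (R : comAlgType k) : p \in [pchar R].
Proof. by rewrite pchar_lalg. Qed.

Lemma exp_pD (R : comAlgType k) : {morph (fun x : R => x ^+ p) : x y / x + y}.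
Proof. by move=> x y /=; rewrite -!(pFrobenius_autE (pchar_alg R)) rmorphD. Qed.

Lemma p_gt0 : (0 < p)%N.
Proof. exact: prime_gt0 (pcharf_prime hp). Qed.

Lemma exp_p0 (R : comAlgType k) : (0 : R) ^+ p = 0.
Proof. by rewrite expr0n; case: p p_gt0. Qed.

Lemma exp_p_sum (R : comAlgType k) (I : Type) (r : seq I) (P : pred I) (F : I -> R) :
  (\sum_(i <- r | P i) F i) ^+ p = \sum_(i <- r | P i) F i ^+ p.
Proof. exact: (big_morph _ (@exp_pD R) (exp_p0 R)). Qed.

(** By additivity of Frobenius it is enough to raise axis vectors to the p-th
    power, and the coordinates of the p-th power of a generic axis vector are
    one-variable polynomials over k vanishing on the algebraic closure. *)
Lemma frobenius_kernel (F : closedFieldAlgType k) :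
  (forall x : cs_obj B F, cs_pi x = 0 -> x ^+ p = 0) ->
  forall (R : comAlgType k) (x : cs_obj B R), cs_pi x = 0 -> x ^+ p = 0.
Proof.
move=> h R x x0.
have gen i : i != ord0 -> (axis B i ('X : kpoly (k^o : comAlgType k))) ^+ p = 0.
  move=> i0; apply: cs_eqP => j; rewrite cs_coord0.
  set f := cs_coord j _; pose g := map_poly (scalar_lr F) f.
  have g0 s : g.[s] = 0.
    rewrite -kpoly_evalE /f -BmapE rmorphXn /= Bmap_axis.
    rewrite (@kpoly_evalX k (k^o : comAlgType k) F (scalar_lr F) s) h ?cs_coord0 //.
    by rewrite /cs_pi axisE eq_sym (negbTE i0).
  have {}g0 : g = 0.
    have : ~ exists s, root (g + 1) s by move=> [s]; rewrite rootE hornerD hornerC g0 add0r oner_eq0.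
    move=> nroot; have /size_poly1P[c _ gc] : size (g + 1) == 1%N.
      by apply: contraT => /closed_rootP.
    have gE : g = (c - 1)%:P by rewrite polyCB -gc addrK.
    by have := g0 0; rewrite gE hornerC => ->.
  by apply/eqP; rewrite -(map_poly_eq0 (scalar_lr F)); apply/eqP; exact: g0.
rewrite [x]cs_sum_axis exp_p_sum big1 // => i _.
have [->|i0] := eqVneq i ord0; first by rewrite -/(cs_pi x) x0 axis0 exp_p0.
pose ev := kpoly_eval (scalar_lr R) (cs_coord i x).
have -> : axis B i (cs_coord i x) = Bmap B ev (axis B i ('X : kpoly (k^o : comAlgType k))).
  by rewrite Bmap_axis /ev (@kpoly_evalX k (k^o : comAlgType k)).
by rewrite -rmorphXn gen // rmorph0.
Qed.

Hypothesis ker : forall (R : comAlgType k) (x : cs_obj B R), cs_pi x = 0 -> x ^+ p = 0.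

(** A ring morphism lifting Frobenius, through which p-th powers in the scheme
    factor; it is what forces every operator to agree on p-th powers. *)
Definition sigma (R : comAlgType k) (r : R) : cs_obj B R := (axis B ord0 r) ^+ p.

Lemma exp_p_sigma (R : comAlgType k) (x : cs_obj B R) : x ^+ p = sigma (cs_pi x).
Proof.
have : (x - axis B ord0 (cs_pi x)) ^+ p = 0.
  by apply: ker; rewrite /cs_pi cs_coordD cs_coordN axisE eqxx subrr.
by move=> h; rewrite -[x in LHS](subrK (axis B ord0 (cs_pi x))) exp_pD h add0r.
Qed.

Lemma pi_axis0 (R : comAlgType k) (r : R) : cs_pi (axis B ord0 r) = r.
Proof. by rewrite /cs_pi axisE eqxx. Qed.

Lemma sigmaD (R : comAlgType k) : {morph @sigma R : x y / x + y}.
Proof. by move=> x y; rewrite /sigma axisD exp_pD. Qed.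

Lemma sigma0 (R : comAlgType k) : @sigma R 0 = 0.
Proof. by rewrite /sigma axis0 exp_p0. Qed.

Lemma sigma_sum (R : comAlgType k) (I : Type) (r : seq I) (P : pred I) (F : I -> R) :
  sigma (\sum_(i <- r | P i) F i) = \sum_(i <- r | P i) sigma (F i).
Proof. exact: (big_morph _ (@sigmaD R) (sigma0 R)). Qed.

Lemma sigma1 (R : comAlgType k) : @sigma R 1 = 1.
Proof. by rewrite -[1 in LHS](pi1 B R) -exp_p_sigma expr1n. Qed.

Lemma sigmaM (R : comAlgType k) : {morph @sigma R : x y / x * y}.
Proof.
move=> x y; rewrite -[x * y](_ : cs_pi (axis B ord0 x * axis B ord0 y) = _); last by rewrite piM !pi_axis0.
by rewrite -exp_p_sigma exprMn.
Qed.

Lemma Bmap_sigma (R S : comAlgType k) (f : {lrmorphism R -> S}) r :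
  Bmap B f (sigma r) = sigma (f r).
Proof. by rewrite /sigma rmorphXn /= Bmap_axis. Qed.

(** Since the p-th power of [x] only depends on its first coordinate, it is enough
    to invert the latter. *)
Lemma scheme_inverse (R : comAlgType k) (x : cs_obj B R) (u : R) :
  cs_pi x * u = 1 -> x * (x ^+ p.-1 * sigma u) = 1.
Proof.
by move=> xu; rewrite mulrA -exprS (prednK p_gt0) exp_p_sigma -sigmaM xu sigma1.
Qed.

End FrobeniusKernel.

(** * Linear independence of p-th powers *)

Section AdditivePolynomials.
Context (K : fieldType) (p : nat) (hp : p \in [pchar K]).

Lemma coef_binomial (n i : nat) : ((1 + 'X) ^+ n : {poly K})`_i = 'C(n, i)%:R.
Proof.
have -> : (1 + 'X) ^+ n = \poly_(i < n.+1) 'C(n, i)%:R :> {poly K}.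
  rewrite exprDn poly_def; apply: eq_bigr => j _.
  by rewrite expr1n mul1r scaler_nat.
by rewrite coef_poly; case: ltnP => // /bin_small->.
Qed.

(** Compare coefficients in (1 + X)^(p^r b) = (1 + X^(p^r))^b. *)
Lemma bin_p_part (r b : nat) : 'C(p ^ r * b, p ^ r)%:R = b%:R :> K.
Proof.
have p0 : (0 < p ^ r)%N by rewrite expn_gt0 (prime_gt0 (pcharf_prime hp)).
have frobX : (1 + 'X : {poly K}) ^+ (p ^ r) = 1 + 'X^(p ^ r).
  rewrite exprDn_pchar ?expr1n // pnatX; apply/orP; left.
  rewrite (eq_pnat _ (pchar_poly K)); by rewrite pnatE ?(pcharf_prime hp).
rewrite -coef_binomial exprM frobX.
have -> : (1 + 'X^(p ^ r)) ^+ b = ((1 + 'X) ^+ b) \Po 'X^(p ^ r) :> {poly K}.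
  by rewrite rmorphXn rmorphD /= comp_polyX rmorph1.
by rewrite coef_comp_poly_Xn // dvdnn divnn p0 coef_binomial bin1.
Qed.

(** By Taylor expansion, the Hasse derivatives of positive order of an additive
    polynomial are constants. At an exponent which is not a power of p one of them
    multiplies the coefficient by a binomial coefficient prime to p. *)
Lemma additive_poly (f : {poly K}) (a : nat) :
  (forall x y : {poly {poly K}}, f^:P^:P.[x + y] = f^:P^:P.[x] + f^:P^:P.[y]) ->
  (forall r, a != p ^ r)%N -> f`_a = 0.
Proof.
move=> fD ap.
have nder i : (0 < i)%N -> f^`N(i) = (f`_i)%:P.
  move=> i0; have := fD ('X%:P) 'X.
  rewrite nderiv_taylor; last by rewrite /GRing.comm mulrC.
  have -> : f^:P^:P.[('X)%:P] = f%:P.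
    by rewrite horner_map -[f^:P.['X]]/(f \Po 'X) comp_polyXr.
  have -> : f^:P^:P.['X] = f^:P by rewrite -[LHS]/(f^:P \Po 'X) comp_polyXr.
  have cf j : f^:P^:P^`N(j).['X%:P] = (f^`N(j))%:P.
    by rewrite !nderivn_map horner_map -[_.['X]]/(f^`N(j) \Po 'X) comp_polyXr.
  move/(congr1 (fun q : {poly {poly K}} => q`_i)).
  rewrite coefD coefC gtn_eqF // add0r coef_map /= coef_sum => <-.
  have [isz|szi] := ltnP i (size f^:P^:P).
    rewrite (bigD1 (Ordinal isz)) //= big1 => [|j ji].
      by rewrite cf mul_polyC coefZ coefXn eqxx mulr1 addr0.
    rewrite cf mul_polyC coefZ coefXn (_ : _ == _ = false) ?mulr0 //.
    by rewrite eq_sym; apply: negbTE.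
  rewrite big1 => [|j _].
    have sz : (size f <= i)%N by move: szi; rewrite !size_map_polyC.
    by apply/polyP => j; rewrite coef_nderivn nth_default ?mul0rn ?coef0 // (leq_trans sz) ?leq_addr.
  by rewrite cf mul_polyC coefZ coefXn gtn_eqF ?mulr0 // (leq_trans _ szi).
case: (posnP a) => [->|a0].
  have := fD 0 0; rewrite addr0 => /esym/eqP; rewrite -subr_eq0 addrK.
  by rewrite -!horner_coef0 !(horner_map _ _ 0) /= -!polyC0 !polyC_eq0 => /eqP.
have [b pb aE] := pfactor_coprime (pcharf_prime hp) a0.
set r := logn p a in aE; rewrite mulnC in aE.
have p0 : (0 < p ^ r)%N by rewrite expn_gt0 (prime_gt0 (pcharf_prime hp)).
have b1 : (1 < b)%N.
  rewrite ltn_neqAle eq_sym; apply/andP; split.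
    by apply: contraNneq (ap r) => b1; rewrite {1}aE b1 muln1.
  by rewrite lt0n; apply: contraTneq a0 => b0; rewrite aE b0 muln0.
have ra : (p ^ r < a)%N by rewrite aE -[ltnLHS]muln1 ltn_pmul2l.
have /(congr1 (fun q : {poly K} => q`_(a - p ^ r))) := nder _ p0.
rewrite coef_nderivn (subnKC (ltnW ra)) coefC subn_eq0 leqNgt ra /= -mulr_natr {2}aE.
rewrite bin_p_part => /eqP; rewrite mulf_eq0 => /orP[/eqP//|].
by rewrite -(dvdn_pcharf hp); rewrite prime_coprime ?(pcharf_prime hp) // in pb; rewrite (negbTE pb).
Qed.
End AdditivePolynomials.

Section Twist.
Context (k : fieldType) (p : nat) (hp : p \in [pchar k]).

Definition twist_scalar (R : comAlgType k) : k -> R := fun c => c%:A ^+ p.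
Fact twist_scalar_zmod R : zmod_morphism (@twist_scalar R).
Proof.
move=> x y; rewrite /twist_scalar scalerBl.
by rewrite -!(pFrobenius_autE (pchar_alg hp R)) rmorphB.
Qed.
Fact twist_scalar_monoid R : monoid_morphism (@twist_scalar R).
Proof.
split=> [|x y]; rewrite /twist_scalar ?scale1r ?expr1n //.
by rewrite -exprMn -scalerAl mul1r scalerA.
Qed.
HB.instance Definition _ (R : comAlgType k) := GRing.isZmodMorphism.Build k R (@twist_scalar R) (twist_scalar_zmod R).
HB.instance Definition _ (R : comAlgType k) := GRing.isMonoidMorphism.Build k R (@twist_scalar R) (twist_scalar_monoid R).

(** For a field [R] this is a copy of R^(1/p): the scalars act through their
    p-th powers, so that Frobenius becomes the inclusion of [R]. *)
Definition twist (R : comAlgType k) : comAlgType k := alg_via (@twist_scalar R).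

Lemma twist_scale (R : comAlgType k) (c : k) (x : twist R) : c *: x = (c%:A ^+ p : R) * x :> R.
Proof. by []. Qed.

Definition twist_incl (R : comAlgType k) : {lrmorphism R -> twist R}.
apply: (@mk_lr k R (twist R) (fun x => x ^+ p)).
- exact: (exp_pD hp).
- by move=> x y; rewrite exprMn.
- by rewrite expr1n.
- by move=> c x; rewrite twist_scale -exprMn -scalerAl mul1r.
Defined.

Arguments twist_incl : simpl never.

Lemma twist_inclE (R : comAlgType k) (x : R) : twist_incl R x = (x ^+ p : R).
Proof. exact: mk_lrE. Qed.

Definition twist_map (R S : comAlgType k) (f : {lrmorphism R -> S}) : {lrmorphism twist R -> twist S}.
apply: (@mk_lr k (twist R) (twist S) f).
- by move=> x y; exact: (rmorphD f x y).
- by move=> x y; exact: (rmorphM f x y).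
- exact: (rmorph1 f).
- by move=> c x; rewrite !twist_scale rmorphM rmorphXn /= linearZ rmorph1.
Defined.

Arguments twist_map : simpl never.

Lemma twist_mapE (R S : comAlgType k) (f : {lrmorphism R -> S}) (x : R) : twist_map f x = (f x : S).
Proof. exact: mk_lrE. Qed.

End Twist.

Section Independence.
Context (k : fieldType) (p : nat) (hp : p \in [pchar k]) (d : nat) (B : coordScheme k d).
Hypothesis ker : forall (R : comAlgType k) (x : cs_obj B R), cs_pi x = 0 -> x ^+ p = 0.
Context (K M : fieldAlgType k) (iota : {lrmorphism K -> M}).
Context (D : {lrmorphism M -> cs_obj B M}) (Dop : B_operator D).
Context (DK : K -> cs_obj B K) (DKE : forall x, Bmap B iota (DK x) = D (iota x)).
Hypothesis closedK : forall x z, iota x = z ^+ p -> exists w, x = w ^+ p.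
Hypothesis constM : forall x : M,
  Bmap B (twist_incl hp M) (D x) = sigma p B (x : twist hp M) -> exists z, x = z ^+ p.

Definition independent (I : finType) (S : {set I}) (c : I -> M) :=
  forall a : I -> K, \sum_(i in S) iota (a i) * c i = 0 -> forall i, i \in S -> a i = 0.

Notation K1 := (twist hp K).
Notation M1 := (twist hp M).
Notation iota1 := (twist_map hp iota).

(** The obstruction, over K^(1/p), to extending the operator to a p-th root of [x]. *)
Definition defect (x : K) : cs_obj B K1 :=
  Bmap B (twist_incl hp K) (DK x) - sigma p B (x : K1).

Lemma defectE x : Bmap B iota1 (defect x) =
  Bmap B (twist_incl hp M) (D (iota x)) - sigma p B (iota x : M1).
Proof.
rewrite rmorphB /= Bmap_sigma -DKE twist_mapE; congr (_ - _).
by apply: cs_eqP => j; rewrite !BmapE twist_mapE !twist_inclE rmorphXn.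
Qed.

Lemma defect0 x : defect x = 0 -> exists w, x = w ^+ p.
Proof.
move=> dx; have /constM[z] : Bmap B (twist_incl hp M) (D (iota x)) = sigma p B (iota x : M1).
  by apply/eqP; rewrite -subr_eq0 -defectE dx rmorph0.
exact: closedK.
Qed.

(** Coordinates of [u] times the generic p-th power, polynomials over K1 in one
    variable which are additive because [sigma] is. *)
Definition scaled (u : cs_obj B K1) (j : 'I_d.+1) : {poly K} :=
  cs_coord j (Bmap B (kpolyC K1) u * sigma p B ('X : kpoly K1)).

Lemma scaledE (S : comAlgType k) (g : {lrmorphism K1 -> S}) (s : S) u j :
  cs_coord j (Bmap B g u * sigma p B s) = (map_poly g (scaled u j : {poly K1})).[s].
Proof.
rewrite -kpoly_evalE /scaled -BmapE rmorphM /= Bmap_sigma kpoly_evalX.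
congr (cs_coord j (_ * _)); symmetry; apply: Bmap_comp => r.
exact: kpoly_evalC.
Qed.

Lemma scaled_coef u j a : (forall r, a != p ^ r)%N -> (scaled u j)`_a = 0.
Proof.
have hpK : p \in [pchar K] := pchar_alg hp K.
apply: (additive_poly hpK) => x y.
pose g : {lrmorphism K1 -> kpoly (kpoly K1)} := (kpolyC (kpoly K1) \o kpolyC K1)%FUN.
have gE : (scaled u j)^:P^:P = map_poly g (scaled u j : {poly K1}).
  by rewrite -map_poly_comp; apply: eq_map_poly => r /=; rewrite !kpolyCE.
rewrite gE -!(scaledE g) (sigmaD hp) mulrDr cs_coordD //.
Qed.

Lemma coef_comp_scale (R : comNzRingType) (q : {poly R}) (c : R) b :
  (q \Po (c%:P * 'X))`_b = q`_b * c ^+ b.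
Proof.
rewrite coef_comp_poly (eq_bigr (fun i : 'I_(size q) => q`_i * c ^+ i * (b == i)%:R)) => [|i _]; last first.
  by rewrite exprMn -polyC_exp coefCM coefXn mulrA.
have [bq|qb] := ltnP b (size q).
  rewrite (bigD1 (Ordinal bq)) //= eqxx mulr1 big1 ?addr0 // => i ib.
  by rewrite (_ : _ == _ = false) ?mulr0 // eq_sym; exact: negbTE.
rewrite nth_default // mul0r big1 // => i _.
by rewrite gtn_eqF ?mulr0 // (leq_trans _ qb).
Qed.

(** Applying the operator to a relation between the c_i^p and subtracting the
    relation itself leaves one between products of defects and p-th powers. Its
    homogeneous parts are relations between the c_i^(p^(r+1)) over K, with one
    term less once a coefficient is normalised to 1; by induction they are
    trivial, so all defects vanish and the relation is the p-th power of one
    between the c_i. *)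
Theorem independent_pow (I : finType) (S : {set I}) (c : I -> M) :
  independent S c -> independent S (fun i => c i ^+ p).
Proof.
have [n] := ubnP #|S|; elim: n S c => // n IH S c; rewrite ltnS => Sn indc a rel.
apply: contrapT => /existsNP[i0] /not_implyP[i0S /eqP ai0].
pose x i := a i / a i0.
have x1 : x i0 = 1 by rewrite /x divff.
have relx : \sum_(i in S) iota (x i) * c i ^+ p = 0.
  rewrite (eq_bigr (fun i => iota (a i0)^-1 * (iota (a i) * c i ^+ p))) => [|i _].
    by rewrite -mulr_sumr rel mulr0.
  by rewrite /x rmorphM mulrA [iota (a i0)^-1 * _]mulrC.
have reld : \sum_(i in S) Bmap B iota1 (defect (x i)) * sigma p B (c i ^+ p : M1) = 0.
  pose fr := twist_incl hp M.
  have relD : \sum_(i in S) Bmap B fr (D (iota (x i))) * sigma p B (c i ^+ p : M1) = 0.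
    transitivity (Bmap B fr (D (\sum_(i in S) iota (x i) * c i ^+ p))).
      rewrite !rmorph_sum /=; apply: eq_bigr => i _.
      have Dc : D (c i ^+ p) = sigma p B (c i).
        by rewrite rmorphXn /= (exp_p_sigma hp ker) Dop.
      by rewrite !rmorphM /= Dc Bmap_sigma /fr twist_inclE.
    by rewrite relx !rmorph0.
  have relS : \sum_(i in S) sigma p B (iota (x i) : M1) * sigma p B (c i ^+ p : M1) = 0.
    transitivity (sigma p B (\sum_(i in S) iota (x i) * c i ^+ p : M1)).
      by rewrite (sigma_sum hp); apply: eq_bigr => i _; rewrite (sigmaM hp ker).
    by rewrite relx sigma0.
  rewrite -[RHS](subrr 0) -[X in X - _]relD -[X in _ - X]relS -sumrB.
  by apply: eq_bigr => i _; rewrite defectE mulrBl.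
have defect1 : defect (x i0) = 0.
  apply: (Bmap_inj (f := iota1)); first by move=> y z; rewrite !twist_mapE => /fmorph_inj.
  by rewrite defectE x1 !rmorph1 (sigma1 hp ker) subrr rmorph0.
(* Multiplying by the p-th power of a generic element separates the homogeneous
   parts of the relation. *)
pose S' := S :\ i0.
have Sn' : (#|S'| < n)%N by move: Sn; rewrite [#|S|](cardsD1 i0) i0S.
have relt j b : \sum_(i in S') iota ((scaled (defect (x i)) j)`_b) * (c i ^+ p) ^+ b = 0.
  pose g : {lrmorphism K1 -> kpoly M1} := (kpolyC M1 \o iota1)%FUN.
  have reldt : \sum_(i in S') Bmap B g (defect (x i)) * sigma p B (kpolyC M1 (c i ^+ p : M1) * 'X) = 0.
    transitivity (Bmap B (kpolyC M1) (\sum_(i in S) Bmap B iota1 (defect (x i)) * sigma p B (c i ^+ p : M1))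
                  * sigma p B ('X : kpoly M1)); last by rewrite reld rmorph0 mul0r.
    rewrite [in RHS](big_setD1 i0) //= defect1 rmorph0 mul0r add0r rmorph_sum mulr_suml.
    apply: eq_bigr => i _; rewrite rmorphM /= Bmap_sigma (sigmaM hp ker) mulrA.
    by rewrite (@Bmap_comp _ _ _ _ _ _ iota1 (kpolyC M1) g).
  have := congr1 (cs_coord j) reldt; rewrite cs_coord_sum cs_coord0.
  move/(congr1 (fun q : {poly M} => q`_b)); rewrite coef0 coef_sum => reljb.
  rewrite -[RHS]reljb; apply: eq_bigr => i _; rewrite scaledE.
  have -> : map_poly g (scaled (defect (x i)) j : {poly K1}) =
            map_poly polyC (map_poly iota (scaled (defect (x i)) j)).
    by rewrite -map_poly_comp; apply: eq_map_poly => r /=; rewrite kpolyCE twist_mapE.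
  rewrite kpolyCE.
  rewrite -[_.[_]]/(map_poly iota (scaled (defect (x i)) j) \Po ((c i ^+ p)%:P * 'X)).
  by rewrite coef_comp_scale coef_map.
have indS' r : independent S' (fun i => c i ^+ (p ^ r)).
  elim: r => [|r IHr].
    move=> y rely i; rewrite in_setD1 => /andP[ii0 iS].
    have := indc (fun i => if i == i0 then 0 else y i).
    rewrite (big_setD1 i0) //= eqxx rmorph0 mul0r add0r => h.
    have := h _ i iS; rewrite (negbTE ii0); apply.
    rewrite -[RHS]rely; apply: eq_bigr => l; rewrite in_setD1 => /andP[/negbTE-> _].
    by rewrite expr1.
  move=> y rely; apply: (IH S' _ Sn' IHr).
  by rewrite -[RHS]rely; apply: eq_bigr => l _; rewrite -exprM expnSr.
have d0 i : i \in S' -> defect (x i) = 0.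
  move=> iS'; have sc0 j : scaled (defect (x i)) j = 0.
    apply/polyP => b; rewrite coef0.
    have [[r /eqP br]|nb] := pselect (exists r, b == p ^ r)%N; last first.
      by apply: scaled_coef => r; apply/negP => br; apply: nb; exists r.
    apply: (indS' r.+1 (fun i => (scaled (defect (x i)) j)`_b)) => //.
    by rewrite -[RHS](relt j b); apply: eq_bigr => l _; rewrite br -exprM expnS.
  apply: cs_eqP => j; rewrite cs_coord0.
  have := @scaledE K1 idfun 1 (defect (x i)) j.
  rewrite sc0 rmorph0 horner0 (sigma1 hp ker) mulr1 BmapE; exact.
have /choice[w wP] : forall i, exists w, i \in S -> x i = w ^+ p.
  move=> i; have [iS|niS] := boolP (i \in S); last by exists 0.
  have [|w ->] := @defect0 (x i); last by exists w.
  by have [->//|ii0] := eqVneq i i0; apply: d0; rewrite in_setD1 ii0.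
have : w i0 = 0.
  apply: (indc w) => //; have : (\sum_(i in S) iota (w i) * c i) ^+ p = 0.
    rewrite (exp_p_sum hp) -[RHS]relx; apply: eq_bigr => i iS.
    by rewrite exprMn (wP i iS) rmorphXn.
  by move/eqP; rewrite expf_eq0 => /andP[_ /eqP].
by move=> w0; have := wP i0 i0S; rewrite x1 w0 (exp_p0 hp) => /eqP; rewrite oner_eq0.
Qed.

End Independence.

(** * Fields from prime ideals stable under an operator *)

Section FieldVia.
Context (k : fieldType) (S : fieldType) (f : {rmorphism k -> S}).
HB.instance Definition _ := GRing.Field.copy (alg_via f) S.
End FieldVia.

Section PrimeQuotient.
Context (R : comNzRingType) (P : prime_idealr R).

Definition prime_quot : Type := {ideal_quot P}.
HB.instance Definition _ := GRing.ComNzRing.copy prime_quot {ideal_quot P}.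

Definition pq_unit : pred prime_quot := fun x => `[< exists y, y * x = 1 >].
Definition pq_inv (x : prime_quot) : prime_quot :=
  if pselect (exists y, y * x = 1) is left ex then sval (cid ex) else x.

Fact pq_mulVx : {in pq_unit, left_inverse 1 pq_inv *%R}.
Proof.
move=> x /asboolP ex; rewrite /pq_inv; case: pselect => // ex'.
exact: (svalP (cid ex')).
Qed.
Fact pq_unitPl (x y : prime_quot) : y * x = 1 -> pq_unit x.
Proof. by move=> yx; apply/asboolP; exists y. Qed.
Fact pq_inv_out : {in [predC pq_unit], pq_inv =1 id}.
Proof.
move=> x; rewrite inE /= => /negP nx; rewrite /pq_inv; case: pselect => // ex.
by case: nx; apply/asboolP.
Qed.
HB.instance Definition _ := GRing.ComNzRing_hasMulInverse.Build prime_quot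
  pq_mulVx pq_unitPl pq_inv_out.
Fact pq_integral : GRing.integral_domain_axiom prime_quot.
Proof. exact: Quotient.rquot_IdomainAxiom. Qed.
HB.instance Definition _ := GRing.ComUnitRing_isIntegral.Build prime_quot pq_integral.
End PrimeQuotient.

Lemma fraction_numden (T : idomainType) (x : {fraction T}) :
  x * FracField.tofrac (frac (repr x)).2 = FracField.tofrac (frac (repr x)).1.
Proof.
rewrite -[X in X * _]reprK; set y := repr x; unlock FracField.tofrac.
rewrite -[LHS]FracField.pi_mul; apply/eqmodP.
rewrite /= FracField.equivfE /FracField.mulf !numden_Ratio ?oner_eq0 ?mulf_neq0 ?denom_ratioP ?oner_eq0 //.
by rewrite !mulr1 mulrC.
Qed.

Definition prime_ideal (R : comNzRingType) (P : set R) :=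
  [/\ P 0, ~ P 1, forall a u v, P u -> P v -> P (a * u + v) &
      forall u v, P (u * v) -> P u \/ P v].

Section ResidueField.
Context (k : fieldType) (R : comAlgType k).

Lemma residue_field (P : set R) : prime_ideal P ->
  exists (L : fieldAlgType k) (theta : {lrmorphism R -> L}),
    (forall r, theta r = 0 <-> P r) /\
    forall x : L, exists a b, theta b != 0 /\ x = theta a / theta b.
Proof.
move=> [P0 P1 Pid Pprime].
pose Pb : R -> bool := fun x => `[< P x >].
have Pb_id : idealr_closed Pb.
  split; first exact/asboolP.
    exact/asboolPn.
  by move=> a u v /asboolP Pu /asboolP Pv; apply/asboolP; exact: Pid.
have Pb_prime : prime_idealr_closed Pb.
  by move=> u v /asboolP/Pprime[] h; apply/orP; [left|right]; apply/asboolP.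
pose I : prime_idealr R := HB.pack Pb (isIdealr.Build R Pb Pb_id) (isPrimeIdealrClosed.Build R Pb Pb_prime).
pose Q : comNzRingType := prime_quot I.
pose pr : R -> Q := fun x => \pi_({ideal_quot I}) x.
have prD : {morph pr : x y / x + y} by move=> x y; rewrite /pr !piE.
have prN : {morph pr : x / - x} by move=> x; rewrite /pr !piE.
have prM : {morph pr : x y / x * y} by move=> x y; rewrite /pr !piE.
have pr1 : pr 1 = 1 by rewrite /pr !piE.
pose tf : R -> {fraction (prime_quot I)} := fun x => FracField.tofrac (pr x : prime_quot I).
have tfD : {morph tf : x y / x + y} by move=> x y; rewrite /tf prD rmorphD.
have tfM : {morph tf : x y / x * y} by move=> x y; rewrite /tf prM rmorphM.
have tf1 : tf 1 = 1 by rewrite /tf pr1 rmorph1.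
have fracP (x : {fraction (prime_quot I)}) : exists a b : prime_quot I,
    b != 0 /\ x = FracField.tofrac a / FracField.tofrac b.
  have [a [b [b0 xb]]] : exists a b : prime_quot I,
      b != 0 /\ x * FracField.tofrac b = FracField.tofrac a.
    exists (frac (repr x)).1, (frac (repr x)).2; split; first exact: denom_ratioP.
    exact: fraction_numden.
  exists a, b; split=> //; rewrite -xb mulfK //.
  by rewrite tofrac_eq0.
pose sc : k -> {fraction (prime_quot I)} := fun c => tf c%:A.
have scB : zmod_morphism sc.
  by move=> x y; rewrite /sc scalerBl /tf prD prN rmorphB.
have scM : monoid_morphism sc.
  by split=> [|x y]; rewrite /sc ?scale1r // -tfM -scalerAl mul1r scalerA.
pose f : {rmorphism k -> {fraction (prime_quot I)}} :=
  HB.pack sc (GRing.isZmodMorphism.Build _ _ sc scB) (GRing.isMonoidMorphism.Build _ _ sc scM).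
pose L : fieldAlgType k := alg_via f.
have tfZ c x : (tf (c *: x) : L) = c *: (tf x : L).
  by rewrite alg_viaE -[_ * _]/(tf c%:A * tf x) -tfM -scalerAl mul1r.
pose theta : {lrmorphism R -> L} := @mk_lr k R L tf tfD tfM tf1 tfZ.
have theta0 r : theta r = 0 <-> P r.
  have -> : (theta r = 0) = (pr r = 0).
    rewrite mk_lrE; apply/propext; split=> [/eqP|h]; first by rewrite tofrac_eq0 => /eqP.
    by rewrite /tf h rmorph0.
  have -> : (pr r = 0) = (pr r == 0) by apply/propext; split=> [->//|/eqP].
  have <- : pr 0 = 0 by apply: (addrI (pr 0)); rewrite -prD !addr0.
  by rewrite /pr -Quotient.idealrBE subr0; split=> [/asboolP|h]; last exact/asboolP.
exists L, theta; split=> // x; have [a [b [b0 xE]]] := fracP x.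
exists (repr (a : {ideal_quot I})), (repr (b : {ideal_quot I})).
by rewrite !mk_lrE /tf /pr !reprK; split=> //; rewrite tofrac_eq0.
Qed.
End ResidueField.

Section Operators.
Context (k : fieldType) (p : nat) (hp : p \in [pchar k]) (d : nat) (B : coordScheme k d).
Hypothesis ker : forall (R : comAlgType k) (x : cs_obj B R), cs_pi x = 0 -> x ^+ p = 0.

(** An operator descends to the quotient by a stable prime ideal, and then
    extends to fractions because an element of the scheme over a field is
    invertible as soon as its first coordinate is. *)
Theorem operator_residue_field (R : comAlgType k) (D : {lrmorphism R -> cs_obj B R})
    (Dop : B_operator D) (P : set R) : prime_ideal P ->
  (forall r, P r -> forall j, P (cs_coord j (D r))) ->
  exists (L : B_field B) (theta : {lrmorphism R -> L}),
    (forall r, theta r = 0 <-> P r) /\ forall r, Bmap B theta (D r) = bf_op L (theta r).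
Proof.
move=> primeP stabP; have [L [theta [theta0 frac]]] := residue_field primeP.
have [E EE] : exists E : {lrmorphism R -> cs_obj B L}, forall r, E r = Bmap B theta (D r).
  by exists (Bmap B theta \o D)%FUN.
have piE r : cs_pi (E r) = theta r by rewrite EE pi_Bmap Dop.
have E0 r : theta r = 0 -> E r = 0.
  move=> /theta0 Pr; rewrite EE; apply: cs_eqP => j; rewrite BmapE cs_coord0.
  exact/theta0/stabP.
have Eeq r s : theta r = theta s -> E r = E s.
  move=> rs; apply/eqP; rewrite -subr_eq0 -rmorphB; apply/eqP/E0.
  by rewrite rmorphB /= rs subrr.
have Einv b : theta b != 0 -> exists y, E b * y = 1.
  by move=> b0; exists (E b ^+ p.-1 * sigma p B (theta b)^-1); apply: (scheme_inverse hp ker);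
    rewrite piE mulfV.
have Ecancel b y z : theta b != 0 -> y * E b = z * E b -> y = z.
  by move=> /Einv[w bw] /(congr1 (fun t => t * w)); rewrite -!mulrA bw !mulr1.
(* The value at a / b is E a / E b; it is characterised by its products with the
   E b, so that no canonical choice of numerators is needed. *)
have /choice[DL DLP] : forall x : L, exists y : cs_obj B L,
    forall a b, theta b != 0 -> x * theta b = theta a -> y * E b = E a.
  move=> x; have [a [b [b0 xE]]] := frac x; have [w bw] := Einv b b0.
  exists (E a * w) => a' b' b0' xE'.
  have : E (a * b') = E (a' * b).
    by apply: Eeq; rewrite !rmorphM /= -xE' xE mulrAC divfK.
  rewrite !rmorphM /= => ab; rewrite mulrAC ab -mulrA bw mulr1 //.
have DLfrac x : exists a b, [/\ theta b != 0, x * theta b = theta a & DL x * E b = E a].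
  have [a [b [b0 xE]]] := frac x; exists a, b; split=> //; first by rewrite xE divfK.
  by apply: DLP => //; rewrite xE divfK.
have DLD : {morph DL : x y / x + y}.
  move=> x y; have [a [b [b0 xb Db]]] := DLfrac x; have [c [e [e0 ye De]]] := DLfrac y.
  apply: (@Ecancel (b * e)); first by rewrite rmorphM mulf_neq0.
  rewrite (@DLP _ (a * e + c * b)); first last.
  - by rewrite !rmorphD !rmorphM /= -xb -ye mulrDl mulrA [theta b * theta e]mulrC mulrA.
  - by rewrite rmorphM mulf_neq0.
  by rewrite !rmorphD !rmorphM /= -Db -De mulrDl mulrA [E b * E e]mulrC mulrA.
have DLM : {morph DL : x y / x * y}.
  move=> x y; have [a [b [b0 xb Db]]] := DLfrac x; have [c [e [e0 ye De]]] := DLfrac y.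
  apply: (@Ecancel (b * e)); first by rewrite rmorphM mulf_neq0.
  rewrite (@DLP _ (a * c)); first last.
  - by rewrite !rmorphM /= -xb -ye mulrACA.
  - by rewrite rmorphM mulf_neq0.
  by rewrite !rmorphM /= -Db -De mulrACA.
have DLtheta r : DL (theta r) = E r.
  have := @DLP (theta r) r 1; rewrite !rmorph1 !mulr1; apply=> //; exact: oner_neq0.
have DL1 : DL 1 = 1 by have := DLtheta 1; rewrite !rmorph1.
have DLZ c x : DL (c *: x) = c *: DL x.
  have tc : theta c%:A = c%:A by rewrite linearZ rmorph1.
  have := DLM (theta c%:A) x; rewrite DLtheta tc -scalerAl mul1r => ->.
  by rewrite linearZ rmorph1 -scalerAl mul1r.
have DLop : B_operator (mk_lr DLD DLM DL1 DLZ).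
  move=> x; rewrite mk_lrE; have [a [b [b0 xb Db]]] := DLfrac x.
  by apply: (mulIf b0); rewrite xb -piE -piM Db piE.
exists (BField DLop), theta; split=> // r.
have := DLtheta r; rewrite EE => <-; symmetry; exact: mk_lrE.
Qed.

(** In a reduced ring the complement of a maximal multiplicative set avoiding 0
    is a (minimal) prime every element of which is killed by some element outside
    it; such a prime is stable under every operator. *)
Theorem operator_reduced (R : comAlgType k) (D : {lrmorphism R -> cs_obj B R})
    (Dop : B_operator D) : (forall r : R, r ^+ p = 0 -> r = 0) ->
  exists (L : B_field B) (theta : {lrmorphism R -> L}),
    forall r, Bmap B theta (D r) = bf_op L (theta r).
Proof.
move=> red.
have redn (r : R) n : r ^+ n = 0 -> r = 0.
  have p1 : (1 < p)%N by exact: prime_gt1 (pcharf_prime hp).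
  move=> rn; have : r ^+ (p ^ n) = 0.
    by rewrite -(subnK (ltnW (ltn_expl n p1))) exprD rn mulr0.
  by elim: n {rn} => [|n IH]; rewrite ?expr1 // expnSr exprM => /red.
pose mult (S : set R) := ~ S 0 /\ forall x y, S x -> S y -> S (x * y).
have [F FP totF|S [[S0 SM] Smax]] := @Zorn_bigcup R mult.
  split=> [[S /FP[]//]|x y [S FS Sx] [T FT Ty]].
  have [ST|TS] := totF _ _ FS FT.
    by exists T => //; have [_] := FP _ FT; apply=> //; exact: ST.
  by exists S => //; have [_] := FP _ FS; apply=> //; exact: TS.
(* By maximality of S, adjoining r to S makes 0 a product. *)
have out1 r : ~ S r -> exists s, (S s \/ s = 1) /\ s * r = 0.
  move=> nSr; apply: contrapT => ns.
  pose T : set R := [set x | exists n s, (S s \/ s = 1) /\ x = s * r ^+ n].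
  apply: (Smax T); first split.
  - by move=> s Ss; exists 0%N, s; rewrite expr0 mulr1; split=> //; left.
  - by move=> TS; apply: nSr; apply: TS; exists 1%N, 1; rewrite expr1 mul1r; split=> //; right.
  split=> [[n [s [Ss /esym s0]]]|x y [n [s [Ss ->]]] [m [t [St ->]]]].
    apply: ns; exists s; split=> //; apply: (redn _ n.+1).
    by rewrite exprMn exprSr exprS mulrACA s0 mulr0.
  exists (n + m)%N, (s * t); rewrite exprD mulrACA; split=> //.
  case: Ss St => [Ss|->] [St|->]; rewrite ?mulr1 ?mul1r; [left|left|left|right] => //.
  exact: SM.
have S1 : S 1.
  apply: contrapT => /out1[s []] + /eqP; rewrite mulr1 => + /eqP s0.
  by rewrite s0 => -[//|/esym/eqP]; rewrite oner_eq0.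
have out r : ~ S r -> exists s, S s /\ s * r = 0.
  by move=> /out1[s [[Ss|->] sr]]; [exists s|exists 1].
pose P : set R := [set r | exists s, S s /\ s * r = 0].
have PS r : P r -> S r -> False by move=> [s [Ss sr]] Sr; apply: S0; rewrite -sr; exact: SM.
have primeP : prime_ideal P.
  split.
  - by exists 1; rewrite mulr0.
  - by move=> P1; exact: (PS 1).
  - move=> a u v [s [Ss su]] [t [St tv]]; exists (s * t); split; first exact: SM.
    by rewrite mulrDr -[s * t * v]mulrA tv mulr0 addr0 [a * u]mulrC mulrACA su mul0r.
  - move=> u v Puv; apply: contrapT => /not_orP[nPu nPv]; apply: (PS _ Puv).
    by apply: SM; apply: contrapT => /out.
have stabP r : P r -> forall j, P (cs_coord j (D r)).
  move=> Pr; have [L [theta [theta0 _]]] := residue_field primeP.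
  suff E0 : Bmap B theta (D r) = 0 by move=> j; apply/theta0; rewrite -BmapE E0 cs_coord0.
  case: Pr => s [Ss sr].
  have s0 : theta s != 0 by apply/eqP => /theta0 Ps; exact: (PS s).
  have := scheme_inverse hp ker (x := Bmap B theta (D s)) (u := (theta s)^-1).
  rewrite pi_Bmap Dop mulfV // => /(_ (erefl _)); set w := (X in _ * X) => sw.
  rewrite -[LHS]mul1r -sw mulrAC -rmorphM -rmorphM /=.
  by rewrite sr !rmorph0 mul0r.
have [L [theta [_ thetaD]]] := operator_residue_field Dop primeP stabP.
by exists L, theta.
Qed.
End Operators.

Section AdjoinRoot.
Context (k : fieldType) (p : nat) (hp : p \in [pchar k]) (d : nat) (B : coordScheme k d).
Hypothesis ker : forall (R : comAlgType k) (x : cs_obj B R), cs_pi x = 0 -> x ^+ p = 0.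
Context (M : B_field B).

(** After Frobenius the gcd of [f] and X^p - x becomes a power (X - x)^m up to a
    scalar, with m > 0. If m < p, its second highest coefficient shows that x is a
    p-th power, because m is its own p-th power in the field. *)
Lemma purely_insep_dvd (x : M) (f : {poly M}) : (forall z : M, x <> z ^+ p) ->
  (map_poly (twist_incl hp M) f).[x : twist hp M] = 0 -> 'X^p - x%:P %| f.
Proof.
move=> nx; have hpM : p \in [pchar M] := pchar_alg hp M.
pose phi : {rmorphism M -> M} := pFrobenius_aut hpM.
have -> : map_poly (twist_incl hp M) f = map_poly phi f.
  by apply: eq_map_poly => r; rewrite twist_inclE.
move=> fx; set g := 'X^p - x%:P.
have gphi : map_poly phi g = ('X - x%:P) ^+ p.
  have hpX : p \in [pchar {poly M}] by rewrite pchar_poly.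
  have -> : ('X - x%:P) ^+ p = 'X^p - (x ^+ p)%:P :> {poly M}.
    by rewrite -(pFrobenius_autE hpX) rmorphB /= polyC_exp.
  by rewrite /g rmorphB /= map_polyXn map_polyC /= (pFrobenius_autE hpM).
pose h := gcdp f g.
have hx : root (map_poly phi h) x.
  by rewrite gcdp_map root_gcd gphi /root fx eqxx /= horner_exp hornerXsubC subrr (exp_p0 hp).
have [m mp hm] : exists2 m, (m <= p)%N & map_poly phi h %= ('X - x%:P) ^+ m.
  by apply/dvdp_exp_XsubCP; rewrite -gphi dvdp_map dvdp_gcdr.
have szh : size h = m.+1.
  by rewrite -(size_map_poly phi) (eqp_size hm) size_exp_XsubC.
have szg : size g = p.+1 by rewrite size_XnsubC // (p_gt0 hp).
have [mlt|pm|mE] := ltngtP m p; last first.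
- have : h %= g by rewrite -dvdp_size_eqp ?dvdp_gcdr // szh szg mE.
  by rewrite /eqp => /andP[_ gh]; apply: dvdp_trans gh _; exact: dvdp_gcdl.
- by rewrite leqNgt pm in mp.
have m0 : (0 < m)%N.
  case: m {mlt mp} hm szh => // hm _; move: hx; rewrite (eqp_root hm) expr0.
  by rewrite (negbTE (root1 x)).
have cm : (('X - x%:P) ^+ m : {poly M})`_m.-1 = - (m%:R * x).
  have := @coefPn_prod_XsubC M (nseq m x); rewrite size_nseq -lt0n m0 => /(_ isT).
  by rewrite !big_nseq iter_mulr_1 iter_addr_0 mulr_natl.
have lm : (('X - x%:P) ^+ m : {poly M})`_m = 1.
  by have /monicP := monic_exp m (monicXsubC x); rewrite /lead_coef size_exp_XsubC.
have /eqpP[[a b] /= /andP[a0 b0] ab] := hm.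
have am i : a * h`_i ^+ p = b * (('X - x%:P) ^+ m : {poly M})`_i.
  by rewrite -(pFrobenius_autE hpM) -coef_map -!coefZ ab.
have := am m; rewrite lm mulr1 => bE; have := am m.-1; rewrite cm => eqx.
have mM : m%:R != 0 :> M.
  by rewrite -(dvdn_pcharf hpM) gtnNdvd.
have hm0 : h`_m != 0.
  by apply: contraNneq b0 => hm0; rewrite -bE hm0 (exp_p0 hp) mulr0.
exfalso; apply: (nx (- (h`_m.-1 / (m%:R * h`_m)))).
have -> : (- (h`_m.-1 / (m%:R * h`_m))) ^+ p = - (h`_m.-1 ^+ p / (m%:R * h`_m ^+ p)).
  rewrite -!(pFrobenius_autE hpM) rmorphN fmorph_div rmorphM /=.
  by rewrite pFrobenius_aut_nat.
have den : m%:R * h`_m ^+ p != 0 by rewrite mulf_neq0 // expf_neq0.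
apply: (mulIf den); rewrite mulNr divfK //; apply: (mulfI a0).
rewrite mulrN eqx -bE mulrN opprK -[RHS]mulrA; congr (_ * _).
by rewrite mulrC mulrAC mulrC.
Qed.

(** Extend the operator to the polynomials in T by lifting T arbitrarily to the
    scheme. The kernel of evaluation at the p-th root of [x] is stable, since the
    p-th power of the lift of T goes to sigma of that root. *)
Lemma adjoin_root (x : M) :
  Bmap B (twist_incl hp M) (bf_op M x) = sigma p B (x : twist hp M) ->
  exists (L : B_field B) (theta : {lrmorphism M -> L}),
    (forall r, Bmap B theta (bf_op M r) = bf_op L (theta r)) /\ exists z, theta x = z ^+ p.
Proof.
move=> cx; have [[z xz]|nz] := pselect (exists z, x = z ^+ p).
  exists M, idfun; split=> [r|]; last by exists z.
  by apply: cs_eqP => j; rewrite BmapE.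
have {}nz z : x <> z ^+ p by move=> xz; apply: nz; exists z.
pose R := kpoly M; pose T : R := 'X.
have [C CE] : exists C : {lrmorphism M -> cs_obj B R}, forall r, C r = Bmap B (kpolyC M) (bf_op M r).
  by exists (Bmap B (kpolyC M) \o bf_op M)%FUN.
pose D : {lrmorphism R -> cs_obj B R} := kpoly_eval C (axis B ord0 T : cs_obj B R).
have DC r : D (kpolyC M r) = Bmap B (kpolyC M) (bf_op M r) by rewrite /D kpoly_evalC CE.
have DT : D T = axis B ord0 T by exact: kpoly_evalX.
have Dop : B_operator D.
  move=> f; elim/poly_ind: f => [|f c IH]; first by rewrite rmorph0 /cs_pi cs_coord0.
  rewrite -[f * 'X + c%:P]/((f : R) * T + c%:P) -kpolyCE rmorphD rmorphM /=.
  rewrite /cs_pi cs_coordD -!/(cs_pi _) piM IH DT pi_axis0 DC pi_Bmap.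
  by have -> : cs_pi (bf_op M c) = c by exact: bf_opP.
pose theta1 : {lrmorphism R -> twist hp M} := kpoly_eval (twist_incl hp M) (x : twist hp M).
pose P : set R := [set f | theta1 f = 0].
have primeP : prime_ideal P.
  split.
  - exact: rmorph0.
  - by rewrite /P /= rmorph1 => /eqP; rewrite oner_eq0.
  - by move=> a u v; rewrite /P /= rmorphD rmorphM /= => -> ->; rewrite mulr0 addr0.
  - move=> u v; rewrite /P /= rmorphM /= => /eqP.
    by rewrite (mulf_eq0 (theta1 u : M) (theta1 v : M)) => /orP[] /eqP; [left|right].
have t1T : theta1 T = x by exact: kpoly_evalX.
have stab r : P r -> forall j, P (cs_coord j (D r)).
  move=> Pr; suff E0 : Bmap B theta1 (D r) = 0 by move=> j; rewrite /P /= -BmapE E0 cs_coord0.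
  have /dvdpP[q ->] : 'X^p - x%:P %| (r : {poly M}).
    by apply: purely_insep_dvd nz _; rewrite -kpoly_evalE.
  have -> : q * ('X^p - x%:P) = (q : R) * (T ^+ p - kpolyC M x) by rewrite kpolyCE.
  rewrite rmorphM rmorphM /= [D (_ - _)]rmorphB rmorphXn /= DT DC rmorphB /=.
  rewrite -/(sigma p B T) Bmap_sigma t1T (@Bmap_comp _ _ _ _ _ _ _ _ (twist_incl hp M)) => [|y].
    by rewrite cx subrr mulr0.
  by rewrite /theta1 kpoly_evalC.
have [L [theta [theta0 thetaD]]] := operator_residue_field hp ker Dop primeP stab.
exists L, (theta \o kpolyC M)%FUN; split=> [r|].
  rewrite -(@Bmap_comp _ _ _ _ _ _ (kpolyC M) theta) // -DC thetaD //.
exists (theta T); have : theta (kpolyC M x - T ^+ p) = 0.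
  apply/theta0; rewrite /P /= rmorphB rmorphXn /= t1T /theta1 kpoly_evalC twist_inclE.
  by rewrite subrr.
by rewrite rmorphB rmorphXn /= => /eqP; rewrite subr_eq0 => /eqP.
Qed.

End AdjoinRoot.

(** * Tensor products and amalgamation *)

Section LinearFunctional.
Context (k : fieldType) (K M : fieldAlgType k) (iota : {lrmorphism K -> M}).

(** A maximal subspace containing the other vectors but not c_(i0) has
    codimension one. *)
Lemma dual_functional (I : finType) (S : {set I}) (c : I -> M) i0 :
  independent iota S c -> i0 \in S ->
  exists f : M -> K, [/\ {morph f : u v / u + v}, forall a u, f (iota a * u) = a * f u,
    f (c i0) = 1 & forall i, i \in S -> i != i0 -> f (c i) = 0].
Proof.
move=> indc i0S; set c0 := c i0.
pose W0 : set M := [set m | exists a : I -> K, m = \sum_(i in S :\ i0) iota (a i) * c i].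
pose subsp (W : set M) := forall a u v, W u -> W v -> W (iota a * u + v).
(* The union of the empty chain is empty: containing W0 is only required of
   nonempty sets. *)
pose good : set (set M) := [set W | [/\ ~ W c0, subsp W & W !=set0 -> W0 `<=` W]].
have W0c i : i \in S -> i != i0 -> W0 (c i).
  move=> iS ii0; exists (fun l => (l == i)%:R).
  rewrite (bigD1 i) ?in_setD1 ?ii0 //= eqxx rmorph1 mul1r big1 ?addr0 // => l /andP[_ /negbTE->].
  by rewrite rmorph0 mul0r.
have goodW0 : good W0.
  split=> [[a c0E]|a u v [b ->] [e ->]|_ //].
    have := indc (fun i => if i == i0 then -1 else a i).
    rewrite (big_setD1 i0) //= eqxx rmorphN rmorph1 mulN1r => h.
    have /eqP : (-1 : K) = 0.
      have := h _ i0 i0S; rewrite eqxx; apply.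
      rewrite -/c0 c0E addrC; apply/eqP; rewrite subr_eq0; apply/eqP.
      by apply: eq_bigr => i; rewrite in_setD1 => /andP[/negbTE-> _].
    by rewrite oppr_eq0 oner_eq0.
  exists (fun i => a * b i + e i); rewrite mulr_sumr -big_split; apply: eq_bigr => i _ /=.
  by rewrite rmorphD rmorphM mulrDl mulrA.
have [F FP totF|W [[Wc0 Wsub WW0] Wmax]] := @Zorn_bigcup M good.
  split=> [[X /FP[]//]|a u v [X FX Xu] [Y FY Yv]|[u [X FX Xu]] w W0w].
    have [XY|YX] := totF _ _ FX FY.
      by exists Y => //; have [_ Ys _] := FP _ FY; apply: Ys => //; exact: XY.
    by exists X => //; have [_ Xs _] := FP _ FX; apply: Xs => //; exact: YX.
  by exists X => //; have [_ _ h] := FP _ FX; apply: h => //; exists u.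
have W00 : W0 0 by exists (fun=> 0); rewrite big1 // => i _; rewrite rmorph0 mul0r.
have Wn0 : W !=set0.
  apply: contrapT => We; apply: (Wmax W0) => //; split=> [m Wm|]; first by exfalso; apply: We; exists m.
  by move=> sub; apply: We; exists 0; exact: sub.
have {}WW0 := WW0 Wn0; have W_0 := WW0 _ W00.
have WZ a u : W u -> W (iota a * u) by move=> Wu; rewrite -[_ * _]addr0; exact: Wsub.
have WD u v : W u -> W v -> W (u + v).
  by move=> Wu Wv; rewrite -[u]mul1r -(rmorph1 iota); exact: Wsub.
have WB u v : W u -> W v -> W (u - v).
  by move=> Wu Wv; rewrite addrC -mulN1r -(rmorph1 iota) -rmorphN; exact: Wsub.
have uniq_coef m a b : W (m - iota a * c0) -> W (m - iota b * c0) -> a = b.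
  move=> Wa Wb; apply/eqP; rewrite -subr_eq0; apply: contrapT => /negP ab.
  apply: Wc0; have := WZ (a - b)^-1 _ (WB _ _ Wb Wa).
  have -> : m - iota b * c0 - (m - iota a * c0) = iota (a - b) * c0.
    by rewrite opprB addrC addrA subrK -mulrBl -rmorphB.
  rewrite mulrA -rmorphM mulVf //.
  by rewrite rmorph1 mul1r.
have ex_coef m : exists a, W (m - iota a * c0).
  have [Wm|nWm] := pselect (W m); first by exists 0; rewrite rmorph0 mul0r subr0.
  pose W' : set M := [set x | exists a w, W w /\ x = iota a * m + w].
  have WW' : W `<=` W' by move=> w Ww; exists 0, w; rewrite rmorph0 mul0r add0r.
  have [a [w [Ww c0E]]] : W' c0.
    apply: contrapT => nc0; apply: (Wmax W'); first split=> //.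
      by move=> sub; apply: nWm; apply: sub; exists 1, 0; rewrite rmorph1 mul1r addr0.
    split=> // [a u v [b [w [Ww ->]]] [e [x [Wx ->]]]|_ x W0x]; last exact/WW'/WW0.
    exists (a * b + e), (iota a * w + x); split; first exact: Wsub.
    by rewrite rmorphD rmorphM mulrDl mulrDr addrACA mulrA.
  have a0 : a != 0.
    by apply/eqP => a0; apply: Wc0; rewrite c0E a0 rmorph0 mul0r add0r.
  exists a^-1; rewrite c0E mulrDr mulrA -rmorphM mulVf // rmorph1 mul1r opprD addrA subrr add0r.
  by rewrite -[- _]add0r; apply: WB => //; exact: WZ.
have /choice[f fP] := ex_coef.
have fE m a : W (m - iota a * c0) -> f m = a by exact: uniq_coef (fP m).
exists f; split.
- move=> u v; apply: fE; rewrite rmorphD mulrDl opprD addrACA; exact: WD.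
- by move=> a u; apply: fE; rewrite rmorphM -mulrA -mulrBr; exact: WZ.
- by apply: fE; rewrite rmorph1 mul1r subrr.
- by move=> i iS ii0; apply: fE; rewrite rmorph0 mul0r subr0; exact/WW0/W0c.
Qed.
End LinearFunctional.

Section Tensor.
Context (k : fieldType) (K M N : fieldAlgType k).
Context (iM : {lrmorphism K -> M}) (iN : {lrmorphism K -> N}).

Record balanced (A : zmodType) (b : M -> N -> A) : Prop := Balanced {
  bal_l : forall m m' n, b (m + m') n = b m n + b m' n;
  bal_r : forall m n n', b m (n + n') = b m n + b m n';
  bal_K : forall x m n, b (iM x * m) n = b m (iN x * n) }.

Definition tsum (A : zmodType) (b : M -> N -> A) (s : seq (M * N)) : A :=
  \sum_(x <- s) b x.1 x.2.

(** Formal sums are identified when every balanced map identifies them, so that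
    the universal property holds by construction. *)
Definition teq : rel (seq (M * N)) := fun s t =>
  `[< forall (A : zmodType) (b : M -> N -> A), balanced b -> tsum b s = tsum b t >].

Lemma teq_equiv : equiv_class_of teq.
Proof.
split=> [s|s t|t s u]; first exact/asboolP.
  by apply/asboolP/asboolP => h A b bb; rewrite h.
by move=> /asboolP st /asboolP tu; apply/asboolP => A b bb; rewrite st // tu.
Qed.
Canonical teq_equivrel := EquivRelPack teq_equiv.

Definition tensor : Type := {eq_quot teq_equivrel}.
HB.instance Definition _ := Choice.copy tensor {eq_quot teq_equivrel}.

Definition tcl (s : seq (M * N)) : tensor := \pi_({eq_quot teq_equivrel}) s.
Definition trep (x : tensor) : seq (M * N) := repr (x : {eq_quot teq_equivrel}).

Lemma trepK x : tcl (trep x) = x. Proof. exact: reprK. Qed.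

Lemma tclP s t : tcl s = tcl t <->
  forall (A : zmodType) (b : M -> N -> A), balanced b -> tsum b s = tsum b t.
Proof.
split=> [/eqmodP/asboolP //|h]; exact/eqmodP/asboolP.
Qed.

Lemma tsum_trep s (A : zmodType) (b : M -> N -> A) : balanced b ->
  tsum b (trep (tcl s)) = tsum b s.
Proof. by move=> bb; have /tclP := trepK (tcl s); apply. Qed.

Definition sopp (s : seq (M * N)) := [seq (- x.1, x.2) | x <- s].
Definition smul (s t : seq (M * N)) := [seq (x.1 * y.1, x.2 * y.2) | x <- s, y <- t].

Lemma tsum_cat (A : zmodType) (b : M -> N -> A) s t : tsum b (s ++ t) = tsum b s + tsum b t.
Proof. exact: big_cat. Qed.

Lemma bal_0l (A : zmodType) (b : M -> N -> A) n : balanced b -> b 0 n = 0.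
Proof. by move=> bb; apply: (addrI (b 0 n)); rewrite -(bal_l bb) !addr0. Qed.

Lemma bal_Nl (A : zmodType) (b : M -> N -> A) m n : balanced b -> b (- m) n = - b m n.
Proof. by move=> bb; apply: (addrI (b m n)); rewrite -(bal_l bb) !subrr bal_0l. Qed.

Lemma tsum_opp (A : zmodType) (b : M -> N -> A) s : balanced b -> tsum b (sopp s) = - tsum b s.
Proof.
by move=> bb; rewrite /tsum big_map -sumrN; apply: eq_bigr => x _; rewrite bal_Nl.
Qed.

Lemma tsum_mul (A : zmodType) (b : M -> N -> A) s t :
  tsum b (smul s t) = tsum (fun m n => tsum (fun m' n' => b (m * m') (n * n')) t) s.
Proof. by rewrite /tsum big_allpairs_dep. Qed.

Lemma tsum_mulC (A : zmodType) (b : M -> N -> A) s t : tsum b (smul s t) = tsum b (smul t s).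
Proof.
rewrite !tsum_mul /tsum exchange_big; apply: eq_bigr => x _; apply: eq_bigr => y _.
by rewrite mulrC [_.2 * _]mulrC.
Qed.

Lemma balanced_mul (A : zmodType) (b : M -> N -> A) t : balanced b ->
  balanced (fun m n => tsum (fun m' n' => b (m * m') (n * n')) t).
Proof.
move=> bb; split=> [m m' n|m n n'|x m n]; rewrite /tsum -?big_split; apply: eq_bigr => y _ /=.
- by rewrite mulrDl (bal_l bb).
- by rewrite mulrDl (bal_r bb).
- by rewrite -!mulrA (bal_K bb).
Qed.

Definition tadd (x y : tensor) : tensor := tcl (trep x ++ trep y).
Definition topp (x : tensor) : tensor := tcl (sopp (trep x)).
Definition tmulr (x y : tensor) : tensor := tcl (smul (trep x) (trep y)).

Lemma tadd_cl s t : tadd (tcl s) (tcl t) = tcl (s ++ t).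
Proof. by apply/tclP => A b bb; rewrite !tsum_cat !tsum_trep. Qed.
Lemma topp_cl s : topp (tcl s) = tcl (sopp s).
Proof. by apply/tclP => A b bb; rewrite !tsum_opp // !tsum_trep. Qed.
Lemma tmulr_cl s t : tmulr (tcl s) (tcl t) = tcl (smul s t).
Proof.
have half r u : tcl (smul (trep (tcl r)) u) = tcl (smul r u).
  apply/tclP => A b bb; rewrite !tsum_mul; exact: tsum_trep (balanced_mul u bb).
have swap r u : tcl (smul r u) = tcl (smul u r).
  by apply/tclP => A b _; exact: tsum_mulC.
by rewrite /tmulr half swap half swap.
Qed.

Fact taddA : associative tadd.
Proof.
by move=> x y z; rewrite -[x]trepK -[y]trepK -[z]trepK !tadd_cl catA.
Qed.
Fact taddC : commutative tadd.
Proof.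
move=> x y; rewrite -[x]trepK -[y]trepK !tadd_cl; apply/tclP => A b bb.
by rewrite !tsum_cat addrC.
Qed.
Fact tadd0 : left_id (tcl [::]) tadd.
Proof. by move=> x; rewrite -[x]trepK tadd_cl. Qed.
Fact taddN : left_inverse (tcl [::]) topp tadd.
Proof.
move=> x; rewrite -[x]trepK topp_cl tadd_cl; apply/tclP => A b bb.
by rewrite tsum_cat tsum_opp // addNr /tsum big_nil.
Qed.
HB.instance Definition _ := GRing.isZmodule.Build tensor taddA taddC tadd0 taddN.

Fact tmulrA : associative tmulr.
Proof.
move=> x y z; rewrite -[x]trepK -[y]trepK -[z]trepK !tmulr_cl; apply/tclP => A b bb.
rewrite !tsum_mul; apply: eq_bigr => u _; rewrite tsum_mul; apply: eq_bigr => v _.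
by apply: eq_bigr => w _; rewrite !mulrA.
Qed.
Fact tmulrC : commutative tmulr.
Proof.
move=> x y; rewrite -[x]trepK -[y]trepK !tmulr_cl; apply/tclP => A b bb; exact: tsum_mulC.
Qed.
Fact tmulr1 : left_id (tcl [:: (1, 1)]) tmulr.
Proof.
move=> x; rewrite -[x]trepK tmulr_cl; apply/tclP => A b bb.
rewrite tsum_mul /tsum big_seq1; apply: eq_bigr => y _.
by rewrite !mul1r.
Qed.
Fact tmulrD : left_distributive tmulr +%R.
Proof.
have addE u v : tcl u + tcl v = tcl (u ++ v) by exact: tadd_cl.
move=> x y z; rewrite -[x]trepK -[y]trepK -[z]trepK addE !tmulr_cl addE.
by apply/tclP => A b bb; rewrite tsum_cat !tsum_mul /tsum big_cat.
Qed.

Fact tensor_nonzero : tcl [:: (1, 1)] != 0.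
Proof.
have [||f [fD fZ f1 _]] := @dual_functional k K M iM 'I_1 (finset.setTfor 'I_1) (fun=> 1) ord0.
- move=> a; rewrite (big_pred1 ord0) => [|i]; last by rewrite finset.in_setT [i]ord1 /= eqxx.
  by rewrite mulr1 => /eqP; rewrite fmorph_eq0 => /eqP a0 i _; rewrite ord1.
- exact: finset.in_setT.
pose b m n := iN (f m) * n.
have bb : balanced b.
  split=> [m m' n|m n n'|x m n]; rewrite /b; first by rewrite fD rmorphD mulrDl.
    by rewrite mulrDr.
  by rewrite fZ rmorphM mulrA [iN x * _]mulrC -mulrA.
apply/eqP => /tclP/(_ _ b bb); rewrite /tsum big_seq1 big_nil /b f1 rmorph1 mulr1 => /eqP.
by rewrite oner_eq0.
Qed.
HB.instance Definition _ := GRing.Zmodule_isComNzRing.Build tensor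
  tmulrA tmulrC tmulr1 tmulrD tensor_nonzero.

Lemma tcl_add s t : tcl s + tcl t = tcl (s ++ t). Proof. exact: tadd_cl. Qed.
Lemma tcl_mul s t : tcl s * tcl t = tcl (smul s t). Proof. exact: tmulr_cl. Qed.

Definition pure (m : M) (n : N) : tensor := tcl [:: (m, n)].

Lemma pureM m n m' n' : pure m n * pure m' n' = pure (m * m') (n * n').
Proof. exact: tcl_mul. Qed.

Lemma pure_balanced : balanced pure.
Proof.
split=> [m m' n|m n n'|x m n]; rewrite ?tcl_add; apply/tclP => A b bb;
  rewrite /tsum ?big_cons ?big_nil /= !addr0; [exact: bal_l|exact: bal_r|exact: bal_K].
Qed.

Lemma tcl_pure s : tcl s = \sum_(x <- s) pure x.1 x.2.
Proof.
elim: s => [|[m n] s IH]; first by rewrite big_nil.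
by rewrite big_cons -IH /pure tcl_add.
Qed.

Definition tlift (A : zmodType) (b : M -> N -> A) (x : tensor) : A := tsum b (trep x).

Lemma tlift_cl (A : zmodType) (b : M -> N -> A) s : balanced b -> tlift b (tcl s) = tsum b s.
Proof. exact: tsum_trep. Qed.

Lemma tlift_pure (A : zmodType) (b : M -> N -> A) m n : balanced b -> tlift b (pure m n) = b m n.
Proof. by move=> bb; rewrite tlift_cl // /tsum big_seq1. Qed.

Lemma tliftD (A : zmodType) (b : M -> N -> A) : balanced b -> {morph tlift b : x y / x + y}.
Proof.
by move=> bb x y; rewrite -[x]trepK -[y]trepK tcl_add !tlift_cl // tsum_cat.
Qed.

Lemma tlift_sum (A : zmodType) (b : M -> N -> A) (I : Type) (r : seq I) (P : pred I) F :
  balanced b -> tlift b (\sum_(i <- r | P i) F i) = \sum_(i <- r | P i) tlift b (F i).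
Proof.
move=> bb; apply: (big_morph _ (tliftD bb)); apply: (addrI (tlift b 0)).
by rewrite -tliftD // !addr0.
Qed.

Definition tensor_scalar : k -> tensor := fun c => pure c%:A 1.
Fact tensor_scalar_zmod : zmod_morphism tensor_scalar.
Proof.
move=> x y; rewrite /tensor_scalar scalerBl (bal_l pure_balanced).
by rewrite (bal_Nl _ _ pure_balanced).
Qed.
Fact tensor_scalar_monoid : monoid_morphism tensor_scalar.
Proof.
split=> [|x y]; rewrite /tensor_scalar ?scale1r //.
by rewrite pureM mulr1 -scalerAl mul1r scalerA.
Qed.
HB.instance Definition _ := GRing.isZmodMorphism.Build k tensor tensor_scalar tensor_scalar_zmod.
HB.instance Definition _ := GRing.isMonoidMorphism.Build k tensor tensor_scalar tensor_scalar_monoid.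

Definition tensor_alg : comAlgType k := alg_via tensor_scalar.

Lemma tensor_scale (c : k) (x : tensor_alg) : c *: x = pure c%:A 1 * x :> tensor.
Proof. by []. Qed.

Definition inM : {lrmorphism M -> tensor_alg}.
apply: (@mk_lr k M tensor_alg (fun m => pure m 1)).
- by move=> x y; exact: (bal_l pure_balanced).
- by move=> x y; rewrite [RHS]pureM mulr1.
- by [].
- by move=> c x; rewrite tensor_scale pureM mulr1 -scalerAl mul1r.
Defined.

Definition inN : {lrmorphism N -> tensor_alg}.
apply: (@mk_lr k N tensor_alg (fun n => pure 1 n)).
- by move=> x y; exact: (bal_r pure_balanced).
- by move=> x y; rewrite [RHS]pureM mulr1.
- by [].
- move=> c x; rewrite tensor_scale pureM mulr1 mul1r.
  have := bal_K pure_balanced c%:A 1 x; rewrite !linearZ !rmorph1 mulr1 => ->.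
  by rewrite -scalerAl mul1r.
Defined.

Arguments inM : simpl never.
Arguments inN : simpl never.

Lemma inME m : inM m = pure m 1. Proof. exact: mk_lrE. Qed.
Lemma inNE n : inN n = pure 1 n. Proof. exact: mk_lrE. Qed.
Lemma inMN m n : inM m * inN n = pure m n.
Proof. by rewrite inME inNE [LHS]pureM mulr1 mul1r. Qed.

Lemma inM_inN x : inM (iM x) = inN (iN x).
Proof. by rewrite inME inNE; have := bal_K pure_balanced x 1 1; rewrite !mulr1. Qed.

(** A dependence between the left factors would let one term be absorbed by the
    others, so an expression of minimal length will do. *)
Lemma tensor_independent (x : tensor) : exists (I : finType) (S : {set I}) (c : I -> M) (b : I -> N),
  independent iM S c /\ x = \sum_(i in S) pure (c i) (b i).
Proof.
pose s := trep x; pose I : finType := 'I_(size s).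
pose c (i : 'I_(size s)) : M := (nth (0, 0) s i).1.
have ex : exists n, `[< exists (S : {set I}) (b : I -> N),
    #|S| = n /\ x = \sum_(i in S) pure (c i) (b i) >].
  exists #|finset.setTfor I|; apply/asboolP; exists (finset.setTfor I), (fun i : 'I_(size s) => (nth (0, 0) s i).2).
  split=> //; rewrite -[LHS]trepK tcl_pure (big_nth (0, 0)) big_mkord.
  by apply: eq_bigl => i; rewrite finset.in_setT.
case: (ex_minnP ex) => n /asboolP[S [b [Sn xE]]] minn.
exists I, S, c, b; split=> // a rel i0 i0S; apply/eqP; apply: contrapT => /negP ai0.
have /minn : `[< exists (S' : {set I}) (b' : I -> N),
    #|S'| = #|S :\ i0| /\ x = \sum_(i in S') pure (c i) (b' i) >].
  apply/asboolP; exists (S :\ i0), (fun i => b i - iN (a i / a i0) * b i0); split=> //.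
  have ci0 : c i0 = \sum_(i in S :\ i0) iM (- (a i / a i0)) * c i.
    have iai0 : iM (a i0) != 0 by rewrite fmorph_eq0.
    apply: (mulfI iai0); apply/eqP; rewrite -subr_eq0 mulr_sumr -sumrN -[X in _ == X]rel.
    rewrite [in X in _ == X](big_setD1 i0) //=; apply/eqP; congr (_ + _).
    apply: eq_bigr => i _; rewrite rmorphN mulNr mulrN opprK mulrA -rmorphM.
    by rewrite mulrC [a i / _]mulrC mulVKf // mulrC.
  rewrite xE (big_setD1 i0) //= {1}ci0.
  have pure_suml (F : I -> M) n' : pure (\sum_(i in S :\ i0) F i) n' = \sum_(i in S :\ i0) pure (F i) n'.
    apply: (big_morph (fun m => pure m n')); first by move=> u v; exact: bal_l pure_balanced _ _ _.
    exact: bal_0l pure_balanced.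
  rewrite pure_suml -big_split /=; apply: eq_bigr => i _.
  by rewrite (bal_K pure_balanced) addrC -(bal_r pure_balanced) rmorphN mulNr.
by rewrite -Sn (cardsD1 i0 S) i0S add1n ltnn.
Qed.

Section Reduced.
Context (p : nat) (hp : p \in [pchar k]).
Hypothesis sep : forall (I : finType) (S : {set I}) (c : I -> M),
  independent iM S c -> independent iM S (fun i => c i ^+ p).

(** The p-th power of a sum of pure tensors with independent left factors again
    has independent left factors, so that functionals isolate the right ones. *)
Lemma tensor_reduced (x : tensor_alg) : x ^+ p = 0 -> x = 0.
Proof.
have [I [S [c [b [indc xE]]]]] := tensor_independent x.
have xp : x ^+ p = \sum_(i in S) pure (c i ^+ p) (b i ^+ p).
  rewrite xE (exp_p_sum hp (R := tensor_alg)); apply: eq_bigr => i _.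
  rewrite -!inMN exprMn !rmorphXn //.
move=> xp0; rewrite xE big1 // => i0 i0S.
have [f [fD fZ f1 f0]] := dual_functional (sep indc) i0S.
pose g m n := iN (f m) * n.
have gb : balanced g.
  split=> [m m' n|m n n'|y m n]; rewrite /g; first by rewrite fD rmorphD mulrDl.
    by rewrite mulrDr.
  by rewrite fZ rmorphM mulrA [iN y * _]mulrC -mulrA.
have := congr1 (tlift g) xp; rewrite xp0 tlift_sum // (bigD1 i0) //= tlift_pure // big1 => [|i /andP[iS ii0]].
  rewrite addr0 /g f1 rmorph1 mul1r.
  have -> : tlift g 0 = 0 by apply: (addrI (tlift g 0)); rewrite -tliftD // !addr0.
  move/esym/eqP; rewrite expf_eq0 => /andP[_ /eqP->].
  by apply: (addrI (pure (c i0) 0)); rewrite -(bal_r pure_balanced) !addr0.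
by rewrite tlift_pure // /g f0 // rmorph0 mul0r.
Qed.
End Reduced.
End Tensor.

Section Amalgamation.
Context (k : fieldType) (p : nat) (hp : p \in [pchar k]) (d : nat) (B : coordScheme k d).
Hypothesis ker : forall (R : comAlgType k) (x : cs_obj B R), cs_pi x = 0 -> x ^+ p = 0.
Context (K : fieldAlgType k) (M N : B_field B).
Context (iM : {lrmorphism K -> M}) (iN : {lrmorphism K -> N}).
Context (DK : K -> cs_obj B K).
Hypotheses (DKM : forall x, Bmap B iM (DK x) = bf_op M (iM x))
  (DKN : forall x, Bmap B iN (DK x) = bf_op N (iN x)).
Hypothesis sep : forall (I : finType) (S : {set I}) (c : I -> M),
  independent iM S c -> independent iM S (fun i => c i ^+ p).

(** The two operators induce one on the tensor product, which is reduced because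
    one side is separable; a minimal prime then gives the amalgam. *)
Theorem amalgamation : exists (L : B_field B) (jM : {lrmorphism M -> L}) (jN : {lrmorphism N -> L}),
  [/\ forall x, Bmap B jM (bf_op M x) = bf_op L (jM x),
      forall y, Bmap B jN (bf_op N y) = bf_op L (jN y) &
      forall x, jM (iM x) = jN (iN x)].
Proof.
pose R := tensor_alg iM iN; pose inl := inM iM iN; pose inr := inN iM iN.
pose b (m : M) (n : N) : cs_obj B R := Bmap B inl (bf_op M m) * Bmap B inr (bf_op N n).
have bb : balanced iM iN b.
  split=> [m m' n|m n n'|x m n]; rewrite /b.
  - by rewrite !rmorphD mulrDl.
  - by rewrite !rmorphD mulrDr.
  rewrite [bf_op M (_ * _)]rmorphM [bf_op N (_ * _)]rmorphM /= -DKM -DKN !rmorphM /=.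
  have -> : Bmap B inl (Bmap B iM (DK x)) = Bmap B inr (Bmap B iN (DK x)).
    by apply: cs_eqP => j; rewrite !BmapE; exact: inM_inN.
  by rewrite mulrA [_ * Bmap B inl _]mulrC.
have bM m m' n n' : b (m * m') (n * n') = b m n * b m' n'.
  by rewrite /b !rmorphM /= mulrACA.
have b1 : b 1 1 = 1 by rewrite /b !rmorph1 mulr1.
pose D := @tlift _ _ _ _ iM iN (cs_obj B R) b.
have DD : {morph (D : R -> cs_obj B R) : x y / x + y} by move=> x y; exact: tliftD bb _ _.
have DM : {morph (D : R -> cs_obj B R) : x y / x * y}.
  move=> x y; rewrite -[x]trepK -[y]trepK [X in D X]tcl_mul /D !tlift_cl // tsum_mul.
  rewrite /tsum mulr_suml; apply: eq_bigr => u _; rewrite mulr_sumr.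
  by apply: eq_bigr => v _; rewrite bM.
have Dpure m n : D (pure iM iN m n) = b m n by exact: tlift_pure bb.
have D1 : (D : R -> cs_obj B R) 1 = 1 by rewrite [LHS]Dpure b1.
have DZ c (x : R) : (D : R -> cs_obj B R) (c *: x) = c *: D x.
  have -> : c *: x = (pure iM iN c%:A 1 : R) * x by [].
  rewrite DM Dpure /b !linearZ /= !rmorph1 mulr1 -scalerAl mul1r //.
pose Dlr : {lrmorphism R -> cs_obj B R} := mk_lr DD DM D1 DZ.
have Dop : B_operator Dlr.
  move=> x; rewrite mk_lrE -[x]trepK /D tlift_cl // tcl_pure /cs_pi /tsum cs_coord_sum.
  apply: eq_bigr => y _; rewrite -/(cs_pi _) piM !pi_Bmap.
  have -> : cs_pi (bf_op M y.1) = y.1 by exact: bf_opP.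
  have -> : cs_pi (bf_op N y.2) = y.2 by exact: bf_opP.
  exact: inMN.
have [L [theta thetaD]] := operator_reduced hp ker Dop (tensor_reduced hp sep).
have Dl x : Dlr (inl x) = Bmap B inl (bf_op M x).
  by rewrite mk_lrE [inl x]inME [LHS]Dpure /b !rmorph1 mulr1.
have Dr y : Dlr (inr y) = Bmap B inr (bf_op N y).
  by rewrite mk_lrE [inr y]inNE [LHS]Dpure /b !rmorph1 mul1r.
exists L, (theta \o inl)%FUN, (theta \o inr)%FUN; split=> [x|y|x] /=.
- by rewrite -(@Bmap_comp _ _ _ _ _ _ inl theta) // -thetaD Dl.
- by rewrite -(@Bmap_comp _ _ _ _ _ _ inr theta) // -thetaD Dr.
- by rewrite /inl inM_inN.
Qed.

End Amalgamation.

(** * Models of the companion as fields with operators *)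

Section TermFunctions.
Context (k : fieldType) (d : nat).
Notation L := (Ld k d).

Definition R_interp (R : comAlgType k) (op : 'I_d -> R -> R) (f : Ld_sym k d) :
    ('I_(@arity L f) -> R) -> R :=
  match f return ('I_(@arity L f) -> R) -> R with
  | SZero => fun _ => 0
  | SOne => fun _ => 1
  | SAdd => fun v => v ord0 + v ord_max
  | SOpp => fun v => - v ord0
  | SMul => fun v => v ord0 * v ord_max
  | SConst c => fun _ => c%:A
  | SOp i => fun v => op i (v ord0)
  end.

Definition R_structure (R : comAlgType k) (op : 'I_d -> R -> R) : structure L :=
  @Structure L R (@R_interp R op).

Definition term_fn := forall (R : comAlgType k) (op : 'I_d -> R -> R), (nat -> R) -> R.

(** The functions of the variables given uniformly by one term, in all algebras
    with arbitrary unary operations: no law is required of the operations, so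
    that terms can be computed before such laws are known. *)
Definition termable (g : term_fn) := exists t : term L, forall R op e,
  @eval L (R_structure op) e t = g R op e.

Lemma termable_var n : termable (fun R op e => e n).
Proof. by exists (Var n). Qed.
Lemma termable_const c : termable (fun R op e => c%:A).
Proof. by exists (lcst d c). Qed.
Lemma termable_add g h : termable g -> termable h -> termable (fun R op e => g R op e + h R op e).
Proof. by move=> [t tP] [u uP]; exists (ladd t u) => R op e /=; rewrite tP uP. Qed.
Lemma termable_mul g h : termable g -> termable h -> termable (fun R op e => g R op e * h R op e).
Proof. by move=> [t tP] [u uP]; exists (lmul t u) => R op e /=; rewrite tP uP. Qed.
Lemma termable_op j g : termable g -> termable (fun R op e => op j (g R op e)).
Proof. by move=> [t tP]; exists (lop j t) => R op e /=; rewrite tP. Qed.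
Lemma termable_zero : termable (fun R op e => 0).
Proof. by exists (lzero k d). Qed.
Lemma termable_one : termable (fun R op e => 1).
Proof. by exists (lone k d). Qed.
Lemma termable_ext g h : (forall R op e, g R op e = h R op e) -> termable g -> termable h.
Proof. by move=> gh [t tP]; exists t => R op e; rewrite tP gh. Qed.
Lemma termable_sum (I : Type) (r : seq I) (g : I -> term_fn) : (forall i, termable (g i)) ->
  termable (fun R op e => \sum_(i <- r) g i R op e).
Proof.
move=> tg; elim: r => [|i r IH].
  by apply: termable_ext termable_zero => R op e; rewrite big_nil.
by apply: termable_ext (termable_add (tg i) IH) => R op e; rewrite big_cons.
Qed.
Lemma termable_pow g n : termable g -> termable (fun R op e => g R op e ^+ n).
Proof.
move=> tg; elim: n => [|n IH]; first exact: termable_one.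
by apply: termable_ext (termable_mul tg IH) => R op e; rewrite exprS.
Qed.

Lemma horner_map_coef (A C : nzRingType) (f : {rmorphism A -> C}) (p : {poly A}) x :
  (map_poly f p).[x] = \sum_(i < size p) f p`_i * x ^+ i.
Proof.
rewrite (@horner_coef_wide _ (size p)); last by rewrite size_poly.
by apply: eq_bigr => i _; rewrite coef_map.
Qed.

Context (B : coordScheme k d).

Lemma axis_mul_coord (R : comAlgType k) i l j (a b : R) :
  cs_coord j (axis B i a * axis B l b) =
  \sum_(m < size (generic_slot B i l j)) (\sum_(n < size (generic_slot B i l j)`_m)
     ((generic_slot B i l j)`_m`_n)%:A * a ^+ n) * b ^+ m.
Proof.
pose k0 : comAlgType k := k^o.
pose f : {lrmorphism kpoly (kpoly k0) -> R} := kpoly_eval (kpoly_eval (scalar_lr R) a) b.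
transitivity (f (generic_slot B i l j)).
  rewrite /generic_slot -BmapE rmorphM /= !Bmap_axis.
  have -> : f ('X : kpoly (kpoly k0)) = b by exact: kpoly_evalX.
  rewrite -(kpolyCE ('X : kpoly k0)) [f (kpolyC _ _)]kpoly_evalC.
  by rewrite (@kpoly_evalX k k0 R (scalar_lr R) a).
rewrite /f kpoly_evalE horner_map_coef; apply: eq_bigr => m _; congr (_ * _).
by rewrite /= kpoly_evalE horner_map_coef; apply: eq_bigr => n _; rewrite /= scalar_lrE.
Qed.

(** By biadditivity, the multiplication of the scheme is given by the polynomials
    which multiply two axis vectors. *)
Lemma termable_mul_coord (X Y : 'I_d.+1 -> term_fn) j :
  (forall i, termable (X i)) -> (forall i, termable (Y i)) ->
  termable (fun R op e => cs_coord j ((\row_i X i R op e : cs_obj B R) * (\row_i Y i R op e : cs_obj B R))).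
Proof.
move=> tX tY.
apply: (@termable_ext (fun R op e => \sum_i \sum_l
    \sum_(m < size (generic_slot B i l j)) (\sum_(n < size (generic_slot B i l j)`_m)
     ((generic_slot B i l j)`_m`_n)%:A * X i R op e ^+ n) * Y l R op e ^+ m)) => [R op e|].
  rewrite [\row_i X i R op e in RHS]cs_sum_axis [\row_i Y i R op e in RHS]cs_sum_axis.
  rewrite mulr_suml cs_coord_sum; apply: eq_bigr => i _.
  rewrite mulr_sumr cs_coord_sum; apply: eq_bigr => l _.
  by rewrite axis_mul_coord /cs_coord !mxE.
apply: termable_sum => i; apply: termable_sum => l; apply: termable_sum => m.
apply: termable_mul; last exact: termable_pow.
apply: termable_sum => n; apply: termable_mul; last exact: termable_pow.
exact: termable_const.
Qed.

Definition bf_ops (F : B_field B) : 'I_d -> F -> F :=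
  fun j x => cs_coord (lift ord0 j) (bf_op F x).

Lemma B_eval (F : B_field B) (e : nat -> F) t :
  @eval L (B_structure F) e t = @eval L (R_structure (@bf_ops F)) e t.
Proof.
by [].
Qed.

Definition op_row (R : comAlgType k) (op : 'I_d -> R -> R) (x : R) : cs_obj B R :=
  \row_i (if unlift ord0 i is Some j then op j x else x).

Lemma op_row_bf (F : B_field B) (x : F) : op_row (@bf_ops F) x = bf_op F x.
Proof.
apply: cs_eqP => i; rewrite {1}/cs_coord mxE.
by case: (unliftP ord0 i) => [j ->|->] //; symmetry; exact: bf_opP.
Qed.

Lemma termable_op_row g i : termable g -> termable (fun R op e => cs_coord i (op_row op (g R op e))).
Proof.
move=> tg; apply: (@termable_ext (fun R op e => if unlift ord0 i is Some j then op j (g R op e) else g R op e)).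
  by move=> R op e; rewrite /cs_coord mxE.
by case: unlift => [j|] //; exact: termable_op.
Qed.

Lemma one_coord (R : comAlgType k) (c : k) j :
  cs_coord j (c *: (1 : cs_obj B R)) = (cs_coord j (c *: (1 : cs_obj B k^o)))%:A.
Proof. by rewrite -scalar_lrE -BmapE linearZ /= rmorph1. Qed.

End TermFunctions.

Section ModelField.
Context (k : fieldType) (d : nat) (B : coordScheme k d) (M : structure (Ld k d)).
Notation L := (Ld k d).

Definition madd (x y : M) : M := @interp L M SAdd (fun i : 'I_2 => if i == ord0 then x else y).
Definition mmul (x y : M) : M := @interp L M SMul (fun i : 'I_2 => if i == ord0 then x else y).
Definition mopp (x : M) : M := @interp L M SOpp (fun=> x).
Definition mop (j : 'I_d) (x : M) : M := @interp L M (SOp k j) (fun=> x).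
Definition mzero : M := @interp L M SZero (fun i => match notF (ltn_ord i) with end).
Definition mone : M := @interp L M SOne (fun i => match notF (ltn_ord i) with end).
Definition mcst (c : k) : M := @interp L M (SConst d c) (fun i => match notF (ltn_ord i) with end).

Hypothesis ident : forall t u : term L,
  (forall (F : B_field B) (e : nat -> F), @eval L (B_structure F) e t = @eval L (B_structure F) e u) ->
  forall e : nat -> M, eval e t = eval e u.
Hypothesis mone_neq0 : mone <> mzero.
Hypothesis minverse : forall x, x <> mzero -> exists y, mmul x y = mone.

Lemma eval_ladd (e : nat -> M) t u : eval e (ladd t u) = madd (eval e t) (eval e u).
Proof. by rewrite /=; congr interp; apply/funext => i; case: eqP. Qed.
Lemma eval_lmul (e : nat -> M) t u : eval e (lmul t u) = mmul (eval e t) (eval e u).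
Proof. by rewrite /=; congr interp; apply/funext => i; case: eqP. Qed.
Lemma eval_lzero (e : nat -> M) : eval e (lzero k d) = mzero.
Proof. by rewrite /=; congr interp; apply/funext => -[]. Qed.
Lemma eval_lone (e : nat -> M) : eval e (lone k d) = mone.
Proof. by rewrite /=; congr interp; apply/funext => -[]. Qed.
Lemma eval_lcst (e : nat -> M) c : eval e (lcst d c) = mcst c.
Proof. by rewrite /=; congr interp; apply/funext => -[]. Qed.
Definition evalE := (eval_ladd, eval_lmul, eval_lzero, eval_lone, eval_lcst).

Notation v0 := (Var 0 : term L).
Notation v1 := (Var 1 : term L).
Notation v2 := (Var 2 : term L).
Definition env (x y z : M) : nat -> M := fun n => nth z [:: x; y] n.

Fact maddA : associative madd.
Proof.
move=> x y z; have := ident (t := ladd v0 (ladd v1 v2)) (u := ladd (ladd v0 v1) v2).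
by move=> /(_ _ (env x y z)); rewrite !evalE; apply=> F e /=; rewrite addrA.
Qed.
Fact maddC : commutative madd.
Proof.
move=> x y; have := ident (t := ladd v0 v1) (u := ladd v1 v0).
by move=> /(_ _ (env x y x)); rewrite !evalE; apply=> F e /=; rewrite addrC.
Qed.
Fact madd0 : left_id mzero madd.
Proof.
move=> x; have := ident (t := ladd (lzero k d) v0) (u := v0).
by move=> /(_ _ (env x x x)); rewrite !evalE; apply=> F e /=; rewrite add0r.
Qed.
Fact maddN : left_inverse mzero mopp madd.
Proof.
move=> x; have := ident (t := ladd (lopp v0) v0) (u := lzero k d).
by move=> /(_ _ (env x x x)); rewrite !evalE; apply=> F e /=; rewrite addNr.
Qed.
Fact mmulA : associative mmul.
Proof.
move=> x y z; have := ident (t := lmul v0 (lmul v1 v2)) (u := lmul (lmul v0 v1) v2).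
by move=> /(_ _ (env x y z)); rewrite !evalE; apply=> F e /=; rewrite mulrA.
Qed.
Fact mmulC : commutative mmul.
Proof.
move=> x y; have := ident (t := lmul v0 v1) (u := lmul v1 v0).
by move=> /(_ _ (env x y x)); rewrite !evalE; apply=> F e /=; rewrite mulrC.
Qed.
Fact mmul1 : left_id mone mmul.
Proof.
move=> x; have := ident (t := lmul (lone k d) v0) (u := v0).
by move=> /(_ _ (env x x x)); rewrite !evalE; apply=> F e /=; rewrite mul1r.
Qed.
Fact mmulD : left_distributive mmul madd.
Proof.
move=> x y z; have := ident (t := lmul (ladd v0 v1) v2) (u := ladd (lmul v0 v2) (lmul v1 v2)).
by move=> /(_ _ (env x y z)); rewrite !evalE; apply=> F e /=; rewrite mulrDl.
Qed.

Definition mring : Type := M.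
HB.instance Definition _ := gen_eqMixin mring.
HB.instance Definition _ := gen_choiceMixin mring.
HB.instance Definition _ := GRing.isZmodule.Build mring maddA maddC madd0 maddN.
Fact mone_neq : (mone : mring) != 0. Proof. exact/eqP. Qed.
HB.instance Definition _ := GRing.Zmodule_isComNzRing.Build mring mmulA mmulC mmul1 mmulD mone_neq.

Definition minv (x : mring) : mring :=
  if pselect (exists y : mring, x * y = 1) is left ex then sval (cid ex) else 0.
Fact mmulV (x : mring) : x != 0 -> minv x * x = 1.
Proof.
move=> /eqP /minverse ex; rewrite /minv; case: pselect => // ex'.
by rewrite mulrC; exact: (svalP (cid ex')).
Qed.
Fact minv0 : minv 0 = 0.
Proof.
rewrite /minv; case: pselect => // ex; exfalso; case: ex => y.
by rewrite mul0r => /esym/eqP; rewrite oner_eq0.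
Qed.
HB.instance Definition _ := GRing.ComNzRing_isField.Build mring mmulV minv0.

Definition mscal : k -> mring := mcst.
Fact mscal_zmod : zmod_morphism mscal.
Proof.
move=> a b; have := ident (t := lcst d (a - b)) (u := ladd (lcst d a) (lopp (lcst d b))).
move=> /(_ _ (fun=> mzero)); rewrite !evalE -[eval _ (lopp _)]/(mopp (eval _ (lcst d b))) eval_lcst.
by apply=> F e /=; rewrite scalerBl.
Qed.
Fact mscal_monoid : monoid_morphism mscal.
Proof.
split=> [|a b].
  have := ident (t := lcst d 1) (u := lone k d) => /(_ _ (fun=> mzero)).
  by rewrite !evalE; apply=> F e /=; rewrite scale1r.
have := ident (t := lcst d (a * b)) (u := lmul (lcst d a) (lcst d b)) => /(_ _ (fun=> mzero)).
by rewrite !evalE; apply=> F e /=; rewrite -scalerAl mul1r scalerA.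
Qed.
HB.instance Definition _ := GRing.isZmodMorphism.Build k mring mscal mscal_zmod.
HB.instance Definition _ := GRing.isMonoidMorphism.Build k mring mscal mscal_monoid.

Definition mfield : fieldAlgType k := alg_via mscal.

Lemma mcstE c : c%:A = mcst c :> mfield.
Proof. by rewrite alg_viaE mulr1. Qed.

Lemma M_interp f (a : 'I_(@arity L f) -> M) :
  @interp L M f a = @R_interp k d mfield mop f a.
Proof.
case: f a => [a|a|a|a|a|c a|j a] /=.
- by congr interp; apply/funext => -[].
- by congr interp; apply/funext => -[].
- by congr interp; apply/funext => i; case: i => -[|[]] //= i; congr a; apply/val_inj.
- by congr interp; apply/funext => i; congr a; rewrite ord1.
- by congr interp; apply/funext => i; case: i => -[|[]] //= i; congr a; apply/val_inj.
- by rewrite mcstE; congr interp; apply/funext => -[].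
- by congr interp; apply/funext => i; congr a; rewrite ord1.
Qed.

Lemma M_eval (e : nat -> M) t : eval e t = @eval L (@R_structure k d mfield mop) e t.
Proof.
elim: t => [//|f a IH].
have IHa : (fun i => eval e (a i)) = (fun i => @eval L (@R_structure k d mfield mop) e (a i)).
  by apply/funext => i; exact: IH.
by rewrite [LHS]M_interp IHa.
Qed.

(** Through this the multiplicativity of the operators, which involves the
    multiplication of the scheme, is read off from equations between terms. *)
Lemma term_law (g h : term_fn k d) : termable g -> termable h ->
  (forall (F : B_field B) e, g F (@bf_ops k d B F) e = h F (@bf_ops k d B F) e) ->
  forall e, g mfield mop e = h mfield mop e.
Proof.
move=> [t tP] [u uP] gh e; rewrite -tP -uP -!M_eval; apply: ident => F e'.
by rewrite !B_eval tP uP gh.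
Qed.

Definition mD (x : mfield) : cs_obj B mfield := @op_row k d B mfield mop x.

Lemma mDD : {morph mD : x y / x + y}.
Proof.
move=> x y; apply: cs_eqP => j; rewrite cs_coordD.
have := @term_law (fun R op e => cs_coord j (op_row B op (e 0%N + e 1%N)))
  (fun R op e => cs_coord j (op_row B op (e 0%N)) + cs_coord j (op_row B op (e 1%N))).
move=> /(_ _ _ _ (env x y x)); apply.
- by apply: termable_op_row; apply: termable_add; exact: termable_var.
- by apply: termable_add; apply: termable_op_row; exact: termable_var.
- by move=> F e; rewrite !op_row_bf rmorphD cs_coordD.
Qed.

Lemma mDM : {morph mD : x y / x * y}.
Proof.
move=> x y; apply: cs_eqP => j.
have := @term_law (fun R op e => cs_coord j (op_row B op (e 0%N * e 1%N)))
  (fun R op e => cs_coord j ((\row_i cs_coord i (op_row B op (e 0%N)) : cs_obj B R) *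
                             (\row_i cs_coord i (op_row B op (e 1%N)) : cs_obj B R))).
have rowE (R : comAlgType k) (z : cs_obj B R) : (\row_i cs_coord i z : cs_obj B R) = z.
  by apply: cs_eqP => i; rewrite {1}/cs_coord mxE.
move=> /(_ _ _ _ (env x y x)); rewrite !rowE; apply.
- by apply: termable_op_row; apply: termable_mul; exact: termable_var.
- by apply: termable_mul_coord => i; apply: termable_op_row; exact: termable_var.
- by move=> F e; rewrite !rowE !op_row_bf rmorphM.
Qed.

Lemma mD_const c : mD c%:A = c *: 1.
Proof.
apply: cs_eqP => j.
have := @term_law (fun R op e => cs_coord j (op_row B op c%:A))
  (fun R op e => (cs_coord j (c *: (1 : cs_obj B k^o)))%:A).
move=> /(_ _ _ _ (fun=> 0)); rewrite -one_coord; apply.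
- by apply: termable_op_row; exact: termable_const.
- exact: termable_const.
- by move=> F e; rewrite op_row_bf -one_coord linearZ rmorph1.
Qed.

Lemma mD1 : mD 1 = 1.
Proof. by have := mD_const 1; rewrite !scale1r. Qed.

Lemma mDZ c x : mD (c *: x) = c *: mD x.
Proof. by rewrite -[x in LHS]mul1r scalerAl mDM mD_const -scalerAl mul1r. Qed.

Lemma mD_op : B_operator (mk_lr mDD mDM mD1 mDZ).
Proof. by move=> x; rewrite mk_lrE /cs_pi /cs_coord mxE unlift_none. Qed.

Definition model_B_field : B_field B := BField mD_op.

Lemma model_B_field_embedding :
  exists (F : B_field B) (h : M -> F) (h' : F -> M),
    [/\ cancel h h', cancel h' h & @embedding L M (B_structure F) h].
Proof.
exists model_B_field, id, id; split=> //; split=> // f a; rewrite M_interp.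
case: f a => //= j a; rewrite /bf_ops mk_lrE /cs_coord mxE liftK //.
Qed.

End ModelField.

(** * Embeddings and the model companion *)

Section Embeddings.
Context (L : language).

Lemma embedding_comp (M N P : structure L) (f : M -> N) (g : N -> P) :
  embedding f -> embedding g -> embedding (g \o f).
Proof.
move=> [fI fE] [gI gE]; split=> [|s a]; first exact: inj_comp.
by rewrite /= fE gE.
Qed.

Lemma embedding_eval (M N : structure L) (f : M -> N) (e : nat -> M) t :
  embedding f -> f (eval e t) = eval (f \o e) t.
Proof.
move=> [_ fE]; elim: t => //= s a IH; rewrite fE; congr interp.
by apply/funext => i; exact: IH.
Qed.

Lemma embedding_qf (M N : structure L) (f : M -> N) (e : nat -> M) phi :
  embedding f -> quantifier_free phi -> sat e phi <-> sat (f \o e) phi.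
Proof.
move=> fE; elim: phi => //= [t u _|phi IH1 psi IH2 [q1 q2]].
  by rewrite -!embedding_eval //; split=> [->//|]; case: fE => fI _ /fI.
by rewrite IH1 // IH2.
Qed.

Lemma update_comp (T U : Type) (f : T -> U) e n x : f \o update e n x = update (f \o e) n (f x).
Proof. by apply/funext => m; rewrite /update /=; case: eqP. Qed.

Lemma embedding_ex (M N : structure L) (f : M -> N) (e : nat -> M) n phi :
  embedding f -> quantifier_free phi -> sat e (Ex n phi) -> sat (f \o e) (Ex n phi).
Proof.
move=> fE q /sat_ex[x xP]; apply/sat_ex; exists (f x).
by rewrite -update_comp; exact/(embedding_qf _ fE q).
Qed.

Fixpoint closure n (phi : formula L) := if n is n'.+1 then All n' (closure n' phi) else phi.

Lemma closure_free n phi m : free_in m (closure n phi) -> free_in m phi /\ (n <= m)%N.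
Proof.
elim: n => [|n IH] //= [mn /IH[fm nm]]; split=> //.
by rewrite ltn_neqAle nm andbT eq_sym; apply/eqP.
Qed.

Lemma closure_sat n phi (M : structure L) :
  (forall e : nat -> M, sat e phi) <-> (forall e : nat -> M, sat e (closure n phi)).
Proof.
elim: n => [//|n IH]; rewrite IH /=; split=> h e; first by move=> x; exact: h.
have := h e (e n); rewrite (_ : update e n (e n) = e) //.
by apply/funext => m; rewrite /update; case: eqP => // ->.
Qed.

End Embeddings.

Section Companion.
Context (k : fieldType) (p : nat) (hp : p \in [pchar k]) (d : nat) (B : coordScheme k d).
Notation L := (Ld k d).

Lemma B_embedding (F G : B_field B) (f : {lrmorphism F -> G}) :
  (forall x, Bmap B f (bf_op F x) = bf_op G (f x)) ->
  @embedding L (B_structure F) (B_structure G) f.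
Proof.
move=> fD; split; first exact: fmorph_inj.
case=> [a|a|a|a|a|c a|j a] /=.
- exact: rmorph0.
- exact: rmorph1.
- exact: rmorphD.
- exact: rmorphN.
- exact: rmorphM.
- by rewrite linearZ rmorph1.
- by rewrite -fD BmapE.
Qed.

Lemma eval_lpow (F : B_field B) (e : nat -> F) t n :
  @eval L (B_structure F) e (lpow t n) = (@eval L (B_structure F) e t : F) ^+ n.
Proof. by elim: n => [|n IH] //; rewrite exprS -IH. Qed.

Lemma B_field_model (F : B_field B) : model (theory_of_B_fields B) (B_structure F).
Proof. by move=> phi [_]; apply. Qed.

Lemma valid_sat (N : structure L) (phi : formula L) : model (theory_of_B_fields B) N ->
  (forall (F : B_field B) (e : nat -> B_structure F), sat e phi) -> forall e : nat -> N, sat e phi.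
Proof.
move=> TN val; have [b bP] := formula_bound phi.
apply: (proj2 (closure_sat b phi N)) => e; apply: TN; split.
  by move=> n /closure_free[/bP nb]; rewrite leqNgt nb.
by move=> F; apply: (proj1 (closure_sat b phi _)); exact: val.
Qed.

Context (BDCF : theory L) (hBDCF : model_companion BDCF (theory_of_B_fields B)).

Lemma companion_hull (F : B_field B) : exists (M : structure L) (g : F -> M),
  model BDCF M /\ @embedding L (B_structure F) M g.
Proof.
by have [_ _ up _] := hBDCF; have [M [g [mM gE]]] := up _ (@B_field_model F); exists M, g.
Qed.

Lemma companion_elementary (M M' : structure L) (f : M -> M') :
  model BDCF M -> model BDCF M' -> embedding f -> elementary f.
Proof. by have [_ mc _ _] := hBDCF; exact: mc. Qed.

(** Universal laws of fields with operators hold in a model since it embeds into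
    one of their theory; inverses exist in it by model completeness. *)
Lemma companion_B_field (M : structure L) : model BDCF M ->
  exists (F : B_field B) (h : M -> F) (h' : F -> M),
    [/\ cancel h h', cancel h' h & @embedding L M (B_structure F) h].
Proof.
move=> mM; have [_ _ up down] := hBDCF.
have [N [f [TN fE]]] := down _ mM; have [fI _] := fE.
have [M' [g [mM' gE]]] := up _ TN.
have elem := companion_elementary mM mM' (embedding_comp fE gE).
have qf_law phi : quantifier_free phi ->
    (forall (F : B_field B) (e : nat -> B_structure F), sat e phi) -> forall e : nat -> M, sat e phi.
  by move=> q val e; apply/(embedding_qf _ fE q)/valid_sat.
have m1 : mone M <> mzero M.
  move=> m10; apply: (qf_law (Neg (Eq (lone k d) (lzero k d))) _ _ (fun=> mzero M)) => //.
    by move=> F e /= /eqP; rewrite oner_eq0.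
  exact: etrans (eval_lone _) (etrans m10 (esym (eval_lzero _))).
apply: (model_B_field_embedding (M := M)) => //.
- by move=> t u tu e; apply: (qf_law (Eq t u)).
move=> x x0; pose inv := Eq (lmul (Var 0) (Var 1)) (lone k d).
pose phi := Imp (Neg (Eq (Var 0) (lzero k d))) (Ex 1 inv).
have /(_ (f \o (fun=> x))) : forall e : nat -> N, sat e phi.
  apply: valid_sat TN _ => F e e0; apply: (proj2 (@sat_ex L (B_structure F) e 1 inv)); exists (e 0%N : F)^-1.
  by rewrite /= mulfV //; apply/eqP.
move=> phix.
have fx0 : sat (f \o (fun=> x)) (Neg (Eq (Var 0) (lzero k d))).
  have : sat (fun=> x) (Neg (Eq (Var 0) (lzero k d))).
    by move=> x0'; apply: x0; rewrite -(eval_lzero (fun=> x)); exact: x0'.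
  by move/(embedding_qf _ fE); apply.
have invx := @embedding_ex L N M' g _ 1 inv gE I (phix fx0).
have [y xy] := proj1 (sat_ex _ _ _) (proj2 (elem (Ex 1 inv) (fun=> x)) invx).
exists y; have := etrans (esym (eval_lmul _ _ _)) (etrans xy (eval_lone _)); exact.
Qed.

Hypothesis ker : forall (R : comAlgType k) (x : cs_obj B R), cs_pi x = 0 -> x ^+ p = 0.

(** The root of a constant exists in some extension, hence, by model completeness,
    already in the model. *)
Lemma companion_constants (M : structure L) (F : B_field B) (h : M -> F) (h' : F -> M) :
  model BDCF M -> cancel h' h -> @embedding L M (B_structure F) h ->
  forall x : F, Bmap B (twist_incl hp F) (bf_op F x) = sigma p B (x : twist hp F) ->
    exists z, x = z ^+ p.
Proof.
move=> mM h'K hE x cx; have [E [theta [thetaD [z xz]]]] := adjoin_root ker cx.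
have [M' [g [mM' gE]]] := companion_hull E.
have emb : embedding ((g \o theta) \o h).
  apply: embedding_comp hE _; exact: embedding_comp (B_embedding thetaD) gE.
pose phi := Ex 1 (Eq (lpow (Var 1) p) (Var 0) : formula L).
have phiP (F' : B_field B) (y : F') : @sat L (B_structure F') (fun=> y) phi <-> exists z, y = z ^+ p.
  split=> [/sat_ex[w]|[w yw]].
    by rewrite /= eval_lpow /update /= => <-; exists w.
  by apply/sat_ex; exists w; rewrite /= eval_lpow /update /= yw.
have Ephi : @sat L (B_structure E) (fun=> theta x) phi by apply/phiP; exists z.
have M'phi := @embedding_ex L (B_structure E) M' g _ 1 (Eq (lpow (Var 1) p) (Var 0)) gE I Ephi.
have Mphi : sat (fun=> h' x) phi.
  apply/(companion_elementary mM mM' emb).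
  have -> : (g \o theta) \o h \o (fun=> h' x) = g \o (fun n : nat => theta x).
    by apply/funext => n /=; rewrite h'K.
  exact: M'phi.
have := @embedding_ex L M (B_structure F) h _ 1 (Eq (lpow (Var 1) p) (Var 0)) hE I Mphi.
have -> : h \o (fun=> h' x) = (fun n : nat => x) by apply/funext => n /=; rewrite h'K.
by move/phiP.
Qed.

End Companion.

(** * The amalgamation base *)

Section Subfield.
Context (k : fieldType) (F : fieldAlgType k) (P : set F).
Hypotheses (P1 : P 1) (PB : forall x y, P x -> P y -> P (x - y))
  (PV : forall x y, P x -> P y -> P (x / y)) (PZ : forall c, P c%:A).

Definition subfield_pred : {pred F} := fun x => `[< P x >].
Fact subfield_closed : divring_closed subfield_pred.
Proof.
split=> [|x y|x y]; first exact/asboolP.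
  by move=> /asboolP Px /asboolP Py; apply/asboolP; exact: PB.
by move=> /asboolP Px /asboolP Py; apply/asboolP; exact: PV.
Qed.
HB.instance Definition _ := GRing.isDivringClosed.Build F subfield_pred subfield_closed.
Definition subfield_carrier : Type := {x : F | x \in subfield_pred}.
HB.instance Definition _ := SubType.on subfield_carrier.
HB.instance Definition _ := Choice.on subfield_carrier.
HB.instance Definition _ := [SubChoice_isSubIntegralDomain of subfield_carrier by <:].
HB.instance Definition _ := [SubIntegralDomain_isSubField of subfield_carrier by <:].

Definition subfield_scalar (c : k) : subfield_carrier := exist _ c%:A (asboolT (PZ c)).
Fact subfield_scalar_zmod : zmod_morphism subfield_scalar.
Proof. by move=> a b; apply/val_inj; rewrite rmorphB /= scalerBl. Qed.
Fact subfield_scalar_monoid : monoid_morphism subfield_scalar.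
Proof.
split=> [|a b]; apply/val_inj; first by rewrite rmorph1 /= scale1r.
by rewrite rmorphM /= -scalerAl mul1r scalerA.
Qed.
HB.instance Definition _ := GRing.isZmodMorphism.Build k subfield_carrier subfield_scalar subfield_scalar_zmod.
HB.instance Definition _ := GRing.isMonoidMorphism.Build k subfield_carrier subfield_scalar subfield_scalar_monoid.

Definition subfield_alg : fieldAlgType k := alg_via subfield_scalar.

Definition subfield_val : {lrmorphism subfield_alg -> F}.
apply: (@mk_lr k subfield_alg F (val : subfield_carrier -> F)).
- exact: rmorphD.
- exact: rmorphM.
- exact: rmorph1.
- by move=> c x; rewrite alg_viaE [LHS]rmorphM /= -scalerAl mul1r.
Defined.

Lemma subfield_valE (x : subfield_carrier) : subfield_val x = val x.
Proof. exact: mk_lrE. Qed.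

Lemma subfield_valP x : P (subfield_val x).
Proof. by rewrite subfield_valE; apply/asboolP; exact: valP x. Qed.

Lemma subfield_ex x : P x -> exists w, subfield_val w = x.
Proof. by move=> Px; exists (exist _ x (asboolT Px)); rewrite subfield_valE. Qed.
End Subfield.

(** Used with a correspondence given by pairs of values of the same term, where no
    map is available beforehand. *)
Lemma graph_field (k : fieldType) (F G : fieldAlgType k) (Gam : F -> G -> Prop) :
  Gam 1 1 -> (forall x y x' y', Gam x y -> Gam x' y' -> Gam (x - x') (y - y')) ->
  (forall x y x' y', Gam x y -> Gam x' y' -> Gam (x / x') (y / y')) ->
  (forall c, Gam c%:A c%:A) -> (forall y, Gam 0 y -> y = 0) ->
  exists (K : fieldAlgType k) (iF : {lrmorphism K -> F}) (iG : {lrmorphism K -> G}),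
    (forall w, Gam (iF w) (iG w)) /\
    (forall x y, Gam x y -> exists w, iF w = x /\ iG w = y).
Proof.
move=> G1 GB GV GZ G0; pose P : set F := [set x | exists y, Gam x y].
have P1 : P 1 by exists 1.
have PB x y : P x -> P y -> P (x - y) by move=> [a xa] [b yb]; exists (a - b); exact: GB.
have PV x y : P x -> P y -> P (x / y) by move=> [a xa] [b yb]; exists (a / b); exact: GV.
have PZ c : P c%:A by exists c%:A.
pose K := subfield_alg P1 PB PV PZ; pose iF := subfield_val P1 PB PV PZ.
have Gam_fun x y y' : Gam x y -> Gam x y' -> y = y'.
  by move=> xy xy'; apply/eqP; rewrite -subr_eq0; apply/eqP/G0; rewrite -(subrr x); exact: GB.
have Gam00 : Gam 0 0 by rewrite -(subrr (1 : F)) -(subrr (1 : G)); exact: GB.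
have GamD x y x' y' : Gam x y -> Gam x' y' -> Gam (x + x') (y + y').
  move=> xy xy'; rewrite -[x']opprK -[y']opprK -[- x']sub0r -[- y']sub0r.
  by apply: (GB) => //; exact: GB.
have GamM x y x' y' : Gam x y -> Gam x' y' -> Gam (x * x') (y * y').
  move=> xy xy'; rewrite -[x']invrK -[y']invrK -[x'^-1]mul1r -[y'^-1]mul1r.
  by apply: (GV) => //; exact: GV.
have /choice[iG iGP] : forall w : K, exists y, Gam (iF w) y by exact: subfield_valP.
have iGE w y : Gam (iF w) y -> iG w = y by exact: Gam_fun (iGP w).
have iGD : {morph iG : x y / x + y} by move=> x y; apply: iGE; rewrite rmorphD; exact: GamD (iGP x) (iGP y).
have iGM : {morph iG : x y / x * y} by move=> x y; apply: iGE; rewrite rmorphM; exact: GamM (iGP x) (iGP y).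
have iG1 : iG 1 = 1 by apply: iGE; rewrite rmorph1.
have iGZ c x : iG (c *: x) = c *: iG x.
  apply: iGE; rewrite linearZ /= -[iF x]mul1r -[iG x]mul1r !scalerAl; exact: GamM (GZ c) (iGP x).
exists K, iF, (mk_lr iGD iGM iG1 iGZ); split=> [w|x y xy]; first by rewrite [X in Gam _ X]mk_lrE; exact: iGP.
have [|w wx] := @subfield_ex k F P P1 PB PV PZ x; first by exists y.
have iFw : iF w = x by exact: wx.
by exists w; split=> //; rewrite mk_lrE; apply: iGE; rewrite iFw.
Qed.

Section AmalgamOverSubstructure.
Context (k : fieldType) (p : nat) (hp : p \in [pchar k]) (d : nat) (B : coordScheme k d).
Hypothesis ker : forall (R : comAlgType k) (x : cs_obj B R), cs_pi x = 0 -> x ^+ p = 0.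
Context (F G : B_field B) (A : F -> G -> Prop).
Notation L := (Ld k d).
Hypothesis A_interp : forall (f : Ld_sym k d) (a : 'I_(@arity L f) -> F) (b : 'I_(@arity L f) -> G),
  (forall i, A (a i) (b i)) -> A (B_interp a) (B_interp b).
Hypothesis A_eq : forall x y x' y', A x y -> A x' y' -> x = x' <-> y = y'.
Hypothesis A_root : forall x y z, A x y -> x = z ^+ p -> exists z', A z z'.
Hypothesis constF : forall x : F,
  Bmap B (twist_incl hp F) (bf_op F x) = sigma p B (x : twist hp F) -> exists z, x = z ^+ p.

Let A0 : A 0 0. Proof. by apply: (@A_interp SZero (fun=> 0) (fun=> 0)) => -[]. Qed.
Let A1 : A 1 1. Proof. by apply: (@A_interp SOne (fun=> 0) (fun=> 0)) => -[]. Qed.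
Let AZ c : A c%:A c%:A. Proof. by apply: (@A_interp (SConst d c) (fun=> 0) (fun=> 0)) => -[]. Qed.
Let AD x y x' y' : A x y -> A x' y' -> A (x + x') (y + y').
Proof.
move=> xy xy'; apply: (@A_interp SAdd (fun i : 'I_2 => if i == ord0 then x else x')
  (fun i : 'I_2 => if i == ord0 then y else y')) => i.
by case: eqP.
Qed.
Let AM x y x' y' : A x y -> A x' y' -> A (x * x') (y * y').
Proof.
move=> xy xy'; apply: (@A_interp SMul (fun i : 'I_2 => if i == ord0 then x else x')
  (fun i : 'I_2 => if i == ord0 then y else y')) => i.
by case: eqP.
Qed.
Let AN x y : A x y -> A (- x) (- y).
Proof. by move=> xy; apply: (@A_interp SOpp (fun=> x) (fun=> y)). Qed.
Let Aop j x y : A x y -> A (bf_ops j x) (bf_ops j y).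
Proof. by move=> xy; apply: (@A_interp (SOp k j) (fun=> x) (fun=> y)). Qed.
Let AX x y n : A x y -> A (x ^+ n) (y ^+ n).
Proof. by move=> xy; elim: n => [|n IH]; rewrite ?exprS; [exact: A1|exact: AM]. Qed.
Let A_neq0 x y : A x y -> x != 0 -> y != 0.
Proof. by move=> xy; apply: contraNneq => y0; apply/eqP/(A_eq xy A0). Qed.

Definition fractions (x : F) (y : G) := exists a a' b b',
  [/\ A a a', A b b', b != 0, x = a / b & y = a' / b'].

Let fracA x y : A x y -> fractions x y.
Proof. by move=> xy; exists x, y, 1, 1; split; rewrite ?divr1 ?oner_neq0. Qed.

(** The correspondence need only be closed under the field operations and the
    operators; passing to fractions gives isomorphic subfields, stable under the
    operators because inverses in the scheme are explicit. *)
Theorem amalgam_over : exists (E : B_field B) (jF : {lrmorphism F -> E}) (jG : {lrmorphism G -> E}),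
  [/\ forall x, Bmap B jF (bf_op F x) = bf_op E (jF x),
      forall y, Bmap B jG (bf_op G y) = bf_op E (jG y) &
      forall x y, A x y -> jF x = jG y].
Proof.
have [||||y|K [iF [iG [iFG KP]]]] := @graph_field k F G fractions.
- exact: (fracA A1).
- move=> x y x' y' [a [a' [b [b' [Aa Ab b0 -> ->]]]]] [c [c' [e [e' [Ac Ae e0 -> ->]]]]].
  have b0' := A_neq0 Ab b0; have e0' := A_neq0 Ae e0.
  exists (a * e + - c * b), (a' * e' + - c' * b'), (b * e), (b' * e').
  split; rewrite ?mulf_neq0 //; try by rewrite -mulNr addf_div.
  - by apply: AD; apply: AM => //; exact: AN.
  - exact: AM.
- move=> x y x' y' [a [a' [b [b' [Aa Ab b0 -> ->]]]]] [c [c' [e [e' [Ac Ae e0 -> ->]]]]].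
  have [c0|c0] := eqVneq c 0.
    have c0' : c' = 0 by apply/(A_eq Ac A0).
    by rewrite c0 c0' !mul0r !invr0 !mulr0; exact: (fracA A0).
  exists (a * e), (a' * e'), (b * c), (b' * c'); split; rewrite ?mulf_neq0 //; try exact: AM.
  - by rewrite invf_div mulf_div.
  - by rewrite invf_div mulf_div.
- by move=> c; exact: (fracA (AZ c)).
- move=> [a [a' [b [b' [Aa Ab b0 /esym/eqP + ->]]]]].
  rewrite mulf_eq0 invr_eq0 (negbTE b0) orbF => /eqP /(A_eq Aa A0) ->.
  by rewrite mul0r.
pose Q (u : cs_obj B F) (v : cs_obj B G) := exists w, Bmap B iF w = u /\ Bmap B iG w = v.
have QM u v u' v' : Q u v -> Q u' v' -> Q (u * u') (v * v').
  by move=> [w [<- <-]] [w' [<- <-]]; exists (w * w'); rewrite !rmorphM.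
have QX u v n : Q u v -> Q (u ^+ n) (v ^+ n).
  by move=> [w [<- <-]]; exists (w ^+ n); rewrite !rmorphXn.
have Qcoord u v : (forall j, fractions (cs_coord j u) (cs_coord j v)) -> Q u v.
  move=> uv; have /choice[w wP] := fun j => KP _ _ (uv j).
  exists (\row_j w j : cs_obj B K); split; apply: cs_eqP => j; rewrite BmapE {1}/cs_coord mxE;
    by have [] := wP j.
have Qop a a' : A a a' -> Q (bf_op F a) (bf_op G a').
  move=> Aa; apply: Qcoord => j; apply: fracA.
  case: (unliftP ord0 j) => [i ->|->]; first exact: Aop.
  have -> : cs_coord ord0 (bf_op F a) = a by exact: bf_opP.
  by have -> : cs_coord ord0 (bf_op G a') = a' by exact: bf_opP.
have op_inv (H : B_field B) (a b : H) : b != 0 ->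
    bf_op H (a / b) = bf_op H a * (bf_op H b ^+ p.-1 * sigma p B b^-1).
  move=> b0; have inv : bf_op H b * (bf_op H b ^+ p.-1 * sigma p B b^-1) = 1.
    apply: (scheme_inverse hp ker); have -> : cs_pi (bf_op H b) = b by exact: bf_opP.
    by rewrite mulfV.
  by rewrite -[in RHS](divfK b0 a) [in RHS]rmorphM /= -mulrA inv mulr1.
have /choice[DK DKP] : forall w : K, exists v, Bmap B iF v = bf_op F (iF w) /\ Bmap B iG v = bf_op G (iG w).
  move=> w; have [a [a' [b [b' [Aa Ab b0 -> ->]]]]] := iFG w.
  rewrite !op_inv ?(A_neq0 Ab) //; apply: (QM); first exact: Qop.
  apply: (QM); first exact/QX/Qop.
  have [|c [<- <-]] := KP b^-1 b'^-1; last by exists (sigma p B c); rewrite !Bmap_sigma.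
  by exists 1, 1, b, b'; rewrite !div1r.
have closedK x z : iF x = z ^+ p -> exists w, x = w ^+ p.
  have [a [a' [b [b' [Aa Ab b0 xE _]]]]] := iFG x; rewrite xE => abz.
  (* a / b is a p-th power only if a b^(p-1) is, and the latter is in A. *)
  have [||z' Az] := @A_root (a * b ^+ p.-1) (a' * b' ^+ p.-1) (z * b).
  - by apply: AM => //; exact: AX.
  - by rewrite exprMn -abz -[in RHS](prednK (p_gt0 hp)) exprS mulrA divfK.
  have [|w [wz _]] := KP z (z' / b'); first by exists (z * b), z', b, b'; rewrite mulfK.
  by exists w; apply: (fmorph_inj iF); rewrite rmorphXn /= wz xE.
have sep := independent_pow ker (@bf_opP _ _ _ F) (fun w => proj1 (DKP w)) closedK constF.
have [E [jF [jG [jFD jGD jK]]]] := amalgamation hp ker (fun w => proj1 (DKP w)) (fun w => proj2 (DKP w)) sep.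
exists E, jF, jG; split=> // x y /fracA/KP[w [<- <-]]; exact: jK.
Qed.

End AmalgamOverSubstructure.

(** * Quantifier elimination *)

Section Transfer.
Context (k : fieldType) (p : nat) (hp : p \in [pchar k]) (d : nat) (B : coordScheme k d).
Hypothesis ker : forall (R : comAlgType k) (x : cs_obj B R), cs_pi x = 0 -> x ^+ p = 0.
Context (BDCF : theory (Ld k d)) (hBDCF : model_companion BDCF (theory_of_B_fields B)).
Notation L := (Ld k d).
Notation Ll := (Ld_lambda0 k d).

Lemma reduct_model (M : structure Ll) : model (add_lambda0 p BDCF) M -> model BDCF (reduct M).
Proof.
move=> mM phi Tphi e; apply/(sat_lift (n := 1)); apply: mM; apply: Or31.
by exists phi.
Qed.

(** The values of the terms in the free variables of [phi] form isomorphic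
    substructures of the two models. The models amalgamate over them, and a model
    of the companion containing the amalgam is an elementary extension of both. *)
Theorem companion_transfer (phi : formula Ll) (M N : structure Ll) (e : nat -> M) (e' : nat -> N) :
  model (add_lambda0 p BDCF) M -> model (add_lambda0 p BDCF) N ->
  (forall psi, qf_over phi psi -> sat e psi <-> sat e' psi) -> sat e phi -> sat e' phi.
Proof.
move=> mM mN same.
have [D DP] := translate (fun m n => lambda0_graph p BDCF m n) phi.
have mM' := reduct_model mM; have mN' := reduct_model mN.
have [F [h [h' [hK h'K hE]]]] := companion_B_field hBDCF mM'.
have [G [g [g' [gK g'K gE]]]] := companion_B_field hBDCF mN'.
pose over (t : term Ll) := forall n, in_term n t -> free_in n phi.
pose A (x : F) (y : G) := exists t, [/\ over t, x = h (eval e t) & y = g (eval e' t)].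
have A_interp (f : Ld_sym k d) (a : 'I_(@arity L f) -> F) (b : 'I_(@arity L f) -> G) :
    (forall i, A (a i) (b i)) -> A (B_interp a) (B_interp b).
  move=> /choice[t tP]; exists (@App Ll (Some f) t); split.
  - by move=> n [i ni]; have [ot _ _] := tP i; exact: ot.
  - have -> : a = (fun i => h (eval e (t i))) by apply/funext => i; have [] := tP i.
    by case: hE => _ hI; symmetry; exact: hI.
  - have -> : b = (fun i => g (eval e' (t i))) by apply/funext => i; have [] := tP i.
    by case: gE => _ gI; symmetry; exact: gI.
have A_eq x y x' y' : A x y -> A x' y' -> x = x' <-> y = y'.
  move=> [t [ot -> ->]] [u [ou -> ->]].
  have [s1 s2] : eval e t = eval e u <-> eval e' t = eval e' u.
    by apply: (same (Eq t u)); split=> // n [/ot|/ou].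
  split; first by move/(can_inj hK)/s1 ->.
  by move/(can_inj gK)/s2 ->.
have A_root x y z : A x y -> x = z ^+ p -> exists z', A z z'.
  move=> [t [ot -> _]] tz; exists (g (eval e' (tlambda0 t))), (tlambda0 t); split=> //.
    by move=> n [_ /ot].
  rewrite /= (lambda0_pow (y := h' z) mM) ?h'K //; apply: (can_inj hK).
  by rewrite tz (embedding_eval _ _ hE) eval_lpow /= h'K.
have constF := companion_constants (hp := hp) hBDCF ker mM' h'K hE.
have am := amalgam_over ker A_interp A_eq A_root constF.
have [E [jF [jG [jFD jGD jA]]]] := am.
have [M' [r [mM1 rE]]] := companion_hull hBDCF E.
have hM := companion_elementary hBDCF mM' mM1 (embedding_comp hE (embedding_comp (B_embedding jFD) rE)).
have gN := companion_elementary hBDCF mN' mM1 (embedding_comp gE (embedding_comp (B_embedding jGD) rE)).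
(* Variables not free in phi are reset, so that the two assignments get equal images. *)
pose restrict (X : structure Ll) (c : nat -> X) n : X :=
  if `[< free_in n phi >] then c n else mzero (reduct X).
have sat_restrict (X : structure Ll) (c : nat -> X) : sat c phi <-> sat (restrict X c) phi.
  by apply: sat_free => n fn; rewrite /restrict asboolT.
move=> /sat_restrict/(DP M mM)/hM satM'.
apply/sat_restrict/(DP N mN)/gN.
suff <- : ((r \o jF) \o h) \o restrict M e = ((r \o jG) \o g) \o restrict N e' by exact: satM'.
apply/funext => n /=; congr r; rewrite /restrict; case: asboolP => fn.
  by apply: jA; exists (Var n); split=> // m /= ->.
have h0 : h (mzero (reduct M)) = 0 by case: hE => _ hI; exact: hI.
have g0 : g (mzero (reduct N)) = 0 by case: gE => _ gI; exact: gI.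
by rewrite h0 g0 !rmorph0.
Qed.

End Transfer.

Theorem theorem2p8 (k : fieldType) (p : nat) (hp : p \in [pchar k])
  (d : nat) (B : coordScheme k d)
  (kalg : closedFieldAlgType k) (hkalg : algebraic_closure kalg)
  (hlocal : local_ring (cs_obj B kalg))
  (hnil : forall b : cs_obj B kalg, (exists n : nat, b ^+ n = 0) <-> b ^+ p = 0)
  (BDCF : theory (Ld k d))
  (hBDCF : model_companion BDCF (theory_of_B_fields B)) :
  eliminates_quantifiers (add_lambda0 p BDCF).
Proof.
have ker : forall (R : comAlgType k) (x : cs_obj B R), cs_pi x = 0 -> x ^+ p = 0.
  by apply: (frobenius_kernel hp (F := kalg)) => x /(ker_pi_nil hlocal)/hnil.
apply: qe_criterion => phi M N e e'.
exact: (companion_transfer hp ker hBDCF).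
Qed.
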